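(* The Steklov spectrum of a rectangle uniquely determines its side lengths. That is, if $\Omega=(-a_1,a_1)\times(-a_2,a_2)$ and $\Omega'=(-a_1',a_1')\times(-a_2',a_2')$, with $a_1,a_2,a_1',a_2'>0$, have the same Steklov spectrum (with multiplicities), then $\{a_1,a_2\}=\{a_1',a_2'\}$ as multisets.
   Context: The Steklov eigenvalues of a bounded Lipschitz domain $\Omega\subset\mathbb{R}^2$ are the real numbers $\sigma$ for which there is a nonzero harmonic function $u$ on $\Omega$ with $\partial_n u=\sigma u$ (a.e.) on $\partial\Omega$, where $\partial_n$ is the outward normal derivative. They form a discrete sequence $0=\sigma_0<\sigma_1\le\sigma_2\le\cdots\nearrow\infty$, repeated according to multiplicity. *)

(* Defs.v *)
From HB Require Import structures.
From mathcomp Require Import all_boot all_order all_algebra.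
From mathcomp Require Import all_classical all_reals all_analysis.
Set Implicit Arguments.
Unset Strict Implicit.
Unset Printing Implicit Defensive.
Import Order.TTheory GRing.Theory Num.Theory.
Import numFieldNormedType.Exports.
Local Open Scope classical_set_scope.
Local Open Scope ring_scope.

Section Steklov.
Context {R : realType}.
Implicit Types (A : set (R * R)) (u phi f g : R * R -> R).

Definition dx u (p : R * R) : R := 'D_((1, 0) : R * R) u p.
Definition dy u (p : R * R) : R := 'D_((0, 1) : R * R) u p.

Definition C1_on A u : Prop := forall p, A p ->
  [/\ derivable u p (1, 0), derivable u p (0, 1),
      {for p, continuous (dx u)} & {for p, continuous (dy u)}].

Definition C2_on A u : Prop := [/\ C1_on A u, C1_on A (dx u) & C1_on A (dy u)].

Definition harmonic_on A u : Prop :=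
  C2_on A u /\ forall p, A p -> dx (dx u) p + dy (dy u) p = 0.

Definition area : set (R * R) -> \bar R :=
  (@lebesgue_measure R \x @lebesgue_measure R)%E.

Definition square_integrable d (T : measurableType d) (mu : set T -> \bar R)
    (D : set T) (h : T -> R) : Prop :=
  measurable_fun D h /\ mu.-integrable D (EFin \o (fun t => h t ^+ 2)).

(* For functions that are C^1 in the open set A, so that the weak gradient is
   the classical one. *)
Definition in_H1 A u : Prop :=
  [/\ square_integrable area A u, square_integrable area A (dx u)
    & square_integrable area A (dy u)].

Definition rectangle (a1 a2 : R) : set (R * R) :=
  `]- a1, a1[%classic `*` `]- a2, a2[%classic.

(* The four open sides of the rectangle, parametrized by arc length: the index
   (true, b) is the vertical side with abscissa a1 or - a1, and (false, b) is
   the horizontal side with ordinate a2 or - a2.  The corners are a null set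
   of the boundary. *)
Definition side (a1 a2 : R) (k : bool * bool) (t : R) : R * R :=
  let s := if k.2 then 1 else - 1 in
  if k.1 then (s * a1, t) else (t, s * a2).

Definition side_dom (a1 a2 : R) (k : bool * bool) : set R :=
  if k.1 then `]- a2, a2[%classic else `]- a1, a1[%classic.

Definition boundary_L2 a1 a2 f : Prop := forall k,
  square_integrable (@lebesgue_measure R) (side_dom a1 a2 k)
    (f \o side a1 a2 k).

Definition boundary_integral a1 a2 f : R :=
  \sum_(k : bool * bool)
    Rintegral (@lebesgue_measure R) (side_dom a1 a2 k) (f \o side a1 a2 k).

Definition boundary_ae_eq a1 a2 f g : Prop := forall k,
  {ae @lebesgue_measure R, forall t, side_dom a1 a2 k t ->
     f (side a1 a2 k t) = g (side a1 a2 k t)}.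

Definition H1_dist2 A u phi : \bar R :=
  (\int[area]_(p in A) ((u p - phi p) ^+ 2 + (dx u p - dx phi p) ^+ 2
                        + (dy u p - dy phi p) ^+ 2)%:E)%E.

Definition boundary_L2_dist2 a1 a2 f g : \bar R :=
  (\sum_(k : bool * bool) \int[@lebesgue_measure R]_(t in side_dom a1 a2 k)
    ((f (side a1 a2 k t) - g (side a1 a2 k t)) ^+ 2)%:E)%E.

(* f is the image of u under the trace operator H^1 -> L^2(boundary), that is,
   under the continuous extension of the restriction of smooth functions. *)
Definition is_trace a1 a2 u f : Prop :=
  boundary_L2 a1 a2 f /\
  exists phi : nat -> R * R -> R,
    [/\ forall m, C1_on setT (phi m),
        H1_dist2 (rectangle a1 a2) u (phi m) @[m --> \oo] --> 0%E
      & boundary_L2_dist2 a1 a2 f (phi m) @[m --> \oo] --> 0%E].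

(* For a harmonic function u in H^1 of a Lipschitz domain, the outward normal
   derivative is defined by Green's formula. *)
Definition is_normal_derivative a1 a2 u g : Prop :=
  boundary_L2 a1 a2 g /\
  forall phi, C1_on setT phi ->
    Rintegral area (rectangle a1 a2)
      (fun p => dx u p * dx phi p + dy u p * dy phi p)
    = boundary_integral a1 a2 (fun p => g p * phi p).

(* The values of u outside of the open rectangle are irrelevant; f and g are
   the Dirichlet and Neumann data of u. *)
Definition steklov_solution a1 a2 (sigma : R) u : Prop :=
  [/\ harmonic_on (rectangle a1 a2) u, in_H1 (rectangle a1 a2) u
    & exists f g : R * R -> R,
      [/\ is_trace a1 a2 u f, is_normal_derivative a1 a2 u g
        & boundary_ae_eq a1 a2 g (fun p => sigma * f p)]].

Definition linearly_independent_on A n (u : 'I_n -> R * R -> R) : Prop :=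
  forall c : 'I_n -> R,
    (forall p, A p -> \sum_(i < n) c i * u i p = 0) -> forall i, c i = 0.

(* The eigenspace of sigma has dimension at least n.  In particular sigma is a
   Steklov eigenvalue if and only if this holds for n = 1. *)
Definition steklov_multiplicity_ge a1 a2 (sigma : R) (n : nat) : Prop :=
  exists u : 'I_n -> R * R -> R,
    (forall i, steklov_solution a1 a2 sigma (u i)) /\
    linearly_independent_on (rectangle a1 a2) u.

Definition same_steklov_spectrum a1 a2 b1 b2 : Prop :=
  forall (sigma : R) (n : nat),
    steklov_multiplicity_ge a1 a2 sigma n <->
    steklov_multiplicity_ge b1 b2 sigma n.

End Steklov.

(* Main.v *)
(** Separating variables, a solution X (x) Y (y) with X'' = - l X, Y'' = l Y and
    Robin conditions X' = +- s X, Y' = +- s Y at the ends is a Steklov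
    eigenfunction.  Conversely, Green's formula applied to an eigenfunction with
    trace f and to any harmonic X (x) Y (y) gives a linear relation between the
    integrals of f against X and Y on the four sides.  When X satisfies the Robin
    condition and no Y does, f is orthogonal to X on both horizontal sides; the
    Robin eigenfunctions being complete on an interval, f vanishes there, and then
    everywhere.  Hence, up to s = 1 / a1 and s = 1 / a2, the eigenvalues are exactly
    the resonances of the separated problem.

    The side lengths are read off the set of resonances.  Large resonances of
    the pair (a, b) satisfy cos (2 s a) ~ 0, and there is one near every large
    (n + 1/2) pi / (2 a).  By simultaneous approximation the spectrum therefore has
    gaps of length almost pi / (2 max), but no longer ones, which determines the
    longer side.  Given the longer side M, the smallest positive resonance
    s = k tanh (k m) = k cot (k M) determines the shorter side m, since it
    increases with m. *)
From HB Require Import structures.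
From mathcomp Require Import all_boot all_order all_algebra.
From mathcomp Require Import all_classical all_reals all_analysis.
From mathcomp Require Import measurable_realfun.
From mathcomp Require Import ring lra zify.
Require Import Defs.
Set Implicit Arguments.
Unset Strict Implicit.
Unset Printing Implicit Defensive.
Import Order.TTheory GRing.Theory Num.Theory.
Import numFieldNormedType.Exports.
Local Open Scope classical_set_scope.
Local Open Scope ring_scope.

(** Completeness of the Robin eigenfunctions is obtained without spectral theory. For s > 0 the
    energy of the Robin problem is indefinite, but only the first two members of the explicit system
    can have negative eigenvalues. After projection on the first n + 2 members, the remainder of a
    C^1 function is controlled by the Wirtinger inequality between n + 2 nodes, and its L^2 norm is
    O (1 / n). This only asks for one root of the Robin equation in each window of length pi / (2
    a), which the intermediate value theorem supplies. At s a = 1 the odd mode is linear, neither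
    trigonometric nor hyperbolic; hence the exclusion of s = 1 / a1 and s = 1 / a2. Both separating
    frequencies avoid these values, one by being large, the other by satisfying s M < 1. An
    eigenfunction is only H^1 up to the boundary, so Green's formula is proved for C^1 functions
    against explicit products and carried over by approximation: only L^2 pairings with fixed
    continuous functions pass to the limit. *)

(** * Continuity rules and integrals over an interval *)

Section ContinuityRules.
Context {R : realType} {T : topologicalType}.
Implicit Types f g : T -> R.

Lemma cvg_expr (D : set_system T) (FD : Filter D)
    (h : T -> R) (l : R) n : h @ D --> l -> (h x ^+ n @[x --> D]) --> l ^+ n.
Proof.
move=> hl; elim: n => [|n IHn]; first by under eq_cvg do rewrite expr0; exact: cvg_cst.
by under eq_cvg do rewrite exprS; rewrite exprS; exact: cvgM.
Qed.

Lemma continuous_mul f g : continuous f -> continuous g ->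
  continuous (fun x => f x * g x).
Proof. by move=> cf cg x; apply: cvgM; [exact: cf|exact: cg]. Qed.

Lemma continuous_add f g : continuous f -> continuous g ->
  continuous (fun x => f x + g x).
Proof. by move=> cf cg x; apply: cvgD; [exact: cf|exact: cg]. Qed.

Lemma continuous_opp f : continuous f -> continuous (fun x => - f x).
Proof. by move=> cf x; apply: cvgN; exact: cf. Qed.

Lemma continuous_expr n f : continuous f -> continuous (fun x => f x ^+ n).
Proof. by move=> cf x; apply: cvg_expr; exact: cf. Qed.

End ContinuityRules.

Lemma continuous_comp_fst {R : realType} (f : R -> R) : continuous f ->
  continuous (fun p : R * R => f p.1).
Proof. by move=> cf p; apply: continuous_comp; [exact: cvg_fst|exact: cf]. Qed.

Lemma continuous_comp_snd {R : realType} (f : R -> R) : continuous f ->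
  continuous (fun p : R * R => f p.2).
Proof. by move=> cf p; apply: continuous_comp; [exact: cvg_snd|exact: cf]. Qed.

Section IntervalIntegral.
Context {R : realType}.
Implicit Types (a b c k x : R) (f g F : R -> R).

(** The interval is open to match [side_dom]; [itg_cc] passes to the closed one, on which the
    fundamental theorem of calculus applies. *)
Definition itg a b f : R :=
  \int[@lebesgue_measure R]_(x in `]a, b[) f x.

Lemma continuous_integrable_cc a b f : continuous f ->
  (@lebesgue_measure R).-integrable `[a, b] (EFin \o f).
Proof.
move=> cf; apply: continuous_compact_integrable; first exact: segment_compact.
exact: continuous_subspaceT.
Qed.

Lemma continuous_integrable a b f : continuous f ->
  (@lebesgue_measure R).-integrable `]a, b[ (EFin \o f).
Proof.
move=> cf; apply: integrableS (@continuous_integrable_cc a b _ cf) => //.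
exact: subset_itv_oo_cc.
Qed.

Lemma itg_cc a b f : continuous f ->
  itg a b f = \int[@lebesgue_measure R]_(x in `[a, b]) f x.
Proof.
move=> cf; rewrite /itg Rintegral_itv_obnd_cbnd; last exact: continuous_integrable.
rewrite Rintegral_itv_bndo_bndc //.
apply: integrableS (@continuous_integrable_cc a b _ cf) => //.
by apply: subset_itvl; rewrite bnd_simp.
Qed.

Lemma eq_itg a b f g : (forall x, a < x < b -> f x = g x) ->
  itg a b f = itg a b g.
Proof.
by move=> fg; apply: eq_Rintegral => x; rewrite inE /= in_itv /=; exact: fg.
Qed.

Lemma itgD a b f g : continuous f -> continuous g ->
  itg a b (fun x => f x + g x) = itg a b f + itg a b g.
Proof. by move=> cf cg; apply: RintegralD => //; exact: continuous_integrable. Qed.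

Lemma itgB a b f g : continuous f -> continuous g ->
  itg a b (fun x => f x - g x) = itg a b f - itg a b g.
Proof. by move=> cf cg; apply: RintegralB => //; exact: continuous_integrable. Qed.

Lemma itgZ a b k f : continuous f ->
  itg a b (fun x => k * f x) = k * itg a b f.
Proof. by move=> cf; apply: RintegralZl => //; exact: continuous_integrable. Qed.

Lemma le_itg a b f g : continuous f -> continuous g ->
  (forall x, a < x < b -> f x <= g x) -> itg a b f <= itg a b g.
Proof.
move=> cf cg fg; apply: le_Rintegral => //; exact: continuous_integrable.
Qed.

Lemma itg_ge0 a b f : (forall x, a < x < b -> 0 <= f x) -> 0 <= itg a b f.
Proof. by move=> f0; apply: Rintegral_ge0 => x /=; rewrite in_itv; exact: f0. Qed.

Lemma itg_split a b c f : continuous f -> a <= b -> b <= c ->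
  itg a c f = itg a b f + itg b c f.
Proof.
move=> cf ab bc.
rewrite !itg_cc //.
have cac := @continuous_integrable_cc a c _ cf.
have cbc := @continuous_integrable_cc b c _ cf.
rewrite -[X in _ + X]Rintegral_itv_obnd_cbnd; last first.
  by apply: integrableS cbc => //; apply: subset_itvr; rewrite bnd_simp.
by rewrite -(Rintegral_itvB cac) ?bnd_simp // addrC subrK.
Qed.

Lemma is_derive_continuous f F : (forall x, is_derive x 1 F (f x)) ->
  continuous F.
Proof.
move=> dF x; apply: differentiable_continuous.
by apply/derivable1_diffP; case: (dF x).
Qed.

Lemma FTC_itg a b f F : a <= b -> continuous f ->
  (forall x, is_derive x 1 F (f x)) -> itg a b f = F b - F a.
Proof.
rewrite le_eqVlt => /predU1P[<- _ _|ab cf dF].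
  by rewrite subrr /itg set_itvoo0 Rintegral_set0.
have cF := is_derive_continuous dF.
rewrite itg_cc // /Rintegral (@continuous_FTC2 _ f F) //.
- exact: continuous_subspaceT.
- split.
  + by move=> x _; case: (dF x).
  + by apply: cvg_at_right_filter; exact: cF.
  + by apply: cvg_at_left_filter; exact: cF.
- by move=> x _; rewrite derive1E; apply: derive_val.
Qed.

Lemma itg_cst b k : 0 <= b -> itg (- b) b (fun=> k) = k * (2 * b).
Proof.
move=> b0; transitivity (k * b - k * - b); last by ring.
have cF : continuous (fun _ : R => k) by move=> x; exact: cvg_cst.
apply: (@FTC_itg _ _ _ (fun x => k * x)) => //; first lra.
by move=> x; apply: is_derive_eq; rewrite /GRing.scale /=; ring.
Qed.

End IntervalIntegral.

(** Syntax-directed. Hypotheses are matched function by function, which is why members of families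
    are instantiated in the context before some calls. *)
Ltac continuity := match goal with
  | H : forall x, continuous_at x ?f |- forall x, continuous_at x ?f => exact H
  | H : forall x, continuous_at x ?f |- forall x, continuous_at x (fun y => ?f y) => exact H
  | |- forall x, continuous_at x (fun _ => ?c) => move=> ?; exact: cvg_cst
  | |- forall x, continuous_at x (fun y => y) => move=> ?; exact: cvg_id
  | |- forall x, continuous_at x (fun y => @?f y * @?g y) =>
      apply: (@continuous_mul _ _ f g); continuity
  | |- forall x, continuous_at x (fun y => @?f y + @?g y) =>
      apply: (@continuous_add _ _ f g); continuity
  | |- forall x, continuous_at x (fun y => - @?f y) =>
      apply: (@continuous_opp _ _ f); continuity
  | |- forall x, continuous_at x (fun y => @?f y ^+ ?n) =>
      apply: (@continuous_expr _ _ n f); continuity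
  | |- forall x, continuous_at x (fun y => ?f y.1) =>
      apply: (@continuous_comp_fst _ f); continuity
  | |- forall x, continuous_at x (fun y => ?f y.2) =>
      apply: (@continuous_comp_snd _ f); continuity
  | H : forall x, continuous_at x _ |- _ => exact: H
  end.

(** * The Wirtinger inequality *)

Section Wirtinger.
Context {R : realType}.
Implicit Types (p q nu x : R) (w dw : R -> R).

(* Adding the total derivative of w^2 nu tan (nu (x - m)), whose integral
   vanishes, turns w'^2 - nu^2 w^2 into the square of w' + nu tan w. *)
Lemma wirtinger p q nu w dw : p <= q -> 0 <= nu -> nu * (q - p) < pi ->
  (forall x, is_derive x 1 w (dw x)) -> continuous dw -> w p = 0 -> w q = 0 ->
  nu ^+ 2 * itg p q (fun x => w x ^+ 2) <= itg p q (fun x => dw x ^+ 2).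
Proof.
rewrite le_eqVlt => /predU1P[<- *|pq nu0 nupi dwE cdw wp wq].
  by rewrite /itg set_itvoo0 !Rintegral_set0 mulr0.
have cw := is_derive_continuous dwE.
pose m := (p + q) / 2.
pose T x := tan (nu * (x - m)).
(* The strict bound on [nu * (q - p)] keeps the tangent regular up to both ends. *)
have cosT x : p <= x <= q -> 0 < cos (nu * (x - m)).
  move=> /andP[px xq]; apply: cos_gt0_pihalf.
  have h1 : nu * (p - m) <= nu * (x - m) by apply: ler_wpM2l => //; lra.
  have h2 : nu * (x - m) <= nu * (q - m) by apply: ler_wpM2l => //; lra.
  have h3 : nu * (p - m) = - (nu * (q - p) / 2) by rewrite /m; field.
  have h4 : nu * (q - m) = nu * (q - p) / 2 by rewrite /m; field.
  by apply/andP; split; lra.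
have dT x : p <= x <= q -> is_derive x 1 T (nu * (1 + T x ^+ 2)).
  move=> /cosT c0; have cn0 : cos (nu * (x - m)) != 0 by rewrite gt_eqF.
  have dt := is_derive_tan cn0.
  rewrite /T -cos2_tan2 // [nu * _]mulrC.
  have di : is_derive x 1 (fun x => nu * (x - m)) nu.
    by apply: is_derive_eq; rewrite /GRing.scale /=; ring.
  exact: (@is_derive1_comp _ tan (fun x => nu * (x - m))).
pose F x := w x ^+ 2 * (nu * T x).
pose f x := 2 * w x * dw x * (nu * T x) + w x ^+ 2 * (nu * (nu * (1 + T x ^+ 2))).
have dF x : p <= x <= q -> is_derive x 1 F (f x).
  move=> /dT dTx; have dwx := dwE x; rewrite /F /f; apply: is_derive_eq.
  by rewrite /GRing.scale /=; ring.
have cT x : p <= x <= q -> {for x, continuous T}.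
  move=> /dT [dTx _]; apply: differentiable_continuous; exact/derivable1_diffP.
have cF x : p <= x <= q -> {for x, continuous F}.
  move=> /dF [dFx _]; apply: differentiable_continuous; exact/derivable1_diffP.
have cf : {within `[p, q], continuous f}.
  apply: continuous_in_subspaceT => x; rewrite inE /= in_itv /= => /cT cTx.
  rewrite /f; apply: cvgD; apply: cvgM.
  - by apply: cvgM; [apply: cvgM; [exact: cvg_cst|exact: cw]|exact: cdw].
  - by apply: cvgM; [exact: cvg_cst|exact: cTx].
  - by apply: cvg_expr; exact: cw.
  - apply: cvgM; first exact: cvg_cst.
    apply: cvgM; first exact: cvg_cst.
    by apply: cvgD; [exact: cvg_cst|apply: cvg_expr; exact: cTx].
have intf : \int[@lebesgue_measure R]_(x in `[p, q]) f x = 0.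
  rewrite /Rintegral (@continuous_FTC2 _ f F) //.
  - by rewrite /F wp wq expr0n /= !mul0r subrr.
  - split.
    + move=> x; rewrite in_itv /= => /andP[/ltW px /ltW xq].
      by have [] := dF x; rewrite ?px.
    + by apply: cvg_at_right_filter; apply: cF; rewrite lexx ltW.
    + by apply: cvg_at_left_filter; apply: cF; rewrite lexx ltW.
  - move=> x; rewrite in_itv /= => /andP[/ltW px /ltW xq].
    by rewrite derive1E; apply: derive_val; apply: dF; rewrite px.
have cw2 : continuous (fun x => w x ^+ 2) by continuity.
have cdw2 : continuous (fun x => dw x ^+ 2) by continuity.
have cnw : continuous (fun x => nu ^+ 2 * w x ^+ 2) by continuity.
have cg : continuous (fun x => dw x ^+ 2 - nu ^+ 2 * w x ^+ 2) by continuity.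
rewrite -itgZ // -subr_ge0 -itgB // itg_cc // -[leRHS]addr0 -[X in _ + X]intf -RintegralD //.
- apply: Rintegral_ge0 => x _.
  have -> : dw x ^+ 2 - nu ^+ 2 * w x ^+ 2 + f x = (dw x + nu * T x * w x) ^+ 2.
    by rewrite /f; ring.
  exact: sqr_ge0.
- exact: continuous_integrable_cc.
- apply: continuous_compact_integrable => //; exact: segment_compact.
Qed.

End Wirtinger.

(** * The Robin problem on a symmetric interval *)

Section Robin.
Context {R : realType}.
Implicit Types (a s x mu nu : R) (X dX u du w dw : R -> R) (lam e : nat -> R).
Implicit Types (phi dphi : nat -> R -> R).

(** The equation X'' = - l X as a first order system; [l] of either sign covers trigonometric and
    hyperbolic solutions alike. *)
Definition oscillator (l : R) X dX : Prop :=
  (forall x, is_derive x 1 X (dX x)) /\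
  (forall x, is_derive x 1 dX (- (l * X x))).

(** The outward derivative is s times the value, as on the Steklov boundary. For s > 0 the
    associated energy, the integral of X'^2 minus s (X (a)^2 + X (- a)^2), takes negative values. *)
Definition robin a s X dX : Prop :=
  dX a = s * X a /\ dX (- a) = - (s * X (- a)).

Definition dotp a u w : R := itg (- a) a (fun x => u x * w x).

Lemma dotpC a u w : dotp a u w = dotp a w u.
Proof. by apply: eq_itg => x _; rewrite mulrC. Qed.

Lemma oscillator_continuous l X dX : oscillator l X dX ->
  continuous X /\ continuous dX.
Proof.
by move=> [h1 h2]; split; [exact: is_derive_continuous h1|exact: is_derive_continuous h2].
Qed.

(** Integration by parts: the weak form of the Robin problem, tested against an arbitrary C^1
    function u. *)
Lemma robin_form a s (l : R) X dX u du : 0 <= a -> oscillator l X dX ->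
  robin a s X dX -> (forall x, is_derive x 1 u (du x)) -> continuous du ->
  dotp a du dX = l * dotp a u X + s * (u a * X a + u (- a) * X (- a)).
Proof.
move=> a0 oX [rX rX'] du1 cdu.
have [cX cdX] := oscillator_continuous oX.
have cu := is_derive_continuous du1.
have cux : continuous (fun x => u x * X x) by continuity.
have cuy : continuous (fun x => l * (u x * X x)) by continuity.
have cuz : continuous (fun x => du x * dX x) by continuity.
have : itg (- a) a (fun x => du x * dX x - l * (u x * X x)) =
  u a * dX a - u (- a) * dX (- a).
  apply: (@FTC_itg _ _ _ _ (fun x => u x * dX x)); first lra.
    by continuity.
  move=> x; have [_ ddX] := oX; have := ddX x; have := du1 x => ? ?.
  by apply: is_derive_eq; rewrite /GRing.scale /=; ring.
rewrite itgB // itgZ // rX rX' => h; rewrite /dotp.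
by rewrite -[LHS](subrK (l * itg (- a) a (fun x => u x * X x))) h; ring.
Qed.

(** The boundary term of [robin_form] is symmetric in the two functions, so subtracting its two
    instances leaves (l - m) times the product. *)
Lemma robin_orthogonal a s (l m : R) X dX u du : 0 <= a ->
  oscillator l X dX -> robin a s X dX ->
  oscillator m u du -> robin a s u du -> l != m -> dotp a u X = 0.
Proof.
move=> a0 oX rX ou ru lm.
have [cX cdX] := oscillator_continuous oX; have [cu cdu] := oscillator_continuous ou.
have h1 := robin_form a0 oX rX ou.1 cdu.
have h2 := robin_form a0 ou ru oX.1 cdX.
rewrite (dotpC a dX) (dotpC a X) h1 in h2.
have : (l - m) * dotp a u X = 0 by rewrite mulrBl; lra.
by move/eqP; rewrite mulf_eq0 subr_eq0 (negbTE lm) => /eqP.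
Qed.

Lemma is_derive_lincomb n e phi dphi :
  (forall i x, is_derive x 1 (phi i) (dphi i x)) -> forall x,
  is_derive x 1 (fun x => \sum_(i < n) e i * phi i x)
    (\sum_(i < n) e i * dphi i x).
Proof.
move=> dE x; elim: n => [|n IHn].
  by rewrite big_ord0; under eq_fun do rewrite big_ord0; exact: is_derive_cst.
rewrite big_ord_recr /=; under eq_fun do rewrite big_ord_recr /=.
have := dE n x => dn.
by apply: is_derive_eq; rewrite /GRing.scale /=; ring.
Qed.

Lemma continuous_lincomb n e phi : (forall i, continuous (phi i)) ->
  continuous (fun x => \sum_(i < n) e i * phi i x).
Proof.
move=> cphi; elim: n => [|n IHn].
  by under eq_fun do rewrite big_ord0; move=> x; exact: cvg_cst.
have -> : (fun x => \sum_(i < n.+1) e i * phi i x) =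
    (fun x => \sum_(i < n) e i * phi i x + e n * phi n x).
  by apply/funext => x; rewrite big_ord_recr.
have := cphi n => cn; continuity.
Qed.

Lemma itg_lincomb a (b : R) n e phi : (forall i, continuous (phi i)) ->
  itg a b (fun x => \sum_(i < n) e i * phi i x) =
  \sum_(i < n) e i * itg a b (phi i).
Proof.
move=> cphi; elim: n => [|n IHn].
  under eq_itg do rewrite big_ord0; rewrite big_ord0.
  by rewrite /itg /Rintegral integral0.
under eq_itg do rewrite big_ord_recr /=; rewrite big_ord_recr /= -IHn -itgZ //.
have := cphi n => cn.
by rewrite -itgD //; [exact: continuous_lincomb|continuity].
Qed.

Lemma dotp_lincomb a n e phi u : (forall i, continuous (phi i)) ->
  continuous u ->
  dotp a u (fun x => \sum_(i < n) e i * phi i x) =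
  \sum_(i < n) e i * dotp a u (phi i).
Proof.
move=> cphi cu; rewrite /dotp -(@itg_lincomb _ _ _ _ (fun i x => u x * phi i x)).
  apply: eq_itg => x _; rewrite mulr_sumr; apply: eq_bigr => i _; ring.
by move=> i; have := cphi i => ci; continuity.
Qed.

(** The Wirtinger inequality is summed over n + 1 equal cells; zeros at the n + 2 nodes raise the
    admissible [nu] to anything below (n + 1) pi / (2 a). *)
Lemma dirichlet_partition a nu n w dw : 0 < a -> 0 <= nu ->
  nu * (2 * a / n.+1%:R) < pi ->
  (forall x, is_derive x 1 w (dw x)) -> continuous dw ->
  (forall j, (j <= n.+1)%N -> w (- a + j%:R * (2 * a / n.+1%:R)) = 0) ->
  nu ^+ 2 * itg (- a) a (fun x => w x ^+ 2) <= itg (- a) a (fun x => dw x ^+ 2).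
Proof.
move=> a0 nu0 nupi dwE cdw w0.
have cw := is_derive_continuous dwE.
pose d := 2 * a / n.+1%:R; have d0 : 0 < d by rewrite divr_gt0 ?ltr0n //; lra.
have cw2 : continuous (fun x => w x ^+ 2) by continuity.
have cdw2 : continuous (fun x => dw x ^+ 2) by continuity.
have H j : (j <= n.+1)%N ->
  nu ^+ 2 * itg (- a) (- a + j%:R * d) (fun x => w x ^+ 2) <=
  itg (- a) (- a + j%:R * d) (fun x => dw x ^+ 2).
  elim: j => [_|j IHj jn].
    by rewrite mul0r addr0 /itg set_itvoo0 !Rintegral_set0 mulr0.
  have jd : 0 <= j%:R * d by rewrite mulr_ge0 // ltW.
  have jd' : - a + j.+1%:R * d = - a + j%:R * d + d by rewrite -natr1; ring.
  have l1 : - a <= - a + j%:R * d by lra.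
  have l2 : - a + j%:R * d <= - a + j.+1%:R * d by lra.
  rewrite (@itg_split _ (- a) (- a + j%:R * d) (- a + j.+1%:R * d)) //.
  rewrite [leRHS](@itg_split _ (- a) (- a + j%:R * d) (- a + j.+1%:R * d)) // mulrDr.
  apply: lerD; first exact/IHj/ltnW.
  apply: wirtinger => //; last 2 first.
  - exact/w0/ltnW.
  - exact: w0.
  by rewrite jd' addrAC subrr add0r.
have := H n.+1 (leqnn _).
suff -> : - a + n.+1%:R * d = a by [].
by rewrite /d mulrCA divff ?mulr1 ?pnatr_eq0 //; lra.
Qed.

Lemma kernel_row n (M : 'M[R]_(n.+1, n)) :
  exists2 v : 'rV[R]_n.+1, v != 0 & v *m M = 0.
Proof.
exists (nz_row (kermx M)).
  rewrite nz_row_eq0 -mxrank_eq0 mxrank_ker -lt0n subn_gt0 ltnS.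
  exact: rank_leq_col.
by apply/eqP; rewrite -sub_kermx; exact: nz_row_sub.
Qed.

End Robin.

(** * Completeness of Robin eigenfunctions *)

Section RobinCompleteness.
Context {R : realType}.
Implicit Types (a s x mu nu : R) (g dg : R -> R) (lam e : nat -> R).
Implicit Types (phi dphi : nat -> R -> R).

(** The last clause ensures that no eigenvalue is skipped: members 0 to n + 1 lie below the square
    of the largest [nu] allowed by a partition into n + 1 cells. *)
Definition robin_system a s lam phi dphi : Prop :=
  [/\ forall k, oscillator (lam k) (phi k) (dphi k),
      forall k, robin a s (phi k) (dphi k),
      forall j k, (j < k)%N -> lam j < lam k,
      forall k, 0 < dotp a (phi k) (phi k)
    & forall n, lam n.+1 < (n.+1%:R * pi / (2 * a)) ^+ 2].

Lemma dotp_orthogonal_lincomb a s lam phi dphi n e (k : 'I_n) : 0 <= a ->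
  robin_system a s lam phi dphi ->
  dotp a (fun x => \sum_(i < n) e i * phi i x) (phi k) =
  e k * dotp a (phi k) (phi k).
Proof.
move=> a0 [osc rob lamI _ _].
have cphi i := (oscillator_continuous (osc i)).1.
rewrite dotpC dotp_lincomb // (bigD1 k) //= big1 ?addr0 // => i ik.
rewrite (robin_orthogonal a0 (osc i) (rob i) (osc k) (rob k)) ?mulr0 //.
have [h|h|/val_inj h] := ltngtP i k; last by rewrite h eqxx in ik.
  by rewrite lt_eqF // lamI.
by rewrite gt_eqF // lamI.
Qed.

Lemma dotp_sqr_lincomb a s lam phi dphi n e : 0 <= a ->
  robin_system a s lam phi dphi ->
  dotp a (fun x => \sum_(i < n) e i * phi i x)
    (fun x => \sum_(i < n) e i * phi i x) =
  \sum_(i < n) e i ^+ 2 * dotp a (phi i) (phi i).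
Proof.
move=> a0 rs; have [osc rob lamI _ _] := rs.
have cphi i := (oscillator_continuous (osc i)).1.
rewrite dotp_lincomb //; last exact: continuous_lincomb.
by apply: eq_bigr => i _; rewrite (dotp_orthogonal_lincomb _ _ a0 rs) mulrA -expr2.
Qed.

Lemma dotp_sqrD a (c : R) g w : continuous g -> continuous w ->
  dotp a (fun x => c * g x + w x) (fun x => c * g x + w x) =
  c ^+ 2 * dotp a g g + 2 * c * dotp a g w + dotp a w w.
Proof.
move=> cg cw; rewrite /dotp -!itgZ; try by continuity.
rewrite -!itgD; try by continuity.
by apply: eq_itg => x _; ring.
Qed.

(** By [robin_form] each product with a member of the system is [lam i] times an L^2 product plus a
    boundary term; the boundary terms cancel those of the energy, except for the part quadratic in
    g. *)
Lemma energy_lincomb a s lam phi dphi n e (c : R) g dg : 0 <= a ->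
  robin_system a s lam phi dphi ->
  (forall x, is_derive x 1 g (dg x)) -> continuous dg ->
  let w x := c * g x + \sum_(i < n) e i * phi i x in
  let dw x := c * dg x + \sum_(i < n) e i * dphi i x in
  dotp a dw dw - s * (w a ^+ 2 + w (- a) ^+ 2) =
  c ^+ 2 * (dotp a dg dg - s * (g a ^+ 2 + g (- a) ^+ 2)) +
  \sum_(i < n) lam i *
    (2 * c * e i * dotp a g (phi i) + e i ^+ 2 * dotp a (phi i) (phi i)).
Proof.
move=> a0 rs dgE cdg w dw; have [osc rob _ _ _] := rs.
have cphi i := (oscillator_continuous (osc i)).1.
have cdphi i := (oscillator_continuous (osc i)).2.
pose W x := \sum_(i < n) e i * phi i x.
pose dW x := \sum_(i < n) e i * dphi i x.
have cdW : continuous dW by exact: continuous_lincomb.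
have dWE : forall x, is_derive x 1 W (dW x).
  by apply: is_derive_lincomb => i x; case: (osc i).
have form u du : (forall x, is_derive x 1 u (du x)) -> continuous du ->
    dotp a du dW = \sum_(i < n) lam i * (e i * dotp a u (phi i)) +
      s * (u a * W a + u (- a) * W (- a)).
  move=> duE cdu; rewrite dotp_lincomb // /W !mulr_sumr -!big_split /= mulr_sumr.
  rewrite -big_split /=; apply: eq_bigr => i _.
  by rewrite (robin_form a0 (osc i) (rob i) duE cdu); ring.
rewrite dotp_sqrD // (form _ _ dgE cdg) (form _ _ dWE cdW).
under [\sum_(i < n) lam i * (2 * c * e i * _ + _)]eq_bigr do rewrite mulrDr.
rewrite big_split /=.
have -> : \sum_(i < n) lam i * (2 * c * e i * dotp a g (phi i)) =
    2 * c * \sum_(i < n) lam i * (e i * dotp a g (phi i)).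
  by rewrite mulr_sumr; apply: eq_bigr => i _; ring.
have -> : \sum_(i < n) lam i * (e i * dotp a W (phi i)) =
    \sum_(i < n) lam i * (e i ^+ 2 * dotp a (phi i) (phi i)).
  by apply: eq_bigr => i _; rewrite (dotp_orthogonal_lincomb _ _ a0 rs); ring.
rewrite /w -/(W a) -/(W (- a)); ring.
Qed.

(* Among the combinations of g and the first n + 2 members of the system some
   nonzero one vanishes at the n + 2 nodes of the partition, where the
   Wirtinger inequality bounds its energy from below. *)
Lemma robin_bessel a s lam phi dphi nu n g dg : 0 < a ->
  robin_system a s lam phi dphi ->
  (forall x, is_derive x 1 g (dg x)) -> continuous dg ->
  0 <= nu -> lam n.+1 < nu ^+ 2 -> nu < n.+1%:R * pi / (2 * a) ->
  \sum_(i < n.+2) (lam i - nu ^+ 2) *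
    (dotp a g (phi i) ^+ 2 / dotp a (phi i) (phi i)) <=
  dotp a dg dg - s * (g a ^+ 2 + g (- a) ^+ 2) - nu ^+ 2 * dotp a g g.
Proof.
move=> a0 rs dgE cdg nu0 lamnu nuT; have [osc rob lamI n0 _] := rs.
have cphi i := (oscillator_continuous (osc i)).1.
have cdphi i := (oscillator_continuous (osc i)).2.
have cg := is_derive_continuous dgE.
pose node j : R := - a + j%:R * (2 * a / n.+1%:R).
pose M : 'M[R]_(n.+3, n.+2) := \matrix_(i, j)
  (if i == 0%N :> nat then g (node j) else phi i.-1 (node j)).
have [v vn0 vM] := kernel_row M.
pose c := v ord0 ord0; pose e k := v ord0 (inord k.+1).
pose w x := c * g x + \sum_(i < n.+2) e i * phi i x.
pose dw x := c * dg x + \sum_(i < n.+2) e i * dphi i x.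
have cW : continuous (fun x => \sum_(i < n.+2) e i * phi i x).
  exact: continuous_lincomb.
have cdW : continuous (fun x => \sum_(i < n.+2) e i * dphi i x).
  exact: continuous_lincomb.
have eE (i : 'I_n.+2) : v ord0 (lift ord0 i) = e i.
  by rewrite /e; congr (v _ _); apply: val_inj; rewrite /= inordK // ltnS.
have w0 j : (j <= n.+1)%N -> w (node j) = 0.
  move=> jn; have : (v *m M) ord0 (inord j) = 0 by rewrite vM mxE.
  rewrite mxE big_ord_recl !mxE /= inordK // => h; rewrite -[RHS]h /w.
  congr (_ + _); apply: eq_bigr => i _.
  by rewrite !mxE /= eE inordK.
have dwE x : is_derive x 1 w (dw x).
  have := dgE x => d1.
  have : is_derive x 1 (fun x => \sum_(i < n.+2) e i * phi i x)
      (\sum_(i < n.+2) e i * dphi i x).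
    by apply: is_derive_lincomb => i y; case: (osc i).
  move=> d2; rewrite /w /dw; apply: is_derive_eq.
  by rewrite /GRing.scale /=; ring.
have cdw : continuous dw by rewrite /dw; continuity.
have nun : nu * (2 * a / n.+1%:R) < pi.
  have p2a : 0 < 2 * a / n.+1%:R by rewrite divr_gt0 ?ltr0n //; lra.
  rewrite -(ltr_pM2r p2a) in nuT; apply: lt_le_trans nuT _.
  rewrite le_eqVlt; apply/orP; left; apply/eqP; field.
  by rewrite ?pnatr_eq0 ?gt_eqF // ltr_wpDl.
have := dirichlet_partition a0 nu0 nun dwE cdw w0.
have wa : w (- a) = 0 by have := w0 0%N isT; rewrite /node mul0r addr0.
have wa' : w a = 0.
  have := w0 n.+1 (leqnn _); rewrite /node mulrCA divff ?pnatr_eq0 //.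
  by rewrite mulr1; congr (w _ = _); lra.
have := energy_lincomb n.+2 e c (ltW a0) rs dgE cdg.
rewrite /= -/(w a) -/(w (- a)) wa wa' expr0n /= addr0 mulr0 subr0.
have := dotp_sqrD a c cg cW; rewrite (dotp_sqr_lincomb _ _ (ltW a0) rs).
rewrite (@dotp_lincomb _ a n.+2 e phi g) // -/w.
have -> : itg (- a) a (fun x => w x ^+ 2) = dotp a w w.
  by apply: eq_itg => x _; rewrite expr2.
have -> : itg (- a) a (fun x => dw x ^+ 2) = dotp a dw dw.
  by apply: eq_itg => x _; rewrite expr2.
move=> -> ->; set E := dotp a dg dg - _; set G := dotp a g g => H.
have {}H : 0 <= c ^+ 2 * (E - nu ^+ 2 * G) + \sum_(i < n.+2) (lam i - nu ^+ 2) *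
    (2 * c * e i * dotp a g (phi i) + e i ^+ 2 * dotp a (phi i) (phi i)).
  rewrite -subr_ge0 in H; rewrite (le_trans H) // le_eqVlt; apply/orP; left.
  apply/eqP; under [in RHS]eq_bigr do rewrite mulrBl; rewrite sumrB.
  rewrite -mulr_sumr big_split /=.
  under [\sum_(i < n.+2) 2 * c * e i * _]eq_bigr do rewrite -mulrA.
  by rewrite -mulr_sumr; ring.
have lamn (i : 'I_n.+2) : lam i < nu ^+ 2.
  apply: le_lt_trans lamnu; have := ltn_ord i; rewrite ltnS leq_eqVlt.
  by move=> /orP[/eqP ->//|/lamI /ltW].
(* If c = 0 the combination lies in the span of the system, where [lam i < nu ^+ 2] makes the energy
   smaller than nu ^ 2 times the squared norm unless every [e i] vanishes. *)
have [c0|cn0] := eqVneq c 0.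
  case/eqP: vn0; apply/rowP => j; rewrite mxE.
  have e0 (i : 'I_n.+2) : e i = 0.
    have term0 (k : 'I_n.+2) : true ->
        0 <= (nu ^+ 2 - lam k) * (e k ^+ 2 * dotp a (phi k) (phi k)).
      by rewrite mulr_ge0 ?subr_ge0 ?(ltW (lamn k)) // mulr_ge0 ?sqr_ge0 // ltW.
    have S0 : \sum_(i < n.+2) (nu ^+ 2 - lam i) *
        (e i ^+ 2 * dotp a (phi i) (phi i)) = 0.
      apply/eqP; rewrite eq_le sumr_ge0 // andbT.
      rewrite -oppr_ge0 -sumrN; move: H; rewrite c0 expr0n /= mul0r add0r.
      congr (_ <= _); apply: eq_bigr => k _; ring.
    have /eqP := @psumr_eq0P _ _ _ _ term0 S0 i isT.
    rewrite !mulf_eq0 subr_eq0 (gt_eqF (lamn i)) /=.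
    by rewrite (gt_eqF (n0 i)) orbF orbb => /eqP.
  case: (unliftP ord0 j) => [k|] ->; last exact: c0.
  by rewrite eE e0.
have c2 : 0 < c ^+ 2 by rewrite exprn_even_gt0.
(* As [lam i - nu ^+ 2] is negative, completing the square in [e i] bounds each term by its value at
   e i = - c gi / N. *)
rewrite -(ler_pM2l c2) -subr_ge0; apply: (le_trans H).
rewrite lerD2l mulr_sumr -sumrN; apply: ler_sum => i _.
have ni := n0 i; have li := lamn i.
set N := dotp a (phi i) (phi i) in ni *; set gi := dotp a g (phi i).
have -> : - (c ^+ 2 * ((lam i - nu ^+ 2) * (gi ^+ 2 / N))) =
  (lam i - nu ^+ 2) * (- (c ^+ 2 * (gi ^+ 2 / N))) by ring.
rewrite -subr_ge0 -mulrBr nmulr_rge0 ?subr_lt0 //.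
have -> : - (c ^+ 2 * (gi ^+ 2 / N)) - (2 * c * e i * gi + e i ^+ 2 * N) =
  - ((c * gi + e i * N) ^+ 2 / N) by field; rewrite gt_eqF.
by rewrite oppr_le0 divr_ge0 ?sqr_ge0 // ltW.
Qed.

(** L stands for the pairing with an L^2 trace. It takes the same value on g and on the remainder r
    of its projection on the first n + 2 members; [robin_bessel] bounds nu ^ 2 times the squared
    norm of r independently of n, while [nu] grows linearly with n. *)
Lemma robin_complete a s lam phi dphi (K : R) (L : (R -> R) -> R) g dg :
  0 < a -> 0 <= K -> robin_system a s lam phi dphi -> 0 <= lam 2 ->
  (forall (k : R) (f h : R -> R), continuous f -> continuous h ->
    L (fun x => k * f x + h x) = k * L f + L h) ->
  (forall f : R -> R, continuous f -> L f ^+ 2 <= K * dotp a f f) ->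
  (forall k, L (phi k) = 0) ->
  (forall x, is_derive x 1 g (dg x)) -> continuous dg -> L g = 0.
Proof.
move=> a0 K0 rs lam2 Llin Lbd Lphi dgE cdg; have [osc rob lamI n0 lamT] := rs.
have cphi i := (oscillator_continuous (osc i)).1.
have cg := is_derive_continuous dgE.
pose q i := dotp a g (phi i) ^+ 2 / dotp a (phi i) (phi i).
have q0 i : 0 <= q i by rewrite divr_ge0 ?sqr_ge0 // ltW.
have L0 : L (fun=> 0) = 0.
  have cz : continuous (fun _ : R => 0 : R) by continuity.
  have := Llin 1 _ _ cz cz.
  under eq_fun do rewrite mulr0 addr0.
  by rewrite mul1r -{1}[L _]addr0 => /addrI.
have Lsum n e : L (fun x => \sum_(i < n) e i * phi i x) = 0.
  elim: n => [|n IHn].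
    by under eq_fun do rewrite big_ord0.
  have -> : (fun x => \sum_(i < n.+1) e i * phi i x) =
      (fun x => e n * phi n x + \sum_(i < n) e i * phi i x).
    by apply/funext => x; rewrite big_ord_recr addrC.
  by rewrite Llin ?Lphi ?IHn ?mulr0 ?addr0 //; exact: continuous_lincomb.
pose E := dotp a dg dg - s * (g a ^+ 2 + g (- a) ^+ 2).
pose C := E - lam 0%N * q 0%N - lam 1%N * q 1%N.
have main n : L g ^+ 2 * (n.+1%:R * pi / (4 * a)) ^+ 2 <= K * C.
  pose e i := - (dotp a g (phi i) / dotp a (phi i) (phi i)).
  pose r x := 1 * g x + \sum_(i < n.+2) e i * phi i x.
  have cW : continuous (fun x => \sum_(i < n.+2) e i * phi i x).
    exact: continuous_lincomb.
  have cr : continuous r by rewrite /r; continuity.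
  have Lr : L g = L r by rewrite /r Llin // mul1r Lsum addr0.
  have rr : dotp a r r = dotp a g g - \sum_(i < n.+2) q i.
    rewrite dotp_sqrD // (dotp_sqr_lincomb _ _ (ltW a0) rs) dotp_lincomb //.
    rewrite expr1n mul1r mulr1 -addrA; congr (_ + _).
    rewrite mulr_sumr -big_split -sumrN; apply: eq_bigr => i _ /=.
    by rewrite /q /e; field; rewrite gt_eqF.
  have T0 : 0 < n.+1%:R * pi / (2 * a).
    by rewrite divr_gt0 ?mulr_gt0 ?ltr0n ?pi_gt0.
  set T := n.+1%:R * pi / (2 * a) in T0.
  (* The midpoint [nu] of l and T meets both strict bounds of [robin_bessel], and nu >= T / 2 = (n +
     1) pi / (4 a). *)
  pose l := Num.sqrt (Num.max 0 (lam n.+1)).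
  have l0 : 0 <= l by exact: sqrtr_ge0.
  have lT : l < T.
    rewrite -(ltr_pXn2r (n := 2)) ?nnegrE ?(ltW T0) // sqr_sqrtr ?le_max ?lexx //.
    by rewrite gt_max exprn_gt0 //= lamT.
  pose nu := (l + T) / 2.
  have lnu : lam n.+1 < nu ^+ 2.
    apply: (@le_lt_trans _ _ (l ^+ 2)).
      by rewrite sqr_sqrtr le_max lexx ?orbT.
    by rewrite ltr_pXn2r ?nnegrE //; rewrite /nu; lra.
  have nuT : nu < T by rewrite /nu; lra.
  have nu0 : 0 <= nu by rewrite /nu; lra.
  have := robin_bessel a0 rs dgE cdg nu0 lnu nuT; rewrite -/E => H.
  have {}H : nu ^+ 2 * dotp a r r <= E - \sum_(i < n.+2) lam i * q i.
    move: H; under eq_bigr do rewrite mulrBl -/(q _); rewrite sumrB -mulr_sumr rr.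
    rewrite mulrBr; lra.
  have HC : E - \sum_(i < n.+2) lam i * q i <= C.
    rewrite !big_ord_recl /= /C.
    suff : 0 <= \sum_(i < n) lam (lift ord0 (lift ord0 i)) * q (lift ord0 (lift ord0 i)).
      by move=> ?; lra.
    apply: sumr_ge0 => i _; rewrite mulr_ge0 //.
    have [->//|i0] := eqVneq (lift ord0 (lift ord0 i) : nat) 2%N.
    apply/ltW/(le_lt_trans lam2)/lamI; rewrite /= /bump /= !add1n in i0 *.
    by rewrite !ltnS lt0n; move: i0; rewrite !eqSS.
  have r0 : 0 <= dotp a r r.
    by apply: itg_ge0 => x _; rewrite -expr2 sqr_ge0.
  have hn : (n.+1%:R * pi / (4 * a)) ^+ 2 <= nu ^+ 2.
    have -> : n.+1%:R * pi / (4 * a) = T / 2 by rewrite /T; field; rewrite gt_eqF.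
    by rewrite ler_pXn2r ?nnegrE //; rewrite /nu; lra.
  apply: (@le_trans _ _ (K * dotp a r r * nu ^+ 2)).
    by apply: ler_pM; rewrite ?sqr_ge0 // Lr; exact: Lbd.
  rewrite -mulrA ler_wpM2l // mulrC; exact: le_trans H HC.
apply/eqP/contraT => Ln0.
pose c0 := L g ^+ 2 * (pi / (4 * a)) ^+ 2.
have c00 : 0 < c0.
  by rewrite mulr_gt0 ?exprn_even_gt0 //= gt_eqF // divr_gt0 ?pi_gt0 ?mulr_gt0.
have := archi_boundP (normr_ge0 (K * C / c0)); set n := Num.bound _ => hn.
have hn1 : K * C / c0 < n%:R by apply: le_lt_trans hn; exact: ler_norm.
rewrite ltr_pdivrMr // in hn1.
have := main n; have -> : L g ^+ 2 * (n.+1%:R * pi / (4 * a)) ^+ 2 = n.+1%:R ^+ 2 * c0.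
  by rewrite /c0; ring.
move=> h; have : n%:R * c0 <= n.+1%:R ^+ 2 * c0.
  by rewrite ler_pM2r // -natrX ler_nat; nia.
by move=> ?; lra.
Qed.

End RobinCompleteness.

(** * Square integrable functions *)

Section SquareIntegrable.
Context {d} {T : measurableType d} {R : realType}.
Context (mu : {measure set T -> \bar R}).
Implicit Types (D : set T) (f g h : T -> R).

Lemma integrable_scale D (k : R) f : measurable D ->
  mu.-integrable D (EFin \o f) -> mu.-integrable D (EFin \o (fun t => k * f t)).
Proof.
move=> mD fi; rewrite (_ : _ \o _ = fun t => k%:E * (EFin \o f) t)%E //.
exact: integrableZl.
Qed.

Lemma integrable_add D f g : measurable D ->
  mu.-integrable D (EFin \o f) -> mu.-integrable D (EFin \o g) ->
  mu.-integrable D (EFin \o (fun t => f t + g t)).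
Proof.
move=> mD fi gi; rewrite (_ : _ \o _ = (EFin \o f) \+ (EFin \o g))%E //.
exact: integrableD.
Qed.

Lemma square_integrableM D f g : measurable D ->
  square_integrable mu D f -> square_integrable mu D g ->
  mu.-integrable D (EFin \o (fun t => f t * g t)).
Proof.
move=> mD [mf if2] [mg ig2].
have i2 : mu.-integrable D (EFin \o (fun t => f t ^+ 2 + g t ^+ 2)).
  exact: integrable_add.
apply: le_integrable i2 => //.
  by apply/measurable_EFinP; exact: measurable_funM.
move=> t _; rewrite /= lee_fin [leRHS]ger0_norm ?addr_ge0 ?sqr_ge0 //.
rewrite normrM -(real_normK (num_real (f t))) -(real_normK (num_real (g t))).
have := sqr_ge0 (`|f t| - `|g t|); have := sqr_ge0 (`|f t|); have := sqr_ge0 (`|g t|).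
by rewrite sqrrB; set u := `|f t|; set v := `|g t| => ? ? ?; lra.
Qed.

Lemma square_integrable_lincomb D (k : R) f g : measurable D ->
  square_integrable mu D f -> square_integrable mu D g ->
  square_integrable mu D (fun t => f t + k * g t).
Proof.
move=> mD sf sg; have [mf if2] := sf; have [mg ig2] := sg; split.
  by apply: measurable_funD => //; apply: measurable_funM.
have ifg := square_integrableM mD sf sg.
rewrite (_ : (fun _ => _) = fun t => f t ^+ 2 + (2 * k * (f t * g t) + k ^+ 2 * g t ^+ 2)).
  by apply: integrable_add => //; apply: integrable_add => //; exact: integrable_scale.
by apply/funext => t; ring.
Qed.

(** The integral of (f + k g)^2 is nonnegative for every k; k = - B / C gives the bound. If C = 0
    and B were nonzero, k = - (A + 1) / (2 B) would give the value - 1. *)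
Lemma cauchy_schwarz D f g : measurable D ->
  square_integrable mu D f -> square_integrable mu D g ->
  Rintegral mu D (fun t => f t * g t) ^+ 2 <=
  Rintegral mu D (fun t => f t ^+ 2) * Rintegral mu D (fun t => g t ^+ 2).
Proof.
move=> mD sf sg; have [mf if2] := sf; have [mg ig2] := sg.
have ifg := square_integrableM mD sf sg.
set A := Rintegral mu D (fun t => f t ^+ 2).
set B := Rintegral mu D (fun t => f t * g t).
set C := Rintegral mu D (fun t => g t ^+ 2).
have A0 : 0 <= A by apply: Rintegral_ge0 => t _; exact: sqr_ge0.
have C0 : 0 <= C by apply: Rintegral_ge0 => t _; exact: sqr_ge0.
have pos (k : R) : 0 <= A + (2 * k * B + k ^+ 2 * C).
  rewrite -!RintegralZl // -?RintegralD //.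
  - by apply: Rintegral_ge0 => t _; rewrite (_ : _ + _ = (f t + k * g t) ^+ 2) ?sqr_ge0 //; ring.
  - by apply: integrable_add => //; exact: integrable_scale.
  - exact: integrable_scale.
  - exact: integrable_scale.
have [C00|Cn0] := eqVneq C 0.
  rewrite C00 mulr0; have [->|Bn0] := eqVneq B 0; first by rewrite expr0n.
  have := pos (- (A + 1) / (2 * B)); rewrite C00 mulr0 addr0.
  have -> : 2 * (- (A + 1) / (2 * B)) * B = - (A + 1) by field.
  by move=> ?; lra.
have Cp : 0 < C by rewrite lt_neqAle eq_sym Cn0.
have := pos (- B / C).
have -> : A + (2 * (- B / C) * B + (- B / C) ^+ 2 * C) = (A * C - B ^+ 2) / C by field.
by rewrite pmulr_lge0 ?invr_gt0 // subr_ge0.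
Qed.

Lemma Rintegral_mul_cvg D f (fn : nat -> T -> R) g : measurable D ->
  square_integrable mu D f -> (forall m, square_integrable mu D (fn m)) ->
  square_integrable mu D g ->
  (\int[mu]_(t in D) ((f t - fn m t) ^+ 2)%:E)%E @[m --> \oo] --> 0%E ->
  Rintegral mu D (fun t => fn m t * g t) @[m --> \oo] -->
  Rintegral mu D (fun t => f t * g t).
Proof.
move=> mD sf sfn sg /fine_cvg fcv.
set C := Rintegral mu D (fun t => g t ^+ 2).
have C0 : 0 <= C by apply: Rintegral_ge0 => t _; exact: sqr_ge0.
pose y m := Rintegral mu D (fun t => (f t - fn m t) ^+ 2).
have y0 : y m @[m --> \oo] --> (0 : R) by exact: fcv.
have bd m : `|Rintegral mu D (fun t => f t * g t) - Rintegral mu D (fun t => fn m t * g t)|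
    <= Num.sqrt (y m * C).
  have sd := square_integrable_lincomb (-1) mD sf (sfn m).
  have E : (fun t => f t + -1 * fn m t) = (fun t => f t - fn m t).
    by apply/funext => t; rewrite mulN1r.
  rewrite E in sd.
  rewrite -RintegralB //; try exact: square_integrableM.
  under eq_Rintegral do rewrite -mulrBl.
  rewrite -sqrtr_sqr ler_wsqrtr //; exact: cauchy_schwarz.
apply/cvgrPdist_le => e e0.
have : Num.sqrt (y m * C) @[m --> \oo] --> (0 : R).
  rewrite -(sqrtr0 R) -(mul0r C).
  apply: (@cvg_comp _ _ _ (fun m => y m * C) Num.sqrt); last exact: sqrt_continuous.
  by apply: cvgM => //; exact: cvg_cst.
move=> /cvgrPdist_le /(_ _ e0); apply: filterS => m; rewrite sub0r normrN => h.
by apply: le_trans (bd m) _; apply: le_trans h; exact: ler_norm.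
Qed.

Lemma bounded_square_integrable D h : measurable D -> (mu D < +oo)%E ->
  measurable_fun D h -> [bounded h t | t in D] -> square_integrable mu D h.
Proof.
move=> mD muD mh [M [Mr bM]]; split=> //.
apply: measurable_bounded_integrable => //; first exact: measurable_funX.
exists ((`|M| + 1) ^+ 2); split; first exact: num_real.
move=> x hx t Dt; rewrite /= normrX; apply/ltW/le_lt_trans/hx.
rewrite ler_pXn2r ?nnegrE ?addr_ge0 //.
by apply: bM => //; rewrite (le_lt_trans (ler_norm _)) // ltrDl.
Qed.

Lemma cvg0_le_integral D (F G : nat -> T -> R) : measurable D ->
  (forall m, measurable_fun D (F m)) -> (forall m, measurable_fun D (G m)) ->
  (forall m t, 0 <= F m t <= G m t) ->
  (\int[mu]_(t in D) (G m t)%:E)%E @[m --> \oo] --> 0%E ->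
  (\int[mu]_(t in D) (F m t)%:E)%E @[m --> \oo] --> 0%E.
Proof.
move=> mD mF mG FG G0; apply: (squeeze_cvge _ (cvg_cst 0%E) G0).
apply: nearW => m; apply/andP; split.
  by apply: integral_ge0 => t _; rewrite lee_fin; case/andP: (FG m t).
apply: ge0_le_integral => //.
- by move=> t _; rewrite lee_fin; case/andP: (FG m t).
- exact/measurable_EFinP.
- exact/measurable_EFinP.
- by move=> t _; rewrite lee_fin; case/andP: (FG m t).
Qed.

End SquareIntegrable.

(** * Measure and iterated integrals on the plane *)

Section Plane.
Context {R : realType}.
Implicit Types (a b x y : R) (f : R * R -> R) (U : set (R * R)).

(** The sigma-algebra is the product one, so U is written as a countable union of products: over
    each interval with rational ends, the ordinates whose whole horizontal segment lies in U. Taking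
    their interior makes the second factor open, hence measurable. *)
Lemma open_measurable_plane U : open U -> measurable U.
Proof.
move=> oU.
pose S (a b : R) := [set y : R | forall x, a < x < b -> U (x, y)].
have -> : U = \bigcup_(q : rat) \bigcup_(r : rat)
    (`]ratr q, ratr r[%classic `*` (S (ratr q) (ratr r))°).
  apply/seteqP; split=> [[x y] Uxy|[x y] [q _ [r _ [/= xqr Sy]]]]; last first.
    by apply: (interior_subset Sy); rewrite in_itv in xqr.
  have /= := open_nbhs_nbhs (conj oU Uxy).
  case=> -[A B] /= [nA nB] AB.
  have /nbhs_ballP[e /= e0 eA] := nA.
  have /rat_in_itvoo[q] : x - e < x by lra.
  rewrite in_itv /= => /andP[q1 q2].
  have /rat_in_itvoo[r] : x < x + e by lra.
  rewrite in_itv /= => /andP[r1 r2].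
  exists q => //; exists r => //; split => /=; first by rewrite in_itv /= q2 r1.
  apply: filterS nB => z Bz t /andP[t1 t2]; apply: AB; split=> //=; apply: eA.
  by rewrite /ball /= ltr_norml; apply/andP; split; lra.
apply: bigcupT_measurable_rat => q; apply: bigcupT_measurable_rat => r.
apply: measurableX => //; apply: open_measurable; exact: open_interior.
Qed.

Lemma continuous_slice_x f x : continuous f -> continuous (fun y => f (x, y)).
Proof.
move=> cf y; apply: (@cvg_comp _ _ _ (fun z => (x, z)) f _ (nbhs (x, y))).
  by apply: (@cvg_pair _ _ _ _ (nbhs x) (nbhs y)); [exact: cvg_cst|exact: cvg_id].
exact: cf.
Qed.

Lemma continuous_slice_y f y : continuous f -> continuous (fun x => f (x, y)).
Proof.
move=> cf x; apply: (@cvg_comp _ _ _ (fun z => (z, y)) f _ (nbhs (x, y))).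
  by apply: (@cvg_pair _ _ _ _ (nbhs x) (nbhs y)); [exact: cvg_id|exact: cvg_cst].
exact: cf.
Qed.

Lemma continuous_measurable_plane f : continuous f -> measurable_fun setT f.
Proof.
move=> cf mD; apply: (measurability _ (RGenOInfty.measurableE R)) => //.
move=> /= _ [_ [x ->] <-]; rewrite setTI; apply: open_measurable_plane.
by apply: open_comp => //; exact: rray_open.
Qed.

(** [area] itself is registered as a measure, so that the integration lemmas apply to integrals in
    the form used by the definitions. *)
Let area0 : @area R set0 = 0%E. Proof. exact: measure0. Qed.
Let area_ge0 (A : set (R * R)) : (0 <= @area R A)%E. Proof. exact: measure_ge0. Qed.
Let area_sigma : semi_sigma_additive (@area R).
Proof.
exact: (@measure_semi_sigma_additive _ _ _ (@lebesgue_measure R \x @lebesgue_measure R)%E).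
Qed.
HB.instance Definition _ := isMeasure.Build _ _ _ (@area R) area0 area_ge0 area_sigma.

(* The plane carries two convertible sigma-algebras with distinct displays,
   that of R * R and that of the product measure; Defs uses both. *)
Lemma integral_area_display (F : R * R -> \bar R) : (@area R).-integrable setT F ->
  (@lebesgue_measure R \x @lebesgue_measure R)%E.-integrable setT F /\
  (\int[@area R]_z F z = \int[@lebesgue_measure R \x @lebesgue_measure R]_z F z)%E.
Proof.
move=> /integrableP[m1 m2].
(* The identity is measurable from one display to the other; pushing forward along it identifies the
   two integrals. *)
pose phi : measurableTypeR R * measurableTypeR R -> R * R := id.
have mphi : measurable_fun setT phi by move=> _ Y mY; rewrite setTI; exact: mY.
pose nu := (@lebesgue_measure R \x @lebesgue_measure R)%E.
have fi : nu.-integrable setT F.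
  apply/integrableP; split; first by move=> mD Y mY; exact: (m1 mD Y mY).
  have := @ge0_integral_pushforward _
    (default_measure_display, default_measure_display).-prod%mdisp _ (R * R)%type _
    phi mphi nu setT (fun z => `|F z|%E).
  rewrite /= => <- //.
  exact: measurableT_comp.
split=> //; exact: (@integral_pushforward _
  (default_measure_display, default_measure_display).-prod%mdisp _ (R * R)%type _
    phi mphi nu setT F).
Qed.

Lemma Rintegral_area_display (D : set (R * R)) f : measurable D ->
  (@area R).-integrable D (EFin \o f) ->
  Rintegral (@lebesgue_measure R \x @lebesgue_measure R)%E D f =
  Rintegral (@area R) D f.
Proof.
move=> mD fi; rewrite /Rintegral integral_mkcond [in RHS]integral_mkcond.
have [h _] := @integrable_mkcond _ _ _ (@area R) _ (EFin \o f) mD.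
by rewrite (integral_area_display (h fi)).2.
Qed.

Lemma measurable_rectangle a1 a2 : measurable (@rectangle R a1 a2).
Proof. exact: measurableX. Qed.

Lemma area_rectangle_lty a1 a2 : (@area R (rectangle a1 a2) < +oo)%E.
Proof.
have fin (a : R) : @lebesgue_measure R `]- a, a[%classic \is a fin_num.
  by rewrite lebesgue_measure_itv; case: ifP.
rewrite /area /rectangle product_measure1E //.
apply: lte_mul_pinfty; [exact: measure_ge0|exact: fin|].
have := fin a2; rewrite fin_numElt => /andP[_ h]; exact: h.
Qed.

Lemma continuous_square_integrable_plane a1 a2 f : continuous f ->
  square_integrable (@area R) (rectangle a1 a2) f.
Proof.
move=> cf; apply: bounded_square_integrable.
- exact: measurable_rectangle.
- exact: area_rectangle_lty.
- by apply: measurable_funTS; exact: continuous_measurable_plane.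
have cK : compact (`[- a1, a1]%classic `*` `[- a2, a2]%classic : set (R * R)).
  by apply: compact_setX; exact: segment_compact.
have [M [Mr bM]] := compact_bounded (continuous_compact (continuous_subspaceT cf) cK).
exists M; split=> // x Mx p [p1 p2]; apply: bM => //=; exists p => //.
by split; exact: subset_itv_oo_cc.
Qed.

Lemma continuous_integrable_plane a1 a2 f : continuous f ->
  (@area R).-integrable (rectangle a1 a2) (EFin \o f).
Proof.
move=> cf; have mr := measurable_rectangle a1 a2.
have c1 : continuous (fun _ : R * R => 1 : R) by move=> p; exact: cvg_cst.
have := square_integrableM mr (continuous_square_integrable_plane a1 a2 cf)
  (continuous_square_integrable_plane a1 a2 c1).
by under eq_fun do rewrite mulr1.
Qed.

(** Green's formula uses both orders, each partial derivative being integrated first in its own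
    variable. *)
Lemma Fubini_rectangle a1 a2 f : continuous f ->
  Rintegral (@area R) (rectangle a1 a2) f =
    itg (- a1) a1 (fun x => itg (- a2) a2 (fun y => f (x, y))) /\
  Rintegral (@area R) (rectangle a1 a2) f =
    itg (- a2) a2 (fun y => itg (- a1) a1 (fun x => f (x, y))).
Proof.
move=> cf; have mr := measurable_rectangle a1 a2.
have fi := continuous_integrable_plane a1 a2 cf.
have cfx x := @continuous_slice_x f x cf; have cfy y := @continuous_slice_y f y cf.
pose F := (EFin \o f) \_ (rectangle a1 a2).
have [fi2 areaE] : (@lebesgue_measure R \x @lebesgue_measure R)%E.-integrable setT F /\
    (\int[@area R]_z F z = \int[@lebesgue_measure R \x @lebesgue_measure R]_z F z)%E.
  apply: integral_area_display.
  by have [h _] := @integrable_mkcond _ _ _ (@area R) _ (EFin \o f) mr; exact: h.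
split; rewrite /Rintegral [X in fine X = _]integral_mkcond -/F areaE.
  rewrite -(integral12_prod_meas1 fi2).
  rewrite /itg /Rintegral; congr fine.
  rewrite [RHS]integral_mkcond; apply: eq_integral => x _.
  rewrite /fubini_F /patch; case: ifPn => xi; last first.
    apply: integral0_eq => y _ /=.
    rewrite /F /patch; case: ifPn => // /set_mem [/= xi' _].
    by case/negP: xi; exact/mem_set.
  rewrite fineK; last first.
    exact/integrable_fin_num/continuous_integrable.
  rewrite [RHS]integral_mkcond; apply: eq_integral => y _.
  rewrite /patch; congr (if _ then _ else _); apply/idP/idP; rewrite !inE.
    by case.
  by rewrite inE in xi.
rewrite -(integral21_prod_meas1 fi2).
  rewrite /itg /Rintegral; congr fine.
rewrite [RHS]integral_mkcond; apply: eq_integral => y _.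
rewrite /fubini_G /patch; case: ifPn => yi; last first.
  apply: integral0_eq => x _ /=.
  rewrite /F /patch; case: ifPn => // /set_mem [/= _ yi'].
  by case/negP: yi; exact/mem_set.
rewrite fineK; last exact/integrable_fin_num/continuous_integrable.
rewrite [RHS]integral_mkcond; apply: eq_integral => x _.
rewrite /patch; congr (if _ then _ else _); apply/idP/idP; rewrite !inE.
  by case.
by rewrite inE in yi.
Qed.

End Plane.

(** * Partial derivatives as derivatives of slices *)

Section PartialDerivatives.
Context {R : realType}.
Implicit Types (x y l : R) (p : R * R) (u : R * R -> R).

(** The quotients agree as functions of h, so derivability and the derivative transfer in both
    directions between u and its slices. *)
Let quotient_x u x y :
  (fun h : R => h^-1 *: ((u \o shift (x, y)) (h *: ((1, 0) : R * R)) - u (x, y))) =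
  (fun h : R => h^-1 *: (((fun t => u (t, y)) \o shift x) (h *: (1 : R)) - u (x, y))).
Proof.
apply/funext => h; rewrite /shift /=; congr (_ *: (u (_, _) - _)).
by rewrite -[_.2]/(h *: 0) scaler0 add0r.
Qed.

Let quotient_y u x y :
  (fun h : R => h^-1 *: ((u \o shift (x, y)) (h *: ((0, 1) : R * R)) - u (x, y))) =
  (fun h : R => h^-1 *: (((fun t => u (x, t)) \o shift y) (h *: (1 : R)) - u (x, y))).
Proof.
apply/funext => h; rewrite /shift /=; congr (_ *: (u (_, _) - _)).
by rewrite -[_.1]/(h *: 0) scaler0 add0r.
Qed.

Lemma derivable_dx u x y : derivable u (x, y) (1, 0) ->
  is_derive x 1 (fun t => u (t, y)) (dx u (x, y)).
Proof.
by rewrite /dx /derivable /derive quotient_x => h; apply: DeriveDef.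
Qed.

Lemma derivable_dy u x y : derivable u (x, y) (0, 1) ->
  is_derive y 1 (fun t => u (x, t)) (dy u (x, y)).
Proof.
by rewrite /dy /derivable /derive quotient_y => h; apply: DeriveDef.
Qed.

Lemma is_derive_dx u x y l : is_derive x 1 (fun t => u (t, y)) l ->
  derivable u (x, y) (1, 0) /\ dx u (x, y) = l.
Proof.
by case=> h <-; move: h; rewrite /dx /derivable /derive quotient_x.
Qed.

Lemma is_derive_dy u x y l : is_derive y 1 (fun t => u (x, t)) l ->
  derivable u (x, y) (0, 1) /\ dy u (x, y) = l.
Proof.
by case=> h <-; move: h; rewrite /dy /derivable /derive quotient_y.
Qed.

(* u (x', y) - u (x, y) is the sum of a vertical increment, which tends to 0,
   and of a horizontal one, controlled by the local bound of dx u. *)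
Lemma C1_continuous u : C1_on setT u -> continuous u.
Proof.
move=> hu -[x y].
have dxu (a b : R) : is_derive a 1 (fun t => u (t, b)) (dx u (a, b)).
  by apply: derivable_dx; case: (hu (a, b) I).
have cv : (fun t => u (x, t)) t @[t --> y] --> u (x, y).
  have [_ dyu _ _] := hu (x, y) I; have [h _] := derivable_dy dyu.
  by apply: differentiable_continuous; exact/derivable1_diffP.
have [_ _ cdx _] := hu (x, y) I.
apply/cvgrPdist_lt => e e0.
have e2 : 0 < e / 2 by lra.
pose K := `|dx u (x, y)| + 1.
have K0 : 0 < K by rewrite /K; have := normr_ge0 (dx u (x, y)) => ?; lra.
have /cvgrPdist_lt /(_ _ ltr01) /nbhs_ballP[r /= r0 hr] := cdx.
have /cvgrPdist_lt /(_ _ e2) /nbhs_ballP[s /= s0 hs] := cv.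
suff : nbhs ((x, y) : R * R) [set q | `|u (x, y) - u q| < e] by [].
apply/(@nbhs_ballP R (R * R)%type); exists (Num.min (Num.min r s) (e / 2 / K)) => /=.
  by rewrite !lt_min r0 s0 /= divr_gt0.
move=> [x' y'] /= [bx by_].
rewrite /ball /= !lt_min in bx by_.
move: bx by_ => /andP[/andP[xr xs] xe] /andP[/andP[yr ys] ye].
have hy := hs y' ys.
suff hx : `|u (x, y') - u (x', y')| <= K * `|x - x'|.
  have hx2 : `|u (x, y') - u (x', y')| < e / 2.
    by apply: (le_lt_trans hx); rewrite mulrC -ltr_pdivlMr.
  rewrite (_ : _ - _ = (u (x, y) - u (x, y')) + (u (x, y') - u (x', y'))); last by ring.
  by apply: (le_lt_trans (ler_normD _ _)); lra.
have bound z : `|x - z| < r -> `|dx u (z, y')| <= K.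
  move=> xz; have h : `|dx u (x, y) - dx u (z, y')| < 1.
    by apply: (hr (z, y')); split.
  rewrite /K (_ : dx u (z, y') = dx u (x, y) - (dx u (x, y) - dx u (z, y'))); last by ring.
  by apply: (le_trans (ler_normB _ _)); rewrite lerD2l ltW.
have cu : continuous (fun t => u (t, y')).
  by move=> t; apply: differentiable_continuous; apply/derivable1_diffP; case: (dxu t y').
have cmp (a b : R) : a <= b -> (forall z, a <= z <= b -> `|dx u (z, y')| <= K) ->
    `|u (b, y') - u (a, y')| <= K * (b - a).
  move=> ab bd; have [z zab ->] :=
    MVT_segment ab (fun t _ => dxu t y') (continuous_subspaceT cu).
  rewrite normrM [X in _ * X]ger0_norm ?subr_ge0 //.
  by apply: ler_wpM2r; rewrite ?subr_ge0 //; apply: bd; rewrite in_itv in zab.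
have [xx'|x'x] := leP x x'.
  rewrite distrC [`|x - x'|]distrC [X in _ * X]ger0_norm ?subr_ge0 //.
  apply: cmp => // z /andP[z1 z2]; apply: bound.
  by move: xr; rewrite distrC [X in _ -> X < r]distrC !ger0_norm ?subr_ge0 // => h; lra.
rewrite [X in _ * X]ger0_norm ?subr_ge0 ?(ltW x'x) //.
apply: cmp; first exact: ltW; move=> z /andP[z1 z2]; apply: bound.
by move: xr; rewrite !ger0_norm ?subr_ge0 ?(ltW x'x) // => h; lra.
Qed.

Lemma C1_dx_continuous u : C1_on setT u -> continuous (dx u).
Proof. move=> hu p; have [_ _ h _] := hu p I; exact: h. Qed.

Lemma C1_dy_continuous u : C1_on setT u -> continuous (dy u).
Proof. move=> hu p; have [_ _ _ h] := hu p I; exact: h. Qed.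

End PartialDerivatives.

(** * Green's formula for C^1 functions *)

Section Green.
Context {R : realType}.
Implicit Types (x y : R) (p : R * R) (phi : R * R -> R).
Implicit Types (X dX ddX Y dY ddY : R -> R).

Definition C2_with X dX ddX : Prop :=
  [/\ forall x, is_derive x 1 X (dX x), forall x, is_derive x 1 dX (ddX x)
    & continuous ddX].

Lemma C2_with_continuous X dX ddX : C2_with X dX ddX ->
  continuous X /\ continuous dX.
Proof.
by move=> [h1 h2 _]; split; [exact: is_derive_continuous h1|exact: is_derive_continuous h2].
Qed.

(** Divergence theorem for the field phi grad (X Y): F1 is the x-derivative of phi X' Y and F2 the
    y-derivative of phi X Y'. The term with the Laplacian of X Y is kept for the choice X = x ^ 2, Y
    = 1 in [steklov_vanish]. *)
Lemma green_rectangle a1 a2 phi X dX ddX Y dY ddY : 0 <= a1 -> 0 <= a2 ->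
  C1_on setT phi -> C2_with X dX ddX -> C2_with Y dY ddY ->
  Rintegral (@area R) (rectangle a1 a2) (fun p =>
    dx phi p * (dX p.1 * Y p.2) + dy phi p * (X p.1 * dY p.2) +
    phi p * (ddX p.1 * Y p.2 + X p.1 * ddY p.2)) =
  dX a1 * itg (- a2) a2 (fun y => phi (a1, y) * Y y) -
  dX (- a1) * itg (- a2) a2 (fun y => phi (- a1, y) * Y y) +
  (dY a2 * itg (- a1) a1 (fun x => phi (x, a2) * X x) -
  dY (- a2) * itg (- a1) a1 (fun x => phi (x, - a2) * X x)).
Proof.
move=> a10 a20 hphi hX hY.
have [cX cdX] := C2_with_continuous hX; have [cY cdY] := C2_with_continuous hY.
have [XE dXE cddX] := hX; have [YE dYE cddY] := hY.
have cphi := C1_continuous hphi.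
have cdx := C1_dx_continuous hphi; have cdy := C1_dy_continuous hphi.
have dxE x y : is_derive x 1 (fun t => phi (t, y)) (dx phi (x, y)).
  by apply: derivable_dx; case: (hphi (x, y) I).
have dyE x y : is_derive y 1 (fun t => phi (x, t)) (dy phi (x, y)).
  by apply: derivable_dy; case: (hphi (x, y) I).
pose F1 p := (dx phi p * dX p.1 + phi p * ddX p.1) * Y p.2.
pose F2 p := (dy phi p * dY p.2 + phi p * ddY p.2) * X p.1.
have cF1 : continuous F1 by rewrite /F1; continuity.
have cF2 : continuous F2 by rewrite /F2; continuity.
rewrite (_ : (fun p => _) = (fun p => F1 p + F2 p)); last first.
  by apply/funext => p; rewrite /F1 /F2; ring.
rewrite (@RintegralD _ _ _ (@area R)); last 3 first.
- exact: measurable_rectangle.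
- exact: continuous_integrable_plane.
- exact: continuous_integrable_plane.
rewrite (Fubini_rectangle a1 a2 cF1).2 (Fubini_rectangle a1 a2 cF2).1.
have sx x : continuous (fun y => phi (x, y)) by exact: continuous_slice_x.
have sy y : continuous (fun x => phi (x, y)) by exact: continuous_slice_y.
congr (_ + _).
  have h y : itg (- a1) a1 (fun x => F1 (x, y)) =
      dX a1 * (phi (a1, y) * Y y) - dX (- a1) * (phi (- a1, y) * Y y).
    transitivity (phi (a1, y) * dX a1 * Y y - phi (- a1, y) * dX (- a1) * Y y).
      2: by ring.
    apply: (@FTC_itg _ _ _ _ (fun x => phi (x, y) * dX x * Y y)); first lra.
      exact: continuous_slice_y.
    move=> x; have := dxE x y; have := dXE x => ? ?.
    by apply: is_derive_eq; rewrite /F1 /GRing.scale /=; ring.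
  have := sx a1; have := sx (- a1) => c1 c2.
  by under eq_itg do rewrite h; rewrite itgB ?itgZ //; continuity.
have h x : itg (- a2) a2 (fun y => F2 (x, y)) =
    dY a2 * (phi (x, a2) * X x) - dY (- a2) * (phi (x, - a2) * X x).
  transitivity (phi (x, a2) * dY a2 * X x - phi (x, - a2) * dY (- a2) * X x).
    2: by ring.
  apply: (@FTC_itg _ _ _ _ (fun y => phi (x, y) * dY y * X x)); first lra.
    exact: continuous_slice_x.
  move=> y; have := dyE x y; have := dYE y => ? ?.
  by apply: is_derive_eq; rewrite /F2 /GRing.scale /=; ring.
have := sy a2; have := sy (- a2) => c1 c2.
by under eq_itg do rewrite h; rewrite itgB ?itgZ //; continuity.
Qed.

End Green.

(** * Green's formula for traces *)

Section TraceGreen.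
Context {R : realType}.
Implicit Types (a s x y t : R) (u phi f g : R * R -> R) (k : bool * bool).
Implicit Types (X dX ddX Y dY ddY h : R -> R).

Definition side_pairing a1 a2 f k h : R :=
  Rintegral (@lebesgue_measure R) (side_dom a1 a2 k)
    (fun t => f (side a1 a2 k t) * h t).

Lemma side_pairingE a1 a2 f h :
  [/\ side_pairing a1 a2 f (true, true) h = itg (- a2) a2 (fun y => f (a1, y) * h y),
      side_pairing a1 a2 f (true, false) h = itg (- a2) a2 (fun y => f (- a1, y) * h y),
      side_pairing a1 a2 f (false, true) h = itg (- a1) a1 (fun x => f (x, a2) * h x)
    & side_pairing a1 a2 f (false, false) h = itg (- a1) a1 (fun x => f (x, - a2) * h x)].
Proof. by rewrite /side_pairing /side_dom /side /= !mul1r !mulN1r. Qed.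

Lemma measurable_side_dom a1 a2 k : measurable (side_dom a1 a2 k : set R).
Proof. by rewrite /side_dom; case: ifP. Qed.

Lemma continuous_square_integrable (a b : R) h : continuous h ->
  square_integrable (@lebesgue_measure R) `]a, b[ h.
Proof.
move=> ch; have ch2 : continuous (fun x => h x ^+ 2) by continuity.
split; last exact: continuous_integrable.
by have /integrableP[/measurable_EFinP] := @continuous_integrable R a b h ch.
Qed.

Lemma side_dom_square_integrable a1 a2 k h : continuous h ->
  square_integrable (@lebesgue_measure R) (side_dom a1 a2 k) h.
Proof. by rewrite /side_dom; case: ifP => _; exact: continuous_square_integrable. Qed.

Lemma continuous_side f a1 a2 k : continuous f -> continuous (f \o side a1 a2 k).
Proof.
by move=> cf; rewrite /side; case: k.1; [exact: continuous_slice_x|exact: continuous_slice_y].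
Qed.

(** The boundary integral of f times the outward normal derivative of X Y. *)
Definition green_flux a1 a2 f X dX Y dY : R :=
  dX a1 * side_pairing a1 a2 f (true, true) Y -
  dX (- a1) * side_pairing a1 a2 f (true, false) Y +
  (dY a2 * side_pairing a1 a2 f (false, true) X -
   dY (- a2) * side_pairing a1 a2 f (false, false) X).

Lemma side_pairing_cvg a1 a2 f (phi : nat -> R * R -> R) k h :
  boundary_L2 a1 a2 f -> (forall m, continuous (phi m)) ->
  boundary_L2_dist2 a1 a2 f (phi m) @[m --> \oo] --> 0%E -> continuous h ->
  side_pairing a1 a2 (phi m) k h @[m --> \oo] --> side_pairing a1 a2 f k h.
Proof.
move=> fL2 cphi hd ch.
apply: (@Rintegral_mul_cvg _ _ _ (@lebesgue_measure R) _ (f \o side a1 a2 k)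
  (fun m => phi m \o side a1 a2 k)).
- exact: measurable_side_dom.
- exact: fL2.
- by move=> m; apply: side_dom_square_integrable; exact: continuous_side.
- exact: side_dom_square_integrable.
apply: (squeeze_cvge _ (cvg_cst 0%E) hd).
apply: nearW => m; apply/andP; split.
  by apply: integral_ge0 => t _; rewrite lee_fin sqr_ge0.
rewrite /boundary_L2_dist2 (bigD1 k) //= leeDl // sume_ge0 // => j _.
by apply: integral_ge0 => t _; rewrite lee_fin sqr_ge0.
Qed.

Lemma H1_dist2_cvg a1 a2 u (phi : nat -> R * R -> R) :
  in_H1 (rectangle a1 a2) u -> (forall m, C1_on setT (phi m)) ->
  H1_dist2 (rectangle a1 a2) u (phi m) @[m --> \oo] --> 0%E ->
  [/\ (\int[@area R]_(p in rectangle a1 a2) ((u p - phi m p) ^+ 2)%:E)%E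
        @[m --> \oo] --> 0%E,
      (\int[@area R]_(p in rectangle a1 a2) ((dx u p - dx (phi m) p) ^+ 2)%:E)%E
        @[m --> \oo] --> 0%E
    & (\int[@area R]_(p in rectangle a1 a2) ((dy u p - dy (phi m) p) ^+ 2)%:E)%E
        @[m --> \oo] --> 0%E].
Proof.
move=> [[mu _] [mdxu _] [mdyu _]] hphi hd.
have mr : measurable (rectangle a1 a2 : set (R * R)) := @measurable_rectangle R a1 a2.
have m0 (w : R * R -> R) (psi : R * R -> R) : measurable_fun (rectangle a1 a2) w ->
    continuous psi -> measurable_fun (rectangle a1 a2) (fun p => (w p - psi p) ^+ 2).
  move=> mw cpsi; apply: measurable_funX; apply: measurable_funB => //.
  by apply: measurable_funTS; exact: continuous_measurable_plane.
have c0 m := C1_continuous (hphi m).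
have c1 m := C1_dx_continuous (hphi m); have c2 m := C1_dy_continuous (hphi m).
have mG m : measurable_fun (rectangle a1 a2) (fun p => (u p - phi m p) ^+ 2 +
    (dx u p - dx (phi m) p) ^+ 2 + (dy u p - dy (phi m) p) ^+ 2).
  have h0 := m0 _ _ mu (c0 m); have h1 := m0 _ _ mdxu (c1 m).
  exact: (measurable_funD (measurable_funD h0 h1) (m0 _ _ mdyu (c2 m))).
split.
- apply: (cvg0_le_integral mr (fun m => m0 _ _ mu (c0 m)) mG _ hd) => m p.
  by rewrite sqr_ge0 -addrA lerDl addr_ge0 ?sqr_ge0.
- apply: (cvg0_le_integral mr (fun m => m0 _ _ mdxu (c1 m)) mG _ hd) => m p.
  by rewrite sqr_ge0 -addrA addrCA lerDl addr_ge0 ?sqr_ge0.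
- apply: (cvg0_le_integral mr (fun m => m0 _ _ mdyu (c2 m)) mG _ hd) => m p.
  by rewrite sqr_ge0 lerDr addr_ge0 ?sqr_ge0.
Qed.

(** [green_rectangle] holds for the C^1 approximations of u. Its interior terms converge by the H^1
    distance and its boundary terms by the L^2 distance to the trace, all against fixed continuous
    functions. *)
Lemma trace_green a1 a2 u f X dX ddX Y dY ddY : 0 <= a1 -> 0 <= a2 ->
  in_H1 (rectangle a1 a2) u -> is_trace a1 a2 u f ->
  C2_with X dX ddX -> C2_with Y dY ddY ->
  Rintegral (@area R) (rectangle a1 a2) (fun p => dx u p * (dX p.1 * Y p.2)) +
  Rintegral (@area R) (rectangle a1 a2) (fun p => dy u p * (X p.1 * dY p.2)) +
  Rintegral (@area R) (rectangle a1 a2)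
    (fun p => u p * (ddX p.1 * Y p.2 + X p.1 * ddY p.2)) =
  green_flux a1 a2 f X dX Y dY.
Proof.
move=> a10 a20 uH [fL2 [phi [hphi hd1 hd2]]] hX hY.
have [cX cdX] := C2_with_continuous hX; have [cY cdY] := C2_with_continuous hY.
have [_ _ cddX] := hX; have [_ _ cddY] := hY.
have [d0 d1 d2] := H1_dist2_cvg uH hphi hd1.
have mr : measurable (rectangle a1 a2 : set (R * R)) := @measurable_rectangle R a1 a2.
have sq (w : R * R -> R) : continuous w -> square_integrable (@area R) (rectangle a1 a2) w.
  exact: continuous_square_integrable_plane.
have c0 m := C1_continuous (hphi m).
have c1 m := C1_dx_continuous (hphi m); have c2 m := C1_dy_continuous (hphi m).
have [u0 u1 u2] := uH.
have cw1 : continuous (fun p : R * R => dX p.1 * Y p.2) by continuity.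
have cw2 : continuous (fun p : R * R => X p.1 * dY p.2) by continuity.
have cw0 : continuous (fun p : R * R => ddX p.1 * Y p.2 + X p.1 * ddY p.2) by continuity.
have L1 := Rintegral_mul_cvg mr u1 (fun m => sq _ (c1 m)) (sq _ cw1) d1.
have L2 := Rintegral_mul_cvg mr u2 (fun m => sq _ (c2 m)) (sq _ cw2) d2.
have L0 := Rintegral_mul_cvg mr u0 (fun m => sq _ (c0 m)) (sq _ cw0) d0.
have L := cvgD (cvgD L1 L2) L0.
have Foo : Filter \oo by exact: _.
have {}L := L Foo Foo.
have B k h (ch : continuous h) := @side_pairing_cvg a1 a2 f phi k h fL2 c0 hd2 ch.
have RR : green_flux a1 a2 (phi m) X dX Y dY @[m --> \oo] --> green_flux a1 a2 f X dX Y dY.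
  by apply: cvgD; apply: cvgB; apply: cvgM; try exact: cvg_cst; exact: B.
set l := (X in X = _) in L *.
suff L' : green_flux a1 a2 (phi m) X dX Y dY @[m --> \oo] --> l.
  by rewrite -(cvg_lim (@norm_hausdorff _ R) L'); exact: cvg_lim RR.
apply: cvg_trans L; apply: near_eq_cvg; apply: nearW => m /=.
have := green_rectangle a10 a20 (hphi m) hX hY.
rewrite /green_flux.
have [-> -> _ _] := side_pairingE a1 a2 (phi m) Y.
have [_ _ -> ->] := side_pairingE a1 a2 (phi m) X.
move=> <-; have := c0 m; have := c1 m; have := c2 m => cc2 cc1 cc0.
rewrite !(@RintegralD _ _ _ (@area R)) //; apply: continuous_integrable_plane; continuity.
Qed.

End TraceGreen.

(** * The flux identity of a Steklov solution *)

Section SteklovFlux.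
Context {R : realType}.
Implicit Types (a s l x y t : R) (u phi f g : R * R -> R) (k : bool * bool).
Implicit Types (X dX Y dY h dh : R -> R).

Lemma sum_sides (F : bool * bool -> R) : \sum_k F k =
  F (true, true) + F (true, false) + (F (false, true) + F (false, false)).
Proof.
rewrite (eq_bigr (fun k => F (k.1, k.2))) => [|[] //].
by rewrite -(pair_bigA _ (fun i j => F (i, j))) /= !big_bool.
Qed.

Lemma normal_derivative_pairing a1 a2 s u f g phi :
  in_H1 (rectangle a1 a2) u -> boundary_L2 a1 a2 f ->
  is_normal_derivative a1 a2 u g -> boundary_ae_eq a1 a2 g (fun p => s * f p) ->
  C1_on setT phi ->
  Rintegral (@area R) (rectangle a1 a2)
    (fun p => dx u p * dx phi p + dy u p * dy phi p) =
  s * \sum_k side_pairing a1 a2 f k (phi \o side a1 a2 k).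
Proof.
move=> [_ u1 u2] fL2 [gL2 hg] gf hphi.
have mr : measurable (rectangle a1 a2 : set (R * R)) := @measurable_rectangle R a1 a2.
(* The integral in [is_normal_derivative] is taken for the other display of the plane. *)
rewrite -Rintegral_area_display //; last first.
  have sx := continuous_square_integrable_plane a1 a2 (C1_dx_continuous hphi).
  have sy := continuous_square_integrable_plane a1 a2 (C1_dy_continuous hphi).
  exact: (integrable_add mr (square_integrableM mr u1 sx) (square_integrableM mr u2 sy)).
transitivity (boundary_integral a1 a2 (fun p => g p * phi p)); first exact: hg.
rewrite /boundary_integral mulr_sumr.
apply: eq_bigr => k _; have cphi : continuous (phi \o side a1 a2 k).
  by apply: continuous_side; exact: C1_continuous.
have [mf _] := fL2 k; have [mg _] := gL2 k.
have mD := @measurable_side_dom R a1 a2 k.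
have [mphi _] := @side_dom_square_integrable R a1 a2 k _ cphi.
rewrite /side_pairing -RintegralZl //; last first.
  apply: (@square_integrableM _ _ _ (@lebesgue_measure R) _ (f \o side a1 a2 k)) => //.
  exact: side_dom_square_integrable.
rewrite /Rintegral; congr fine; apply: ae_eq_integral => //.
- exact/measurable_EFinP/measurable_funM.
- apply/measurable_EFinP/measurable_funM; first exact: measurable_cst.
  exact: measurable_funM.
have := gf k; apply: negligibleS => t /= h gft; apply: h => Dt.
by rewrite gft // mulrA.
Qed.

Lemma C1_product X dX Y dY : (forall x, is_derive x 1 X (dX x)) -> continuous dX ->
  (forall y, is_derive y 1 Y (dY y)) -> continuous dY ->
  let w := fun p : R * R => X p.1 * Y p.2 in
  [/\ C1_on setT w, dx w = (fun p => dX p.1 * Y p.2)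
    & dy w = (fun p => X p.1 * dY p.2)].
Proof.
move=> dXE cdX dYE cdY w.
have cX := is_derive_continuous dXE; have cY := is_derive_continuous dYE.
have wx p : derivable w p (1, 0) /\ dx w p = dX p.1 * Y p.2.
  case: p => x y; apply: is_derive_dx; rewrite /w /=.
  by have := dXE x => ?; apply: is_derive_eq; rewrite /GRing.scale /=; ring.
have wy p : derivable w p (0, 1) /\ dy w p = X p.1 * dY p.2.
  case: p => x y; apply: is_derive_dy; rewrite /w /=.
  by have := dYE y => ?; apply: is_derive_eq; rewrite /GRing.scale /=; ring.
have dxw : dx w = (fun p => dX p.1 * Y p.2) by apply/funext => p; exact: (wx p).2.
have dyw : dy w = (fun p => X p.1 * dY p.2) by apply/funext => p; exact: (wy p).2.
have c1 : continuous (fun p : R * R => dX p.1 * Y p.2) by continuity.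
have c2 : continuous (fun p : R * R => X p.1 * dY p.2) by continuity.
split=> // p _; split; [exact: (wx p).1|exact: (wy p).1|rewrite dxw; exact: c1|].
by rewrite dyw; exact: c2.
Qed.

(** The Dirichlet integral of u against X Y is computed twice: from the normal derivative of u
    tested on X Y, and from Green's formula against X Y, which is harmonic because the parameters
    are l and - l. *)
Lemma steklov_flux a1 a2 s l u f g X dX Y dY : 0 <= a1 -> 0 <= a2 ->
  in_H1 (rectangle a1 a2) u -> is_trace a1 a2 u f ->
  is_normal_derivative a1 a2 u g ->
  boundary_ae_eq a1 a2 g (fun p => s * f p) ->
  oscillator l X dX -> oscillator (- l) Y dY ->
  (dX a1 - s * X a1) * side_pairing a1 a2 f (true, true) Y -
  (dX (- a1) + s * X (- a1)) * side_pairing a1 a2 f (true, false) Y +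
  ((dY a2 - s * Y a2) * side_pairing a1 a2 f (false, true) X -
  (dY (- a2) + s * Y (- a2)) * side_pairing a1 a2 f (false, false) X) = 0.
Proof.
move=> a10 a20 uH uf ug gf oX oY.
have [cX cdX] := oscillator_continuous oX; have [cY cdY] := oscillator_continuous oY.
have [dXE ddXE] := oX; have [dYE ddYE] := oY.
have hX : C2_with X dX (fun x => - (l * X x)) by split => //; continuity.
have hY : C2_with Y dY (fun y => - (- l * Y y)) by split => //; continuity.
have fL2 := uf.1.
pose w := fun p : R * R => X p.1 * Y p.2.
have [hw dxw dyw] := C1_product dXE cdX dYE cdY.
have c1 : continuous (fun p : R * R => dX p.1 * Y p.2) by continuity.
have c2 : continuous (fun p : R * R => X p.1 * dY p.2) by continuity.
have := normal_derivative_pairing uH fL2 ug gf hw.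
rewrite dxw dyw.
have mr : measurable (rectangle a1 a2 : set (R * R)) := @measurable_rectangle R a1 a2.
have [_ u1 u2] := uH.
have sq (v : R * R -> R) : continuous v -> square_integrable (@area R) (rectangle a1 a2) v.
  exact: continuous_square_integrable_plane.
rewrite (@RintegralD _ _ _ (@area R)) //; last 2 first.
- exact: (square_integrableM mr u1 (sq _ c1)).
- exact: (square_integrableM mr u2 (sq _ c2)).
have := trace_green a10 a20 uH uf hX hY.
rewrite [X in _ + X = _](_ : _ = 0) ?addr0 => [->|]; last first.
  rewrite (_ : (fun p => _) = cst 0); last by apply/funext => p /=; ring.
  by rewrite /Rintegral integral0.
have spZ k h : continuous h -> forall c : R,
    side_pairing a1 a2 f k (fun t => c * h t) = c * side_pairing a1 a2 f k h.
  move=> ch c; rewrite /side_pairing -RintegralZl //; last 2 first.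
  - exact: measurable_side_dom.
  - apply: (@square_integrableM _ _ _ (@lebesgue_measure R) _ (f \o side a1 a2 k)) => //.
      exact: measurable_side_dom.
    exact: side_dom_square_integrable.
  by apply: eq_Rintegral => t _; ring.
rewrite /green_flux sum_sides.
have -> : w \o side a1 a2 (true, true) = (fun t => X a1 * Y t).
  by apply/funext => t; rewrite /w /side /= mul1r.
have -> : w \o side a1 a2 (true, false) = (fun t => X (- a1) * Y t).
  by apply/funext => t; rewrite /w /side /= mulN1r.
have -> : w \o side a1 a2 (false, true) = (fun t => Y a2 * X t).
  by apply/funext => t; rewrite /w /side /= mul1r mulrC.
have -> : w \o side a1 a2 (false, false) = (fun t => Y (- a2) * X t).
  by apply/funext => t; rewrite /w /side /= mulN1r mulrC.
rewrite !spZ // => h; rewrite -[RHS](subrr (s * (X a1 * side_pairing a1 a2 f (true, true) Y +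
  X (- a1) * side_pairing a1 a2 f (true, false) Y +
  (Y a2 * side_pairing a1 a2 f (false, true) X +
  Y (- a2) * side_pairing a1 a2 f (false, false) X)))) -{1}h; ring.
Qed.

End SteklovFlux.

(** * A solution whose trace pairs to zero vanishes *)

Section SteklovVanish.
Context {R : realType}.
Implicit Types (a s x y t : R) (p q : R * R) (u phi f g w : R * R -> R).
Implicit Types (h dh : R -> R) (k : bool * bool).

Lemma continuous_zero_of_Rintegral_sqr a1 a2 w p :
  square_integrable (@area R) (rectangle a1 a2) w -> rectangle a1 a2 p ->
  {for p, continuous w} ->
  Rintegral (@area R) (rectangle a1 a2) (fun q => w q ^+ 2) = 0 -> w p = 0.
Proof.
move=> [mw iw] rp cw int0; apply/eqP/contraT => wp0.
have e0 : 0 < `|w p| / 2 by rewrite divr_gt0 ?normr_gt0.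
case: p rp cw wp0 e0 => x y [/= ] + + cw wp0 e0.
rewrite !in_itv /= => /andP[x1 x2] /andP[y1 y2].
have /cvgrPdist_lt /(_ _ e0) nw := cw.
have /(@nbhs_ballP R (R * R)%type)[r /= r0 hr] : nbhs ((x, y) : R * R)
  [set q | `|w (x, y) - w q| < `|w (x, y)| / 2] by exact: nw.
pose d := Num.min r (Num.min (Num.min (x + a1) (a1 - x)) (Num.min (y + a2) (a2 - y))).
have d0 : 0 < d.
  rewrite !lt_min r0 /= !subr_gt0 x2 y2 !andbT.
  by apply/andP; split; lra.
have : d <= r /\ [/\ d <= x + a1, d <= a1 - x, d <= y + a2 & d <= a2 - y].
  by rewrite /d !ge_min !lexx ?orbT.
move=> [dr [dx1 dx2 dy1 dy2]].
pose B : set (R * R) := `]x - d, x + d[%classic `*` `]y - d, y + d[%classic.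
have mB : measurable B by exact: measurableX.
have BE q : B q -> [/\ rectangle a1 a2 q & (`|w (x, y)| / 2) ^+ 2 <= w q ^+ 2].
  case: q => x' y' [/=]; rewrite !in_itv /= => /andP[h1 h2] /andP[h3 h4].
  split; first by split; rewrite /= in_itv /=; apply/andP; split; lra.
  have /= h : `|w (x, y) - w (x', y')| < `|w (x, y)| / 2.
    by apply: (hr (x', y')); split; rewrite /= /ball /= ltr_norml;
      apply/andP; split; lra.
  rewrite -[leRHS]real_normK ?num_real // ler_pXn2r ?nnegrE ?(ltW e0) //.
  have := ler_normD (w (x, y) - w (x', y')) (w (x', y')); rewrite subrK.
  by move: h; set A := `|w (x, y)|; set C := `|w (x', y')|; move=> h h'; lra.
have : (\int[@area R]_(q in B) ((`|w (x, y)| / 2) ^+ 2)%:E <=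
    \int[@area R]_(q in rectangle a1 a2) (w q ^+ 2)%:E)%E.
  apply: (@le_trans _ _ (\int[@area R]_(q in B) (w q ^+ 2)%:E)%E).
    apply: ge0_le_integral => //.
    - by apply/measurable_EFinP/measurable_funX; apply: measurable_funS mw;
        [exact: measurable_rectangle|move=> ? /BE[]].
    - by move=> ? /BE[_ ?]; rewrite lee_fin.
  apply: ge0_subset_integral => //.
  - exact: measurable_rectangle.
  - exact/measurable_EFinP/measurable_funX.
  - by move=> q _; rewrite lee_fin sqr_ge0.
  - by move=> q /BE[].
rewrite integral_cst //.
have -> : (\int[@area R]_(q in rectangle a1 a2) (w q ^+ 2)%:E = 0)%E.
  rewrite -[LHS]fineK; last by apply: (integrable_fin_num _ iw); exact: measurable_rectangle.
  by move: int0; rewrite /Rintegral => ->.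
set m := (X in (_ * X <= _)%E); have -> : m = (2 * d * (2 * d))%:E.
  rewrite -[m]/(@area R B).
  have leb z : @lebesgue_measure R `]z - d, z + d[%classic = (2 * d)%:E.
    rewrite lebesgue_measure_itv /= lte_fin ifT; last by lra.
    by rewrite -EFinB; congr EFin; ring.
  rewrite /area /B product_measure1E //; transitivity ((2 * d)%:E * (2 * d)%:E)%E => //.
  by congr (_ * _)%E; exact: leb.
rewrite -EFinM lee_fin leNgt => /negP[]; apply: mulr_gt0; first exact: exprn_gt0.
by apply: mulr_gt0; lra.
Qed.

Lemma gradient_zero_constant a1 a2 u : C1_on (rectangle a1 a2) u ->
  (forall p, rectangle a1 a2 p -> dx u p = 0 /\ dy u p = 0) ->
  forall p q, rectangle a1 a2 p -> rectangle a1 a2 q -> u p = u q.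
Proof.
move=> hu du [x y] [x' y'] [/= xr yr] [/= xr' yr'].
have cst1 (v : R -> R) (a : R) : (forall t, - a < t < a -> is_derive t 1 v 0) ->
    forall b c, - a < b < a -> - a < c < a -> v b = v c.
  move=> dv.
  have le b c : - a < b < a -> - a < c < a -> b <= c -> v b = v c.
    move=> /andP[b1 b2] /andP[c1 c2] bc.
    have h t : b <= t <= c -> is_derive t 1 v 0.
      by move=> /andP[t1 t2]; apply: dv; apply/andP; split; lra.
    have [||z _] := @MVT_segment _ v (fun=> 0) b c bc.
    - by move=> t; rewrite in_itv /= => /andP[t1 t2]; apply: h; rewrite !ltW.
    - apply: continuous_in_subspaceT => t; rewrite inE /= in_itv /= => /h [ht _].
      exact/differentiable_continuous/derivable1_diffP.
    by rewrite mul0r => /eqP; rewrite subr_eq0 => /eqP.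
  move=> b c hb hc; have [bc|cb] := leP b c; first exact: le.
  by apply/esym/le => //; exact: ltW.
rewrite !in_itv /= in xr yr xr' yr'.
transitivity (u (x', y)).
  apply: (cst1 (fun t => u (t, y)) a1) => // t ht.
  have rt : rectangle a1 a2 (t, y) by split; rewrite /= in_itv.
  by have [h _ _ _] := hu _ rt; have := derivable_dx h; rewrite (du _ rt).1.
apply: (cst1 (fun t => u (x', t)) a2) => // t ht.
have rt : rectangle a1 a2 (x', t) by split; rewrite /= in_itv.
by have [_ h _ _] := hu _ rt; have := derivable_dy h; rewrite (du _ rt).2.
Qed.

(** A trace orthogonal to C^1 functions on every side makes the gradient of u orthogonal to every
    C^1 gradient, hence, through the approximations of u, to itself. So u is constant, and a last
    use of Green's formula shows that the constant is 0. *)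
Lemma steklov_vanish a1 a2 s u f g : 0 < a1 -> 0 < a2 ->
  harmonic_on (rectangle a1 a2) u -> in_H1 (rectangle a1 a2) u ->
  is_trace a1 a2 u f -> is_normal_derivative a1 a2 u g ->
  boundary_ae_eq a1 a2 g (fun p => s * f p) ->
  (forall k h dh, (forall t, is_derive t 1 h (dh t)) -> continuous dh ->
    side_pairing a1 a2 f k h = 0) ->
  forall p, rectangle a1 a2 p -> u p = 0.
Proof.
move=> a10 a20 [[hu hdxu hdyu] _] uH uf ug gf f0.
have mr : measurable (rectangle a1 a2 : set (R * R)) := @measurable_rectangle R a1 a2.
have [_ u1 u2] := uH.
have sq w : continuous w -> square_integrable (@area R) (rectangle a1 a2) w.
  exact: continuous_square_integrable_plane.
have grad0 phi : C1_on setT phi ->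
    Rintegral (@area R) (rectangle a1 a2) (fun p => dx phi p * dx u p) +
    Rintegral (@area R) (rectangle a1 a2) (fun p => dy phi p * dy u p) = 0.
  move=> hphi; have c1 := C1_dx_continuous hphi; have c2 := C1_dy_continuous hphi.
  rewrite -(@RintegralD _ _ _ (@area R)) //; last 2 first.
  - exact: (square_integrableM mr (sq _ c1) u1).
  - exact: (square_integrableM mr (sq _ c2) u2).
  have := normal_derivative_pairing uH uf.1 ug gf hphi.
  rewrite big1 ?mulr0 => [h|[b b'] _].
    by rewrite -[RHS]h; apply: eq_Rintegral => p _; ring.
  case: b.
    pose c : R := (if b' then 1 else -1) * a1.
    apply: (f0 _ _ (fun t => dy phi (c, t))); last exact: continuous_slice_x.
    by move=> t; have [_ h _ _] := hphi (c, t) I; exact: (derivable_dy h).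
  pose c : R := (if b' then 1 else -1) * a2.
  apply: (f0 _ _ (fun t => dx phi (t, c))); last exact: continuous_slice_y.
  by move=> t; have [h _ _ _] := hphi (t, c) I; exact: (derivable_dx h).
(* [grad0] for the approximations [phi m] of u, in the limit. *)
have grad2 : Rintegral (@area R) (rectangle a1 a2) (fun p => dx u p ^+ 2) +
    Rintegral (@area R) (rectangle a1 a2) (fun p => dy u p ^+ 2) = 0.
  have [_ [phi [hphi hd1 _]]] := uf.
  have [_ d1 d2] := H1_dist2_cvg uH hphi hd1.
  have c1 m := C1_dx_continuous (hphi m); have c2 m := C1_dy_continuous (hphi m).
  have L1 := Rintegral_mul_cvg mr u1 (fun m => sq _ (c1 m)) u1 d1.
  have L2 := Rintegral_mul_cvg mr u2 (fun m => sq _ (c2 m)) u2 d2.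
  have L := cvgD L1 L2.
  have Foo : Filter \oo by exact: _.
  have {}L := L Foo.
  have Z : (0 : R) @[_ --> \oo] --> (0 : R) by exact: cvg_cst.
  rewrite -[LHS]/(Rintegral (@area R) (rectangle a1 a2) (fun p => dx u p * dx u p) +
    Rintegral (@area R) (rectangle a1 a2) (fun p => dy u p * dy u p)).
  rewrite -(cvg_lim (@norm_hausdorff _ R) L); apply/cvg_lim => //.
  apply: cvg_trans Z; apply: near_eq_cvg; apply: nearW => m.
  by rewrite -[LHS](grad0 _ (hphi m)).
have p1 : 0 <= Rintegral (@area R) (rectangle a1 a2) (fun p => dx u p ^+ 2).
  by apply: Rintegral_ge0 => p _; exact: sqr_ge0.
have p2 : 0 <= Rintegral (@area R) (rectangle a1 a2) (fun p => dy u p ^+ 2).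
  by apply: Rintegral_ge0 => p _; exact: sqr_ge0.
have [i1 i2] : Rintegral (@area R) (rectangle a1 a2) (fun p => dx u p ^+ 2) = 0 /\
    Rintegral (@area R) (rectangle a1 a2) (fun p => dy u p ^+ 2) = 0.
  move/eqP: grad2; rewrite (paddr_eq0 p1 p2) => /andP[/eqP h1 /eqP h2].
  split; [exact: h1|exact: h2].
have du p : rectangle a1 a2 p -> dx u p = 0 /\ dy u p = 0.
  move=> rp; have [_ _ cx cy] := hu p rp; split.
    exact: (continuous_zero_of_Rintegral_sqr u1 rp cx i1).
  exact: (continuous_zero_of_Rintegral_sqr u2 rp cy i2).
have ucst := gradient_zero_constant hu du.
(* The Laplacian of x ^ 2 is 2: with zero gradient and zero flux, Green's formula says that the
   integral of 2 u vanishes. *)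
have hX : C2_with (fun x : R => x ^+ 2) (fun x => 2 * x) (fun=> 2).
  split; last by continuity.
    by move=> x; apply: is_derive_eq; rewrite /GRing.scale /=; ring.
  by move=> x; apply: is_derive_eq; rewrite /GRing.scale /=; ring.
have hY : C2_with (fun=> 1 : R) (fun=> 0) (fun=> 0).
  by split; [move=> ?; exact: is_derive_cst|move=> ?; exact: is_derive_cst|continuity].
have := trace_green (ltW a10) (ltW a20) uH uf hX hY.
have [dX1 _ _] := hX; have [dY1 _ _] := hY.
have c2x : continuous (fun x : R => 2 * x) by continuity.
have c0 : continuous (fun _ : R => 0 : R) by continuity.
rewrite /green_flux !(f0 _ _ _ dX1 c2x) !(f0 _ _ _ dY1 c0) !mulr0 !subr0 addr0.
rewrite (_ : Rintegral _ _ _ = 0); last first.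
  rewrite /Rintegral integral0_eq // => p rp.
  by rewrite (du p rp).1 mul0r.
rewrite (_ : Rintegral _ _ _ = 0); last first.
  rewrite /Rintegral integral0_eq // => p rp.
  by rewrite (du p rp).2 mul0r.
rewrite !add0r => int0 p rp; move: int0.
have -> : Rintegral (@area R) (rectangle a1 a2)
    (fun q => u q * (2 * 1 + q.1 ^+ 2 * 0)) =
    Rintegral (@area R) (rectangle a1 a2) (fun q => (fun=> 2 * u p) q).
  apply: eq_Rintegral => q; rewrite inE => rq.
  by rewrite (ucst q p rq rp); ring.
have cc : continuous (fun _ : R * R => 2 * u p) by continuity.
rewrite (Fubini_rectangle a1 a2 cc).1.
rewrite !itg_cst; [|exact: ltW|exact: ltW].
have n1 : 2 * a1 != 0 by rewrite mulf_neq0 ?pnatr_eq0 // gt_eqF.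
have n2 : 2 * a2 != 0 by rewrite mulf_neq0 ?pnatr_eq0 // gt_eqF.
move=> /eqP; rewrite mulf_eq0 (negbTE n1) orbF mulf_eq0 (negbTE n2) orbF.
by rewrite mulf_eq0 pnatr_eq0 /= => /eqP.
Qed.

End SteklovVanish.

(** * Separated solutions are eigenfunctions *)

Section SeparatedEigenvalue.
Context {R : realType}.
Implicit Types (a s l x y t : R) (p : R * R) (u phi f g : R * R -> R).
Implicit Types (X dX Y dY : R -> R).

Lemma continuous_boundary_L2 a1 a2 f : continuous f -> boundary_L2 a1 a2 f.
Proof.
by move=> cf k; apply: side_dom_square_integrable; exact: continuous_side.
Qed.

Lemma continuous_is_trace a1 a2 w : C1_on setT w -> is_trace a1 a2 w w.
Proof.
move=> hw; split; first exact/continuous_boundary_L2/C1_continuous.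
exists (fun=> w); split => //.
  rewrite /H1_dist2 (_ : (fun _ : nat => _) = fun=> 0%E); first exact: cvg_cst.
  apply/funext => m; apply: integral0_eq => p _.
  by rewrite !subrr expr0n /= !addr0.
rewrite /boundary_L2_dist2 (_ : (fun _ : nat => _) = fun=> 0%E); first exact: cvg_cst.
apply/funext => m; rewrite big1 // => k _; apply: integral0_eq => t _.
by rewrite subrr expr0n.
Qed.

(** The product is smooth on the whole plane, hence its own trace; [green_rectangle] and the two
    Robin conditions show that s times it is its normal derivative. *)
Lemma separated_solution a1 a2 s l X dX Y dY : 0 < a1 -> 0 < a2 ->
  oscillator l X dX -> oscillator (- l) Y dY ->
  robin a1 s X dX -> robin a2 s Y dY ->
  steklov_solution a1 a2 s (fun p => X p.1 * Y p.2).
Proof.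
move=> a10 a20 oX oY [rX rX'] [rY rY'].
have [cX cdX] := oscillator_continuous oX; have [cY cdY] := oscillator_continuous oY.
have [dXE ddXE] := oX; have [dYE ddYE] := oY.
have cddX : continuous (fun x => - (l * X x)) by continuity.
have cddY : continuous (fun x => - (- l * Y x)) by continuity.
pose w := fun p : R * R => X p.1 * Y p.2.
have [hw dxw dyw] := C1_product dXE cdX dYE cdY.
have [hdx ddxw _] := C1_product ddXE cddX dYE cdY.
have [hdy _ ddyw] := C1_product dXE cdX ddYE cddY.
have cw : continuous w by rewrite /w; continuity.
have cwx : continuous (dx w) by rewrite dxw; continuity.
have cwy : continuous (dy w) by rewrite dyw; continuity.
have sq (v : R * R -> R) : continuous v -> square_integrable (@area R) (rectangle a1 a2) v.
  exact: continuous_square_integrable_plane.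
have mr : measurable (rectangle a1 a2 : set (R * R)) := @measurable_rectangle R a1 a2.
split.
- split; first split.
  + by move=> p _; exact: hw.
  + by rewrite dxw => p _; exact: hdx.
  + by rewrite dyw => p _; exact: hdy.
  + by move=> p _; rewrite dxw dyw ddxw ddyw; ring.
- exact: (And3 (sq _ cw) (sq _ cwx) (sq _ cwy)).
exists w, (fun p => s * w p); split.
- exact: continuous_is_trace.
- have csw : continuous (fun p => s * w p) by continuity.
  split; first exact: continuous_boundary_L2.
  move=> phi hphi; have cphi := C1_continuous hphi.
  have cpx := C1_dx_continuous hphi; have cpy := C1_dy_continuous hphi.
  have cI : continuous (fun p => dx w p * dx phi p + dy w p * dy phi p) by continuity.
  transitivity (Rintegral (@area R) (rectangle a1 a2)
      (fun p => dx w p * dx phi p + dy w p * dy phi p)).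
    by apply: Rintegral_area_display => //; exact: continuous_integrable_plane.
  have hX : C2_with X dX (fun x => - (l * X x)) by split.
  have hY : C2_with Y dY (fun y => - (- l * Y y)) by split.
  have := green_rectangle (ltW a10) (ltW a20) hphi hX hY.
  rewrite (_ : (fun p => _) = (fun p => dx w p * dx phi p + dy w p * dy phi p)); last first.
    by apply/funext => p; rewrite dxw dyw; ring.
  move=> ->; rewrite /boundary_integral sum_sides /side_dom /side /=.
  rewrite rX rX' rY rY' !mul1r !mulN1r !mulNr !opprK.
  have sx x : continuous (fun y => phi (x, y)) by exact: continuous_slice_x.
  have sy y : continuous (fun x => phi (x, y)) by exact: continuous_slice_y.
  have c1 := sx a1; have c2 := sx (- a1); have c3 := sy a2; have c4 := sy (- a2).
  rewrite -!itgZ; try by continuity.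
  congr (_ + _ + (_ + _)).
  + by apply: eq_itg => t _; rewrite /w /=; ring.
  + by apply: eq_itg => t _; rewrite /w /=; ring.
  + by apply: eq_itg => t _; rewrite /w /=; ring.
  + by apply: eq_itg => t _; rewrite /w /=; ring.
- by move=> k; apply: aeW.
Qed.

Lemma steklov_multiplicity_ge1 a1 a2 s :
  steklov_multiplicity_ge a1 a2 s 1 <->
  exists2 u, steklov_solution a1 a2 s u
    & exists2 p, rectangle a1 a2 p & u p != 0.
Proof.
split=> [[u [hu li]]|[u hu [p rp up]]].
  exists (u ord0); first exact: hu.
  have [//|h] := pselect (exists2 p, rectangle a1 a2 p & u ord0 p != 0).
  have /eqP : (1 : R) = 0; last by rewrite oner_eq0.
  apply: (li (fun=> 1) _ ord0) => p rp; rewrite big_ord1 mul1r.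
  by apply/eqP/contraT => up; case: h; exists p.
exists (fun=> u); split=> // c h i; have := h p rp.
by rewrite (ord1 i) big_ord1 => /eqP; rewrite mulf_eq0 (negbTE up) orbF => /eqP.
Qed.

Lemma separated_eigenvalue a1 a2 s l X dX Y dY x y : 0 < a1 -> 0 < a2 ->
  oscillator l X dX -> oscillator (- l) Y dY ->
  robin a1 s X dX -> robin a2 s Y dY ->
  - a1 < x < a1 -> X x != 0 -> - a2 < y < a2 -> Y y != 0 ->
  steklov_multiplicity_ge a1 a2 s 1.
Proof.
move=> a10 a20 oX oY rX rY hx Xx hy Yy; apply/steklov_multiplicity_ge1.
exists (fun p => X p.1 * Y p.2); first exact: (separated_solution a10 a20 oX oY rX rY).
exists (x, y); last by rewrite mulf_neq0.
by split; rewrite /= in_itv.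
Qed.

End SeparatedEigenvalue.

(** * Excluding eigenvalues by completeness *)

Section NoEigenvalue.
Context {R : realType}.
Implicit Types (a s l x y t : R) (p : R * R) (u f g : R * R -> R).
Implicit Types (X dX Y dY h dh : R -> R) (lam : nat -> R).
Implicit Types (phi dphi : nat -> R -> R).

(** What [steklov_flux] retains about the trace alone, over all separated harmonic functions. *)
Definition flux_vanishes a1 a2 s f : Prop := forall l X dX Y dY,
  oscillator l X dX -> oscillator (- l) Y dY ->
  (dX a1 - s * X a1) * side_pairing a1 a2 f (true, true) Y -
  (dX (- a1) + s * X (- a1)) * side_pairing a1 a2 f (true, false) Y +
  ((dY a2 - s * Y a2) * side_pairing a1 a2 f (false, true) X -
  (dY (- a2) + s * Y (- a2)) * side_pairing a1 a2 f (false, false) X) = 0.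

(* The even and the odd solutions of Y'' = - l Y are unique up to a factor: none
   of them satisfies the Robin condition. *)
Definition nonresonant a s l : Prop :=
  (exists Y dY, [/\ oscillator l Y dY, Y (- a) = Y a, dY (- a) = - dY a
                  & dY a - s * Y a != 0]) /\
  (exists Y dY, [/\ oscillator l Y dY, Y (- a) = - Y a, dY (- a) = dY a
                  & dY a - s * Y a != 0]).

Let even_odd_vanish (e o T B : R) : e != 0 -> o != 0 ->
  e * T + e * B = 0 -> o * T - o * B = 0 -> T = 0 /\ B = 0.
Proof.
move=> e0 o0; rewrite -mulrDr -mulrBr => /eqP; rewrite mulf_eq0 (negbTE e0) /= => /eqP h.
move=> /eqP; rewrite mulf_eq0 (negbTE o0) /= => /eqP h'; split; lra.
Qed.

(** The Robin condition on X removes the vertical sides; the even and the odd Y then annihilate the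
    sum and the difference of the two horizontal pairings. *)
Lemma nonresonant_horizontal a1 a2 s l f X dX : flux_vanishes a1 a2 s f ->
  oscillator l X dX -> robin a1 s X dX -> nonresonant a2 s (- l) ->
  side_pairing a1 a2 f (false, true) X = 0 /\
  side_pairing a1 a2 f (false, false) X = 0.
Proof.
move=> flux oX [rX rX'] [[Ye [dYe [oe e1 e2 en]]] [Yo [dYo [oo o1 o2 on]]]].
have := flux _ _ _ _ _ oX oe; have := flux _ _ _ _ _ oX oo.
rewrite rX rX' e1 e2 o1 o2 !subrr !addNr !mul0r subrr !add0r => ho he.
apply: (even_odd_vanish en on); [rewrite -[RHS]he|rewrite -[RHS]ho]; ring.
Qed.

Lemma nonresonant_vertical a1 a2 s l f Y dY : flux_vanishes a1 a2 s f ->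
  oscillator l Y dY -> robin a2 s Y dY -> nonresonant a1 s (- l) ->
  side_pairing a1 a2 f (true, true) Y = 0 /\
  side_pairing a1 a2 f (true, false) Y = 0.
Proof.
move=> flux oY [rY rY'] [[Xe [dXe [oe e1 e2 en]]] [Xo [dXo [oo o1 o2 on]]]].
have oY' : oscillator (- - l) Y dY by rewrite opprK.
have := flux _ _ _ _ _ oe oY'; have := flux _ _ _ _ _ oo oY'.
rewrite rY rY' e1 e2 o1 o2 !subrr !addNr !mul0r subrr !addr0 => ho he.
apply: (even_odd_vanish en on); [rewrite -[RHS]he|rewrite -[RHS]ho]; ring.
Qed.

(** [robin_complete] with L the pairing with f on one side, bounded by the Cauchy-Schwarz
    inequality; K is the squared norm of f there. A vertical side has half-length a2. *)
Lemma side_pairing_complete a1 a2 s lam phi dphi f k h dh :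
  let a := if k.1 then a2 else a1 in
  0 < a -> boundary_L2 a1 a2 f -> robin_system a s lam phi dphi -> 0 <= lam 2 ->
  (forall i, side_pairing a1 a2 f k (phi i) = 0) ->
  (forall t, is_derive t 1 h (dh t)) -> continuous dh ->
  side_pairing a1 a2 f k h = 0.
Proof.
move=> a a0 fL2 rs lam2 f0 dhE cdh.
pose K := Rintegral (@lebesgue_measure R) (side_dom a1 a2 k) (fun t => f (side a1 a2 k t) ^+ 2).
have K0 : 0 <= K by apply: Rintegral_ge0 => t _; exact: sqr_ge0.
have mD : measurable (side_dom a1 a2 k : set (measurableTypeR R)).
  exact: measurable_side_dom.
have fk : square_integrable (@lebesgue_measure R) (side_dom a1 a2 k) (f \o side a1 a2 k) := fL2 k.
have domE : side_dom a1 a2 k = `]- a, a[%classic by rewrite /side_dom /a; case: k.1.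
apply: (robin_complete a0 K0 rs lam2 (L := side_pairing a1 a2 f k) _ _ f0 dhE cdh).
- move=> c v w cv cw; rewrite /side_pairing.
  have iv := square_integrableM mD fk (@side_dom_square_integrable R a1 a2 k _ cv).
  have iw := square_integrableM mD fk (@side_dom_square_integrable R a1 a2 k _ cw).
  rewrite -RintegralZl // -RintegralD //; last exact: integrable_scale.
  by apply: eq_Rintegral => t _; ring.
- move=> v cv.
  have := cauchy_schwarz mD fk (@side_dom_square_integrable R a1 a2 k _ cv).
  rewrite /dotp /itg -domE => H; apply: (le_trans H).
  by rewrite le_eqVlt; apply/orP; left; apply/eqP; congr (_ * _).
Qed.

Lemma nonresonant_no_eigenvalue a1 a2 s lam1 phi1 dphi1 lam2 phi2 dphi2 :
  0 < a1 -> 0 < a2 ->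
  robin_system a1 s lam1 phi1 dphi1 -> 0 <= lam1 2 ->
  robin_system a2 s lam2 phi2 dphi2 -> 0 <= lam2 2 ->
  (forall i, nonresonant a2 s (- lam1 i)) ->
  (forall i, nonresonant a1 s (- lam2 i)) ->
  ~ steklov_multiplicity_ge a1 a2 s 1.
Proof.
move=> a10 a20 rs1 l1 rs2 l2 n1 n2 /steklov_multiplicity_ge1[u].
move=> [hu uH [f [g [uf ug gf]]]] [p rp /eqP]; apply.
have flux : flux_vanishes a1 a2 s f.
  by move=> l X dX Y dY; exact: (steklov_flux (ltW a10) (ltW a20) uH uf ug gf).
have fL2 := uf.1.
have [q1 r1 _ _ _] := rs1; have [q2 r2 _ _ _] := rs2.
apply: (steklov_vanish a10 a20 hu uH uf ug gf) rp => k h dh dhE cdh.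
have h1 i := nonresonant_horizontal flux (q1 i) (r1 i) (n1 i).
have h2 i := nonresonant_vertical flux (q2 i) (r2 i) (n2 i).
case: k => -[] [].
- exact: (side_pairing_complete (k := (true, true)) a20 fL2 rs2 l2 (fun i => (h2 i).1) dhE).
- exact: (side_pairing_complete (k := (true, false)) a20 fL2 rs2 l2 (fun i => (h2 i).2) dhE).
- exact: (side_pairing_complete (k := (false, true)) a10 fL2 rs1 l1 (fun i => (h1 i).1) dhE).
- exact: (side_pairing_complete (k := (false, false)) a10 fL2 rs1 l1 (fun i => (h1 i).2) dhE).
Qed.

End NoEigenvalue.

(** * Hyperbolic functions and elementary inequalities *)

Section Hyperbolic.
Context {R : realType}.
Implicit Types (t x y z : R).

Definition ch x := (expR x + expR (- x)) / 2.
Definition sh x := (expR x - expR (- x)) / 2.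

Lemma is_derive_expRN x : is_derive x 1 (fun y => expR (- y)) (- expR (- x)).
Proof.
have d1 : is_derive x 1 (fun y : R => - y) (-1) by exact: is_deriveNid.
have d2 := is_derive_expR (- x).
rewrite -mulrN1; exact: (@is_derive1_comp _ expR (fun y : R => - y)).
Qed.

Lemma is_derive_ch x : is_derive x 1 ch (sh x).
Proof.
have := is_derive_expRN x => ?; rewrite /ch /sh; apply: is_derive_eq.
by rewrite /GRing.scale /=; ring.
Qed.

Lemma is_derive_sh x : is_derive x 1 sh (ch x).
Proof.
have := is_derive_expRN x => ?; rewrite /ch /sh; apply: is_derive_eq.
by rewrite /GRing.scale /=; ring.
Qed.

Lemma chN x : ch (- x) = ch x.
Proof. by rewrite /ch opprK addrC. Qed.

Lemma shN x : sh (- x) = - sh x.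
Proof. by rewrite /sh opprK; ring. Qed.

Lemma sh_lt_ch x : sh x < ch x.
Proof. by rewrite /sh /ch; have := expR_gt0 (- x) => ?; lra. Qed.

Lemma ch_gt0 x : 0 < ch x.
Proof. by rewrite /ch; have := expR_gt0 (- x); have := expR_gt0 x => ? ?; lra. Qed.

Lemma sh_gt0 x : 0 < x -> 0 < sh x.
Proof.
move=> x0; have : expR (- x) < expR x by rewrite ltr_expR; lra.
by rewrite /sh => ?; lra.
Qed.

Lemma is_derive_affine (c b x : R) : is_derive x 1 (fun y => c * y + b) c.
Proof. by apply: is_derive_eq; rewrite /GRing.scale /=; ring. Qed.

Lemma le_of_derive_ge0 (f df : R -> R) (x y : R) : x <= y ->
  (forall t, is_derive t 1 f (df t)) -> (forall t, x <= t <= y -> 0 <= df t) ->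
  f x <= f y.
Proof.
move=> xy fE df0; have cf := is_derive_continuous fE.
have [z zxy] := MVT_segment xy (fun t _ => fE t) (continuous_subspaceT cf).
rewrite -subr_ge0 => ->; apply: mulr_ge0; last by lra.
by apply: df0; rewrite in_itv in zxy.
Qed.

Lemma ch_ge1 x : 1 <= ch x.
Proof.
have := expR_ge1Dx x; have := expR_ge1Dx (- x); rewrite /ch => ? ?; lra.
Qed.

Lemma sh_ge x : 0 <= x -> x <= sh x.
Proof.
move=> x0; have : sh 0 - 0 <= sh x - x.
  apply: (@le_of_derive_ge0 (fun t => sh t - t) (fun t => ch t - 1)) => // t.
    have := is_derive_sh t => ?; apply: is_derive_eq; by [].
  by move=> _; have := ch_ge1 t => ?; lra.
have -> : sh 0 = 0 by rewrite /sh oppr0 subrr mul0r.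
by move=> ?; lra.
Qed.

(** The bound tanh x <= x; it rules out the odd hyperbolic mode at low frequency. *)
Lemma sh_le_mul_ch x : 0 <= x -> sh x <= x * ch x.
Proof.
move=> x0; have : 0 * ch 0 - sh 0 <= x * ch x - sh x.
  apply: (@le_of_derive_ge0 (fun t => t * ch t - sh t) (fun t => t * sh t)) => // t.
    have := is_derive_sh t; have := is_derive_ch t => ? ?; apply: is_derive_eq.
    by rewrite /GRing.scale /=; ring.
  by move=> /andP[t0 _]; rewrite mulr_ge0 // (le_trans t0) // sh_ge.
have -> : sh 0 = 0 by rewrite /sh oppr0 subrr mul0r.
by move=> ?; lra.
Qed.

(** The difference of the two sides is sinh (y - x). *)
Lemma tanh_increasing x y : x < y -> sh x * ch y < ch x * sh y.
Proof.
move=> xy; have : 0 < sh (y - x) by apply: sh_gt0; lra.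
suff -> : sh (y - x) = ch x * sh y - sh x * ch y by rewrite subr_gt0.
by rewrite /sh /ch opprB !expRD; field.
Qed.

Lemma cos_ge x : 0 <= x <= pi / 2 -> 1 - x <= cos x.
Proof.
move=> /andP[x0 xpi]; have : cos 0 + 0 <= cos x + x.
  apply: (@le_of_derive_ge0 (fun t => cos t + t) (fun t => - sin t + 1)) => //.
by rewrite cos0 => ?; lra.
Qed.

Lemma sin_le x : 0 <= x -> sin x <= x.
Proof.
move=> x0; have : 0 - sin 0 <= x - sin x.
  apply: (@le_of_derive_ge0 (fun t => t - sin t) (fun t => 1 - cos t)) => //.
by rewrite sin0 => ?; lra.
Qed.

Lemma ivt_zero (f : R -> R) x y : x < y -> continuous f -> 0 < f x -> f y < 0 ->
  exists2 z, x < z < y & f z = 0.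
Proof.
move=> xy cf fx fy.
have [|z zxy fz] := @IVT R f x y 0 (ltW xy) (continuous_subspaceT cf).
  by rewrite ge_min le_max (ltW fx) (ltW fy) orbT.
rewrite in_itv /= in zxy; case/andP: zxy => xz zy; exists z => //.
rewrite !lt_neqAle xz zy !andbT; apply/andP; split; apply/eqP => e.
  by move: fx; rewrite e fz ltxx.
by move: fy; rewrite -e fz ltxx.
Qed.

End Hyperbolic.

(** * Explicit solutions and their parity *)

Section ExplicitOscillators.
Context {R : realType}.
Implicit Types (a b s l k x y z : R) (n m : nat) (X dX h : R -> R).

(* cos (phase n (k * x)) has the parity of n. *)
Definition phase n z : R := z - n%:R * (pi / 2).

Lemma cos_phaseN n z : cos (phase n (- z)) = (-1) ^+ n * cos (phase n z).
Proof.
have -> : phase n (- z) = - (phase n z + pi *+ n) by rewrite /phase -mulr_natr; field.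
by rewrite cosN (alternatingn (@cosDpi R)).
Qed.

Lemma sin_phaseN n z : sin (phase n (- z)) = - ((-1) ^+ n * sin (phase n z)).
Proof.
have -> : phase n (- z) = - (phase n z + pi *+ n) by rewrite /phase -mulr_natr; field.
by rewrite sinN (alternatingn (@sinDpi R)).
Qed.

Lemma is_derive1_affine (f df : R -> R) k b x :
  (forall y, is_derive y 1 f (df y)) ->
  is_derive x 1 (fun y => f (k * y + b)) (k * df (k * x + b)).
Proof.
move=> fE; have d1 := is_derive_affine k b x; have d2 := fE (k * x + b).
by rewrite mulrC; exact: (@is_derive1_comp _ f (fun y => k * y + b)).
Qed.

Lemma trig_oscillator k n :
  oscillator (k ^+ 2) (fun x => cos (phase n (k * x)))
    (fun x => - (k * sin (phase n (k * x)))).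
Proof.
split=> x.
  rewrite -mulrN.
  exact: (@is_derive1_affine cos (fun y => - sin y) k (- (n%:R * (pi / 2))) x (@is_derive_cos R)).
have h : is_derive x 1 (fun y => sin (phase n (k * y))) (k * cos (phase n (k * x))).
  exact: (@is_derive1_affine sin cos k (- (n%:R * (pi / 2))) x (@is_derive_sin R)).
by apply: is_derive_eq; rewrite /GRing.scale /=; ring.
Qed.

Lemma ch_oscillator k : oscillator (- k ^+ 2) (fun x => ch (k * x)) (fun x => k * sh (k * x)).
Proof.
have d f df x : (forall y, is_derive y 1 f (df y)) ->
    is_derive x 1 (fun y => f (k * y)) (k * df (k * x)).
  move=> fE; have := @is_derive1_affine f df k 0 x fE.
  by rewrite addr0; under eq_fun do rewrite addr0.
split=> x; first by apply: d => y; exact: is_derive_ch.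
have := d sh ch x (@is_derive_sh R) => h.
by apply: is_derive_eq; rewrite /GRing.scale /=; ring.
Qed.

Lemma sh_oscillator k : oscillator (- k ^+ 2) (fun x => sh (k * x)) (fun x => k * ch (k * x)).
Proof.
have d f df x : (forall y, is_derive y 1 f (df y)) ->
    is_derive x 1 (fun y => f (k * y)) (k * df (k * x)).
  move=> fE; have := @is_derive1_affine f df k 0 x fE.
  by rewrite addr0; under eq_fun do rewrite addr0.
split=> x; first by apply: d => y; exact: is_derive_sh.
have := d ch sh x (@is_derive_ch R) => h.
by apply: is_derive_eq; rewrite /GRing.scale /=; ring.
Qed.

Lemma trig_robin a s k n :
  - (k * sin (phase n (k * a))) = s * cos (phase n (k * a)) ->
  robin a s (fun x => cos (phase n (k * x))) (fun x => - (k * sin (phase n (k * x)))).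
Proof.
move=> h; split=> //; rewrite mulrN sin_phaseN cos_phaseN.
transitivity (- ((-1) ^+ n * - (k * sin (phase n (k * a))))); first by ring.
by rewrite h; ring.
Qed.

Lemma ch_robin a s k : k * sh (k * a) = s * ch (k * a) ->
  robin a s (fun x => ch (k * x)) (fun x => k * sh (k * x)).
Proof. by move=> h; split=> //; rewrite mulrN shN chN mulrN h. Qed.

Lemma sh_robin a s k : k * ch (k * a) = s * sh (k * a) ->
  robin a s (fun x => sh (k * x)) (fun x => k * ch (k * x)).
Proof. by move=> h; split=> //; rewrite mulrN shN chN h mulrN opprK. Qed.

Lemma cos_robin_neq0 s k z : k != 0 -> - (k * sin z) = s * cos z -> cos z != 0.
Proof.
move=> k0 h; apply/eqP => c0; move: h; rewrite c0 mulr0 => /eqP.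
rewrite oppr_eq0 mulf_eq0 (negbTE k0) /= => /eqP s0.
by have /eqP := cos2Dsin2 z; rewrite c0 s0 expr0n /= addr0 eq_sym oner_eq0.
Qed.

Lemma continuous_near_endpoint a h : 0 < a -> continuous h -> h a != 0 ->
  exists2 d, 0 < d < a & forall x, a - d < x < a -> `|h a| / 2 <= `|h x|.
Proof.
move=> a0 ch hn; have e0 : 0 < `|h a| / 2 by rewrite divr_gt0 ?normr_gt0.
have := ch a; move/cvgrPdist_lt => /(_ _ e0) /nbhs_ballP[r /= r0 hr].
pose d := Num.min r (a / 2); have d0 : 0 < d by rewrite lt_min r0 /=; lra.
have : d <= r /\ d <= a / 2 by rewrite /d !ge_min !lexx ?orbT.
move=> [dr da]; exists d; first by apply/andP; split; lra.
move=> x /andP[x1 x2]; have /= h1 : `|h a - h x| < `|h a| / 2.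
  by apply: hr; rewrite /ball /= ltr_norml; apply/andP; split; lra.
have := ler_normD (h a - h x) (h x); rewrite subrK => h2; lra.
Qed.

(** Robin solutions are known to be nonzero at the end a, whereas eigenfunctions are tested on the
    open rectangle. *)
Lemma interior_neq0 a h : 0 < a -> continuous h -> h a != 0 ->
  exists2 x, - a < x < a & h x != 0.
Proof.
move=> a0 ch ha; have [d /andP[d0 da] hd] := continuous_near_endpoint a0 ch ha.
exists (a - d / 2); first by apply/andP; split; lra.
have := hd (a - d / 2); rewrite -!normr_gt0 in ha *; move=> H.
have := H _; lra.
Qed.

Lemma dotp_gt0 a h : 0 < a -> continuous h -> h a != 0 -> 0 < dotp a h h.
Proof.
move=> a0 ch ha; have [d /andP[d0 da] hd] := continuous_near_endpoint a0 ch ha.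
have ch2 : continuous (fun x => h x * h x) by continuity.
rewrite /dotp (@itg_split _ (- a) (a - d)) //; [|lra|lra].
have p1 : 0 <= itg (- a) (a - d) (fun x => h x * h x).
  by apply: itg_ge0 => x _; rewrite -expr2 sqr_ge0.
have cc : continuous (fun _ : R => (`|h a| / 2) ^+ 2) by continuity.
have p2 : (`|h a| / 2) ^+ 2 * d <= itg (a - d) a (fun x => h x * h x).
  have <- : itg (a - d) a (fun=> (`|h a| / 2) ^+ 2) = (`|h a| / 2) ^+ 2 * d.
    transitivity ((`|h a| / 2) ^+ 2 * a - (`|h a| / 2) ^+ 2 * (a - d)); last by ring.
    apply: (@FTC_itg _ _ _ _ (fun x => (`|h a| / 2) ^+ 2 * x)) => //; first lra.
    by move=> x; apply: is_derive_eq; rewrite /GRing.scale /=; ring.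
  apply: le_itg => // x /hd hx; rewrite -expr2 -[leRHS]real_normK ?num_real //.
  by rewrite ler_pXn2r ?nnegrE ?divr_ge0.
have p3 : 0 < (`|h a| / 2) ^+ 2 * d.
  by rewrite mulr_gt0 // exprn_gt0 // divr_gt0 ?normr_gt0.
lra.
Qed.

End ExplicitOscillators.

(** * Construction of a Robin system *)

Section RobinSpectrum.
Context {R : realType}.
Implicit Types (a b s k al l : R) (n i : nat).

(** Only the parity of n affects the equation, an even n giving the cosine and an odd n the sine;
    the constructions below also use n to label the quarter period that contains [al * a]. *)
Definition trig_root a s al n : Prop :=
  0 < al /\ - (al * sin (phase n (al * a))) = s * cos (phase n (al * a)).

Definition hyperbolic_root b s al : Prop :=
  0 < al /\ (al * sh (al * b) = s * ch (al * b) \/ al * ch (al * b) = s * sh (al * b)).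

Lemma continuous_ch : continuous (@ch R).
Proof. exact: is_derive_continuous (@is_derive_ch R). Qed.

Lemma continuous_sh : continuous (@sh R).
Proof. exact: is_derive_continuous (@is_derive_sh R). Qed.

Lemma continuous_scaled (f : R -> R) k b : continuous f ->
  continuous (fun x : R => f (x * k + b)).
Proof.
move=> cf x; apply: (@continuous_comp _ _ _ (fun x : R => x * k + b) f); last exact: cf.
by apply: cvgD; [apply: cvgM; [exact: cvg_id|exact: cvg_cst]|exact: cvg_cst].
Qed.

(** The common shape of the next functions whose zeros are sought; it accounts for their
    coefficients -1 or 1 and offsets 0. *)
Let root_continuous (f g : R -> R) (k b c d : R) : continuous f -> continuous g ->
  continuous (fun x : R => c * (x * f (x * k + b)) + d * g (x * k + b)).
Proof.
move=> cf cg; have h1 := @continuous_scaled f k b cf; have h2 := @continuous_scaled g k b cg.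
have ci : continuous (fun x : R => x) by move=> x; exact: cvg_id.
by continuity.
Qed.

Lemma ch_root_exists a s : 0 < a -> 0 < s ->
  exists2 k, s < k & k * sh (k * a) = s * ch (k * a).
Proof.
move=> a0 s0; pose f x := -1 * (x * sh (x * a + 0)) + s * ch (x * a + 0).
have cf : continuous f by apply: root_continuous; [exact: continuous_sh|exact: continuous_ch].
(* K a >= 1 gives exp (2 K a) >= 3, that is tanh (K a) >= 1 / 2, and K / 2 > s. *)
pose K := 2 * s + a^-1; have ai : 0 < a^-1 by rewrite invr_gt0.
have fs : 0 < f s.
  rewrite /f addr0 mulN1r addrC -mulrBr mulr_gt0 // subr_gt0; exact: sh_lt_ch.
have fK : f K < 0.
  rewrite /f addr0; set z := K * a.
  have z1 : 1 <= z by rewrite /z mulrDl mulVf ?gt_eqF // lerDr !mulr_ge0 // ltW.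
  have hz : ch z / 2 <= sh z.
    have e1 : 3 * expR (- z) <= expR z.
      have : 3 <= expR (z + z).
        by apply: le_trans (expR_ge1Dx (z + z)); lra.
      rewrite expRD -(ler_pM2r (expR_gt0 (- z))) -mulrA expRxMexpNx_1 mulr1.
      by [].
    by rewrite /ch /sh; lra.
  have h1 : K * (ch z / 2) <= K * sh z by rewrite ler_wpM2l // /K; lra.
  have h2 : s * ch z < K * (ch z / 2).
    have -> : K * (ch z / 2) = K / 2 * ch z by field.
    by rewrite ltr_pM2r ?ch_gt0 // /K; lra.
  by lra.
have sK : s < K by rewrite /K; lra.
have [k /andP[sk _] fk] := ivt_zero sK cf fs fK.
exists k => //; move: fk; rewrite /f addr0 => ?; lra.
Qed.

(** The infimum of k coth (k a) is 1 / a, whence the condition on s; at k = s the value already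
    exceeds s. *)
Lemma sh_root_exists a s : 0 < a -> 1 < s * a ->
  exists2 k, 0 < k < s & k * ch (k * a) = s * sh (k * a).
Proof.
move=> a0 sa1; pose f x := -1 * (x * ch (x * a + 0)) + s * sh (x * a + 0).
have cf : continuous f by apply: root_continuous; [exact: continuous_ch|exact: continuous_sh].
have sa0 : 0 < s * a by lra.
have s0 : 0 < s by rewrite -(pmulr_lgt0 _ a0).
have sai : (s * a)^-1 < 1 by rewrite invf_lt1.
have sai0 : 0 < (s * a)^-1 by rewrite invr_gt0.
(* With this choice cosh z <= exp z <= 1 / (1 - z) < s a. *)
pose z := (1 - (s * a)^-1) / 2.
have z0 : 0 < z by rewrite /z; lra.
have z1 : z < 1 / 2 by rewrite /z; lra.
pose p := z / a; have p0 : 0 < p by rewrite divr_gt0.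
have pa : p * a = z by rewrite /p divfK // gt_eqF.
have ps : p < s by rewrite -(ltr_pM2r a0) pa; lra.
have fs : f s < 0.
  rewrite /f addr0 mulN1r addrC -mulrBr pmulr_rlt0 // subr_lt0; exact: sh_lt_ch.
have fp : 0 < f p.
  rewrite /f addr0 pa.
  have h1 : s * z <= s * sh z by rewrite ler_pM2l //; apply: sh_ge; exact: ltW.
  have h2 : ch z < s * a.
    have e1 : (1 - z) * expR z <= 1.
      rewrite -[leRHS](expRxMexpNx_1 z) [leRHS]mulrC.
      by rewrite ler_pM2r ?expR_gt0 //; exact: expR_ge1Dx.
    have e2 : expR (- z) <= expR z by rewrite ler_expR; lra.
    have e3 : ch z <= expR z by rewrite /ch; lra.
    have e4 : 1 < (1 - z) * (s * a).
      rewrite -(ltr_pM2r sai0) mul1r mulfK ?gt_eqF // /z; lra.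
    apply: le_lt_trans e3 _; have z10 : 0 < 1 - z by lra.
    by rewrite -(ltr_pM2l z10); exact: le_lt_trans e1 e4.
  have h3 : p * ch z < p * (s * a) by rewrite ltr_pM2l.
  have h4 : p * (s * a) = s * z by rewrite -pa; ring.
  by lra.
have [k /andP[pk ks] fk] := ivt_zero ps cf fp fs.
exists k; first by apply/andP; split => //; exact: lt_trans pk.
by move: fk; rewrite /f addr0 => ?; lra.
Qed.

(** The lowest odd mode is trigonometric for s a < 1 and hyperbolic, by [sh_root_exists], for s a >
    1. At s a = 1 it is the linear function x. *)
Lemma trig_root_first a s : 0 < a -> 0 < s -> s * a < 1 ->
  exists2 al, trig_root a s al 1 & al * a < pi / 2.
Proof.
move=> a0 s0 sa1.
pose f x := 1 * (x * cos (x * a + 0)) + - s * sin (x * a + 0).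
have cf : continuous f by apply: root_continuous; [exact: continuous_cos|exact: continuous_sin].
have sa0 : 0 < s * a by rewrite mulr_gt0.
have pi2 := @pi_ge2 R.
(* With this choice z cot z >= cos z >= 1 - z > s a. *)
pose z := (1 - s * a) / 2.
have z0 : 0 < z by rewrite /z; lra.
have z1 : z < 1 / 2 by rewrite /z; lra.
pose p := z / a; have p0 : 0 < p by rewrite divr_gt0.
have pa : p * a = z by rewrite /p divfK // gt_eqF.
pose q := pi / 2 / a; have qa : q * a = pi / 2 by rewrite /q divfK // gt_eqF.
have pq : p < q by rewrite -(ltr_pM2r a0) pa qa; lra.
have fq : f q < 0.
  by rewrite /f addr0 qa cos_pihalf sin_pihalf; lra.
have fp : 0 < f p.
  rewrite /f addr0 pa.
  have h1 : s * sin z <= s * z by rewrite ler_pM2l //; apply: sin_le; exact: ltW.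
  have h2 : p * (1 - z) <= p * cos z.
    by rewrite ler_pM2l //; apply: cos_ge; apply/andP; split; lra.
  have h3 : s * z < p * (1 - z).
    have -> : s * z = p * (s * a) by rewrite -pa; ring.
    by rewrite ltr_pM2l // /z; lra.
  by lra.
have [k /andP[pk kq] fk] := ivt_zero pq cf fp fq.
exists k; last by rewrite -qa ltr_pM2r.
split; first exact: lt_trans pk.
rewrite /phase mul1r sinBpihalf cosBpihalf.
by move: fk; rewrite /f addr0 => ?; lra.
Qed.

(** The shifted angle runs from - pi / 2 to 0. At the left end only the sine term remains and at the
    right end only the cosine term, with opposite signs. *)
Lemma trig_root_next a s n : 0 < a -> 0 < s -> (0 < n)%N ->
  exists2 al, trig_root a s al n.+1 & n%:R * (pi / 2) < al * a < n.+1%:R * (pi / 2).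
Proof.
move=> a0 s0 n0.
pose c : R := n.+1%:R * (pi / 2).
pose f x := -1 * (x * sin (x * a + - c)) + - s * cos (x * a + - c).
have cf : continuous f by apply: root_continuous; [exact: continuous_sin|exact: continuous_cos].
have pi0 := @pi_gt0 R.
pose p := n%:R * (pi / 2) / a; have pa : p * a = n%:R * (pi / 2) by rewrite /p divfK // gt_eqF.
pose q := c / a; have qa : q * a = c by rewrite /q divfK // gt_eqF.
have nR : 0 < n%:R :> R by rewrite ltr0n.
have p0 : 0 < p by rewrite divr_gt0 // mulr_gt0 // divr_gt0.
have cE : n%:R * (pi / 2) - c = - (pi / 2) by rewrite /c -natr1; ring.
have pq : p < q by rewrite -(ltr_pM2r a0) pa qa; lra.
have fp : 0 < f p.
  by rewrite /f pa cE cosN sinN cos_pihalf sin_pihalf; lra.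
have fq : f q < 0 by rewrite /f qa subrr sin0 cos0; lra.
have [k /andP[pk kq] fk] := ivt_zero pq cf fp fq.
exists k; last by rewrite -pa -/c -qa !ltr_pM2r // pk.
split; first exact: lt_trans pk.
by move: fk; rewrite /f /phase -/c => ?; lra.
Qed.

(** One root is chosen in each window between consecutive bounds, which gives the strict ordering
    and the growth clause of [robin_system] at once. *)
Lemma robin_system_exists a s : 0 < a -> 0 < s -> s * a != 1 ->
  exists lam phi dphi, [/\ robin_system a s lam phi dphi, 0 <= lam 2
    & forall i, (exists2 al, hyperbolic_root a s al & lam i = - al ^+ 2) \/
                (exists al n, trig_root a s al n /\ lam i = al ^+ 2)].
Proof.
move=> a0 s0 sa1; have pi0 := @pi_gt0 R.
(* Member i lies between [bnd i.-1] and [bnd i]: the even hyperbolic mode below - s ^ 2, then the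
   lowest odd mode, then one trigonometric mode per quarter period. *)
pose bnd i : R := if i == 0%N then - s ^+ 2 else (i%:R * pi / (2 * a)) ^+ 2.
pose P i (t : R * (R -> R) * (R -> R)) :=
  [/\ oscillator t.1.1 t.1.2 t.2, robin a s t.1.2 t.2, t.1.2 a != 0,
      t.1.1 < bnd i /\ ((0 < i)%N -> bnd i.-1 < t.1.1)
    & (exists2 al, hyperbolic_root a s al & t.1.1 = - al ^+ 2) \/
      (exists al n, trig_root a s al n /\ t.1.1 = al ^+ 2)].
have s2 : 0 < s ^+ 2 by rewrite exprn_gt0.
have trigP i al n : trig_root a s al n -> al ^+ 2 < bnd i ->
    ((0 < i)%N -> bnd i.-1 < al ^+ 2) ->
    P i (al ^+ 2, fun x => cos (phase n (al * x)), fun x => - (al * sin (phase n (al * x)))).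
  move=> [al0 root] h1 h2; split => //=.
  - exact: trig_oscillator.
  - exact: trig_robin.
  - by apply: cos_robin_neq0 root; rewrite gt_eqF.
  - by right; exists al, n.
have ubd i al : (0 < i)%N -> 0 < al -> al * a < i%:R * (pi / 2) -> al ^+ 2 < bnd i.
  move=> i0 al0 h; rewrite /bnd gtn_eqF // ltr_pXn2r ?nnegrE ?(ltW al0) //.
    rewrite -(ltr_pM2r a0); apply: (lt_le_trans h).
    by rewrite le_eqVlt; apply/orP; left; apply/eqP; field; rewrite gt_eqF.
  by rewrite divr_ge0 ?mulr_ge0 // ltW.
have exP i : exists t, P i t.
  case: i => [|[|i]].
  - have [k sk root] := ch_root_exists a0 s0; have k0 : 0 < k by exact: lt_trans sk.
    exists (- k ^+ 2, fun x => ch (k * x), fun x => k * sh (k * x)); split => //=.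
    + exact: ch_oscillator.
    + exact: ch_robin.
    + by rewrite gt_eqF // ch_gt0.
    + by split=> //; rewrite /bnd /= ltrN2 ltr_pXn2r ?nnegrE // ltW.
    + by left; exists k => //; split; [|left].
  - have [sa|sa|sa] := ltgtP (s * a) 1; last by rewrite sa eqxx in sa1.
      have [al root al2] := trig_root_first a0 s0 sa.
      eexists; apply: (trigP 1%N al 1%N root).
        by apply: ubd; rewrite ?mul1r //; case: root.
      by move=> _; rewrite /bnd /=; have := sqr_ge0 al => ?; lra.
    have [k /andP[k0 ks] root] := sh_root_exists a0 sa.
    exists (- k ^+ 2, fun x => sh (k * x), fun x => k * ch (k * x)); split => //=.
    + exact: sh_oscillator.
    + exact: sh_robin.
    + by rewrite gt_eqF // sh_gt0 // mulr_gt0.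
    + split=> [|_]; rewrite /bnd /=.
        have k2 : 0 < k ^+ 2 by rewrite exprn_gt0.
        have := sqr_ge0 (1 * pi / (2 * a)) => ?; lra.
      by rewrite ltrN2 ltr_pXn2r ?nnegrE // ltW.
    + by left; exists k => //; split; [|right].
  - have [al root /andP[al1 al2]] := @trig_root_next a s i.+1 a0 s0 isT.
    eexists; apply: (trigP i.+2 al i.+2 root); first by apply: ubd => //; case: root.
    move=> _; rewrite /bnd /= ltr_pXn2r ?nnegrE //.
    + rewrite -(ltr_pM2r a0); apply: le_lt_trans al1.
      by rewrite le_eqVlt; apply/orP; left; apply/eqP; field; rewrite gt_eqF.
    + by rewrite divr_ge0 ?mulr_ge0 // ltW.
    + by case: root => /ltW.
have [t tP] := choice exP.
exists (fun i => (t i).1.1), (fun i => (t i).1.2), (fun i => (t i).2); split.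
- split.
  + by move=> k; case: (tP k).
  + by move=> k; case: (tP k).
  + move=> j k jk; have [_ _ _ [h1 _] _] := tP j; have [_ _ _ [_ h2] _] := tP k.
    apply: (lt_le_trans h1); apply: le_trans (ltW (h2 (leq_ltn_trans (leq0n j) jk))).
    case: k jk {h2} => // k; rewrite ltnS => jk; rewrite /bnd /=.
    case: j jk {h1} => [_|j jk] /=.
      by case: ifP => // _; have := sqr_ge0 (k%:R * pi / (2 * a)) => ?; lra.
    rewrite gtn_eqF ?(leq_trans _ jk) // ler_pXn2r ?nnegrE ?divr_ge0 ?mulr_ge0 // ?(ltW pi0) ?(ltW a0) //.
    by rewrite ler_pM2r ?invr_gt0 ?mulr_gt0 // ler_pM2r // ler_nat.
  + move=> k; have [h _ hn _ _] := tP k.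
    by apply: dotp_gt0 => //; exact: (oscillator_continuous h).1.
  + by move=> n; have [_ _ _ [h _] _] := tP n.+1.
- have [_ _ _ [_ h] _] := tP 2; apply: ltW; apply: le_lt_trans (h isT).
  exact: sqr_ge0.
- by move=> i; case: (tP i).
Qed.

End RobinSpectrum.

(** * Eigenvalues and resonances *)

Section Resonance.
Context {R : realType}.
Implicit Types (a b s k al l : R) (n i : nat).

(** Not symmetric: the trigonometric factor lives on the interval of half-length a, the hyperbolic
    one on that of half-length b, with a common frequency. *)
Definition resonance s a b : Prop :=
  exists al n, hyperbolic_root b s al /\ trig_root a s al n.

Lemma nonresonant_trig b s al : 0 < al -> (forall n, ~ trig_root b s al n) ->
  nonresonant b s (al ^+ 2).
Proof.
move=> al0 h.
have nr n : - (al * sin (phase n (al * b))) - s * cos (phase n (al * b)) != 0.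
  by apply/eqP => /eqP; rewrite subr_eq0 => /eqP e; apply: (h n).
split.
- exists (fun x => cos (phase 0 (al * x))), (fun x => - (al * sin (phase 0 (al * x)))).
  split; [exact: trig_oscillator| | |exact: nr].
    by rewrite mulrN cos_phaseN expr0 mul1r.
  by rewrite mulrN sin_phaseN expr0 mul1r mulrN.
- exists (fun x => cos (phase 1 (al * x))), (fun x => - (al * sin (phase 1 (al * x)))).
  split; [exact: trig_oscillator| | |exact: nr].
    by rewrite mulrN cos_phaseN expr1 mulN1r.
  by rewrite mulrN sin_phaseN expr1 mulN1r opprK.
Qed.

Lemma nonresonant_hyperbolic b s al : 0 < al -> ~ hyperbolic_root b s al ->
  nonresonant b s (- al ^+ 2).
Proof.
move=> al0 h; split.
- exists (fun x => ch (al * x)), (fun x => al * sh (al * x)).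
  split; [exact: ch_oscillator| | |].
  + by rewrite mulrN chN.
  + by rewrite mulrN shN mulrN.
  + by apply/eqP => /eqP; rewrite subr_eq0 => /eqP e; apply: h; split => //; left.
- exists (fun x => sh (al * x)), (fun x => al * ch (al * x)).
  split; [exact: sh_oscillator| | |].
  + by rewrite mulrN shN.
  + by rewrite mulrN chN.
  + by apply/eqP => /eqP; rewrite subr_eq0 => /eqP e; apply: h; split => //; right.
Qed.

(** Each Robin eigenvalue in the two systems is plus or minus a square [al ^+ 2], and its opposite
    can only be one for the other side at a resonance. The conditions on [s * a1] and [s * a2] set
    aside the linear mode, of Robin eigenvalue 0. *)
Lemma steklov_eigenvalue_resonance a1 a2 s : 0 < a1 -> 0 < a2 -> 0 < s ->
  s * a1 != 1 -> s * a2 != 1 -> steklov_multiplicity_ge a1 a2 s 1 ->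
  resonance s a1 a2 \/ resonance s a2 a1.
Proof.
move=> a10 a20 s0 n1 n2 eig.
have [//|/not_orP[h12 h21]] := pselect (resonance s a1 a2 \/ resonance s a2 a1).
have [lam1 [phi1 [dphi1 [rs1 l1 d1]]]] := robin_system_exists a10 s0 n1.
have [lam2 [phi2 [dphi2 [rs2 l2 d2]]]] := robin_system_exists a20 s0 n2.
have nr a b : ~ resonance s a b -> ~ resonance s b a -> forall l,
    (exists2 al, hyperbolic_root a s al & l = - al ^+ 2) \/
    (exists al n, trig_root a s al n /\ l = al ^+ 2) -> nonresonant b s (- l).
  move=> hab hba l [[al root ->]|[al [n [root ->]]]].
    rewrite opprK; apply: nonresonant_trig; first exact: root.1.
    by move=> n rn; apply: hba; exists al, n.
  apply: nonresonant_hyperbolic; first exact: root.1.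
  by move=> rn; apply: hab; exists al, n.
case: (nonresonant_no_eigenvalue a10 a20 rs1 l1 rs2 l2 _ _ eig) => i.
  exact: (nr _ _ h12 h21).
exact: (nr _ _ h21 h12).
Qed.

Lemma hyperbolic_robin b s al : 0 < b -> hyperbolic_root b s al ->
  exists Y dY, [/\ oscillator (- al ^+ 2) Y dY, robin b s Y dY & Y b != 0].
Proof.
move=> b0 [al0 [h|h]].
  exists (fun x => ch (al * x)), (fun x => al * sh (al * x)).
  by split; [exact: ch_oscillator|exact: ch_robin|rewrite gt_eqF // ch_gt0].
exists (fun x => sh (al * x)), (fun x => al * ch (al * x)).
by split; [exact: sh_oscillator|exact: sh_robin|rewrite gt_eqF // sh_gt0 // mulr_gt0].
Qed.

Lemma trig_root_robin a s al n : trig_root a s al n ->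
  exists X dX, [/\ oscillator (al ^+ 2) X dX, robin a s X dX & X a != 0].
Proof.
move=> [al0 h].
exists (fun x => cos (phase n (al * x))), (fun x => - (al * sin (phase n (al * x)))).
split; [exact: trig_oscillator|exact: trig_robin|].
by apply: cos_robin_neq0 h; rewrite gt_eqF.
Qed.

Lemma resonance_eigenvalue a1 a2 s : 0 < a1 -> 0 < a2 ->
  resonance s a1 a2 \/ resonance s a2 a1 -> steklov_multiplicity_ge a1 a2 s 1.
Proof.
have sep (l : R) X dX Y dY : 0 < a1 -> 0 < a2 -> oscillator l X dX ->
    oscillator (- l) Y dY -> robin a1 s X dX -> robin a2 s Y dY ->
    X a1 != 0 -> Y a2 != 0 -> steklov_multiplicity_ge a1 a2 s 1.
  move=> a10 a20 oX oY rX rY Xn Yn.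
  have [x hx Xx] := interior_neq0 a10 (oscillator_continuous oX).1 Xn.
  have [y hy Yy] := interior_neq0 a20 (oscillator_continuous oY).1 Yn.
  exact: (separated_eigenvalue a10 a20 oX oY rX rY hx Xx hy Yy).
move=> a10 a20 [|] [al [n [hyp trig]]].
  have [Y [dY [oY rY Yn]]] := hyperbolic_robin a20 hyp.
  have [X [dX [oX rX Xn]]] := trig_root_robin trig.
  exact: (sep _ _ _ _ _ a10 a20 oX oY rX rY Xn Yn).
have [X [dX [oX rX Xn]]] := hyperbolic_robin a10 hyp.
have [Y [dY [oY rY Yn]]] := trig_root_robin trig.
rewrite -[al ^+ 2]opprK in oY.
exact: (sep _ _ _ _ _ a10 a20 oX oY rX rY Xn Yn).
Qed.

End Resonance.

(** * Resonances at high frequency *)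

Section HighFrequency.
Context {R : realType}.
Implicit Types (a b c s k al x y z eps eta : R) (n i : nat).

(** In exponentials both equations read |al - s| exp (2 al b) = al + s. The Taylor bounds of order 1
    and 2 of the exponential give the two estimates: the first shows that al is comparable to s, the
    second that the distance tends to 0. *)
Lemma hyperbolic_root_close b s al : 0 < b -> 0 < s -> hyperbolic_root b s al ->
  `|al - s| <= b^-1 /\ `|al - s| <= (al * b ^+ 2)^-1.
Proof.
move=> b0 s0 [al0 root].
have ab0 : 0 < al * b by rewrite mulr_gt0.
have E : `|al - s| * expR (2 * (al * b)) = al + s.
  have e1 := expRxMexpNx_1 (al * b).
  have e2 : expR (2 * (al * b)) = expR (al * b) * expR (al * b).
    by rewrite -expRD; congr expR; ring.
  have key : (al - s) * expR (2 * (al * b)) = al + s \/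
      (al - s) * expR (2 * (al * b)) = - (al + s).
    rewrite e2; move: root; rewrite /ch /sh.
    set u := expR (al * b) in e1 *; set v := expR (- (al * b)) in e1 *.
    case=> h; [left|right].
      have h' : (al - s) * u = (al + s) * v by lra.
      by rewrite mulrA h' -mulrA [v * u]mulrC e1 mulr1.
    have h' : (al - s) * u = - ((al + s) * v) by lra.
    by rewrite mulrA h' mulNr -mulrA [v * u]mulrC e1 mulr1.
  rewrite -[expR _](ger0_norm (expR_ge0 _)) -normrM.
  by case: key => ->; rewrite ?normrN ger0_norm // addr_ge0 // ltW.
set d := `|al - s| in E *.
have d0 : 0 <= d by exact: normr_ge0.
have dle : al + s - d <= 2 * al.
  have := ler_norm (s - al); rewrite distrC -/d => ?; lra.
have F : d * (expR (2 * (al * b)) - 1) <= 2 * al by rewrite mulrBr mulr1 E.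
split.
  have h := expR_ge1Dx (2 * (al * b)).
  have h1 : d * (2 * (al * b)) <= 2 * al.
    by apply: le_trans F; apply: ler_wpM2l => //; lra.
  rewrite -(ler_pM2r b0) mulVf ?gt_eqF // -(ler_pM2r al0) mul1r.
  have -> : d * b * al = d * (2 * (al * b)) / 2 by field.
  by lra.
have h := @expR_ge1Dxn R (2 * (al * b)) 1 (ltW (mulr_gt0 (ltr0Sn _ 1) ab0)).
have h1 : d * (2 * (al * b) ^+ 2) <= 2 * al.
  apply: le_trans F; apply: ler_wpM2l => //; move: h.
  have -> : (2 * (al * b)) ^+ 2 / 2`!%:R = 2 * (al * b) ^+ 2.
    by rewrite (_ : 2`! = 2%N) //; field.
  by move=> ?; lra.
have ab2 : 0 < al * b ^+ 2 by rewrite mulr_gt0 // exprn_gt0.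
rewrite -(ler_pM2r ab2) mulVf ?gt_eqF // -(ler_pM2r al0) mul1r.
have -> : d * (al * b ^+ 2) * al = d * (2 * (al * b) ^+ 2) / 2 by field.
by lra.
Qed.

Lemma cos_lipschitz x y : `|cos x - cos y| <= `|x - y|.
Proof.
have le (u v : R) : u <= v -> `|cos v - cos u| <= `|v - u|.
  move=> uv; have [z _ ->] := MVT_segment uv (fun t _ => @is_derive_cos R t)
    (continuous_subspaceT (@continuous_cos R)).
  rewrite normrM ler_piMl // normrN; exact: sin_max.
have [xy|yx] := leP x y; last exact/le/ltW.
by rewrite distrC [leRHS]distrC; exact: le.
Qed.

(** Squaring the Robin equation gives cos (2 th) = (al ^ 2 - s ^ 2) / (al ^ 2 + s ^ 2); doubling the
    angle turns the dependence on n into a sign. *)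
Lemma trig_root_cos a s al n : 0 < s -> trig_root a s al n ->
  `|cos (2 * (al * a))| <= 2 * `|al - s| / s.
Proof.
move=> s0 [al0 root]; set th := phase n (al * a) in root.
have -> : `|cos (2 * (al * a))| = `|cos (th *+ 2)|.
  have -> : 2 * (al * a) = th *+ 2 + pi *+ n.
    by rewrite mulr2n /th /phase -[pi *+ n]mulr_natr; field.
  by rewrite (alternatingn (@cosDpi R)) normrM normrX normrN1 expr1n mul1r.
have D0 : 0 < al ^+ 2 + s ^+ 2 by rewrite addr_gt0 // exprn_gt0.
have E : cos (th *+ 2) * (al ^+ 2 + s ^+ 2) = (al - s) * (al + s).
  have h1 : al ^+ 2 * sin th ^+ 2 = s ^+ 2 * cos th ^+ 2.
    by rewrite -!exprMn -root sqrrN.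
  have h2 := sin2cos2 th; rewrite h2 in h1.
  rewrite cos_mulr2n; transitivity (2 * (al ^+ 2 * cos th ^+ 2 + s ^+ 2 * cos th ^+ 2) -
    (al ^+ 2 + s ^+ 2)); first by rewrite mulr2n; ring.
  by rewrite -h1; ring.
have {}E : `|cos (th *+ 2)| * (al ^+ 2 + s ^+ 2) = `|al - s| * (al + s).
  rewrite -[al ^+ 2 + s ^+ 2]ger0_norm ?(ltW D0) // -normrM E normrM.
  by rewrite [`|al + s|]ger0_norm // addr_ge0 // ltW.
rewrite -(ler_pM2r D0) E.
have -> : 2 * `|al - s| / s * (al ^+ 2 + s ^+ 2) =
  `|al - s| * (2 * (al ^+ 2 + s ^+ 2) / s) by ring.
apply: ler_wpM2l => //; rewrite ler_pdivlMr //.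
have -> : (al + s) * s = 2 * (al ^+ 2 + s ^+ 2) -
  ((s - al / 2) ^+ 2 + 7 / 4 * al ^+ 2) by field.
have := sqr_ge0 al; have := sqr_ge0 (s - al / 2).
set u := (s - _) ^+ 2; set v := al ^+ 2 => ? ?; lra.
Qed.

Lemma high_resonance_cos a b eps : 0 < a -> 0 < b -> 0 < eps ->
  (* The first threshold used below, 2 / b, gives al >= s / 2 and 2 / s <= b; the second makes the
     resulting bound (2 a + b) 2 / (s b ^ 2) at most eps. *)
  exists S : R, forall s, S <= s -> 0 < s -> resonance s a b ->
    `|cos (2 * (s * a))| <= eps.
Proof.
move=> a0 b0 e0; exists (Num.max (2 / b) ((2 * a + b) * 2 / (eps * b ^+ 2))).
move=> s; rewrite ge_max => /andP[sb se] s0 [al [n [hyp trig]]].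
have [d1 d2] := hyperbolic_root_close b0 s0 hyp.
have b2 : 0 < b ^+ 2 by rewrite exprn_gt0.
have al0 := hyp.1; set d := `|al - s| in d1 d2.
have d0 : 0 <= d by exact: normr_ge0.
have sal : s / 2 <= al.
  have h1 : s - al <= d by rewrite /d distrC; exact: ler_norm.
  have : 2 / b = 2 * b^-1 by []; lra.
have d3 : d <= 2 / (s * b ^+ 2).
  apply: (le_trans d2); rewrite -[leRHS]invf_div lef_pV2 ?posrE; last 2 first.
  - by rewrite mulr_gt0.
  - by rewrite divr_gt0 // mulr_gt0.
  by rewrite mulrAC ler_pM2r.
have c1 := trig_root_cos s0 trig; rewrite -/d in c1.
have c2 : `|cos (2 * (s * a)) - cos (2 * (al * a))| <= 2 * a * d.
  apply: (le_trans (cos_lipschitz _ _)); rewrite (_ : _ - _ = 2 * a * (s - al)); last by ring.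
  by rewrite normrM distrC ger0_norm // mulr_ge0 // ltW.
have c3 : 2 * d / s <= b * d.
  rewrite mulrAC ler_wpM2r // ler_pdivrMr // mulrC.
  by rewrite -ler_pdivrMr.
have c4 : `|cos (2 * (s * a))| <= (2 * a + b) * d.
  have := ler_normD (cos (2 * (s * a)) - cos (2 * (al * a))) (cos (2 * (al * a))).
  by rewrite subrK => ?; lra.
apply: (le_trans c4); have ab0 : 0 < 2 * a + b by lra.
apply: (@le_trans _ _ ((2 * a + b) * (2 / (s * b ^+ 2)))); first by rewrite ler_pM2l.
have sb2 : 0 < s * b ^+ 2 by rewrite mulr_gt0.
rewrite mulrA ler_pdivrMr //; move: se; rewrite ler_pdivrMr ?mulr_gt0 // => se.
by rewrite mulrCA.
Qed.

Lemma cos_neq_small x k c : `|x - k| <= c -> c <= pi -> (exists n, k = n%:R * pi) ->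
  cos c <= `|cos x|.
Proof.
move=> xk cpi [n kE].
have -> : `|cos x| = `|cos (x - k)|.
  have {1}-> : x = (x - k) + pi *+ n by rewrite kE -[pi *+ n]mulr_natr; ring.
  by rewrite (alternatingn (@cosDpi R)) normrM normrX normrN1 expr1n mul1r.
rewrite -(cos_norm (x - k)); apply: le_trans (ler_norm _).
have c0 : 0 <= c by apply: le_trans xk.
have x0 : 0 <= `|x - k| by [].
move: xk; rewrite le_eqVlt => /predU1P[->//|xk]; apply: ltW.
by rewrite ltr_cos // in_itv /= ?x0 ?c0 //= ltW // (lt_le_trans xk).
Qed.

End HighFrequency.

(** * Existence of high resonances and simultaneous approximation *)

Section Window.
Context {R : realType}.
Implicit Types (a b c r s k al x y z t eps eta : R) (n i q p K N : nat).

Lemma cos_sin_quarter : cos (pi / 4) = sin (pi / 4) :> R.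
Proof.
have {1}-> : pi / 4 = - (pi / 4) + pi / 2 :> R by field.
by rewrite cosDpihalf sinN opprK.
Qed.

Lemma sin_lt_cos z : 0 < z < pi / 4 -> sin z < cos z.
Proof.
move=> /andP[z0 z1]; rewrite -[ltRHS]cosN -sinDpihalf.
by rewrite ltr_sin ?in_itv /=; [lra|apply/andP; split; lra|apply/andP; split; lra].
Qed.

(** For the even hyperbolic mode the two Robin equations combine into - tan (al a - c) = tanh (al
    b). As the right side tends to 1, the root has al a - c close to - pi / 4, that is, al close to
    (n + 1 / 2) pi / (2 a). *)
Lemma resonance_near a b eta : 0 < a -> 0 < b -> 0 < eta ->
  exists N, forall n, (N <= n)%N -> exists s,
    [/\ resonance s a b, 0 < s & `|s - (n%:R + 1 / 2) * (pi / (2 * a))| <= eta].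
Proof.
move=> a0 b0 e0; have pi0 := @pi_gt0 R.
(* The root is sought in an interval of length h / a <= eta / 2; the bound pi / 8 keeps [be]
   positive. *)
pose h := Num.min (pi / 8) (a * eta / 2).
have h0 : 0 < h by rewrite lt_min divr_gt0 //= divr_gt0 // mulr_gt0.
have [h1 h2] : h <= pi / 8 /\ h <= a * eta / 2 by rewrite /h !ge_min !lexx orbT.
pose be := pi / 4 - h.
have bein : 0 < be < pi / 4 by apply/andP; rewrite /be; split; lra.
have [kk kkE kp] : exists2 kk, kk = cos be - sin be & 0 < kk.
  by exists (cos be - sin be) => //; rewrite subr_gt0; exact: sin_lt_cos.
(* The first term makes x2 b >= 2 / kk, enough for tanh (x2 b) > tan be; the second makes al >= 2 /
   (b ^ 2 eta), so that |al - s| <= eta / 2. *)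
pose N := (Num.bound (2 * a / (b * pi) * (2 / kk)) +
           Num.bound (2 * a / pi * (2 / (b ^+ 2 * eta)))).+1.
exists N => n Nn.
have nN : N%:R <= n%:R :> R by rewrite ler_nat.
have A1 : 2 / kk <= n%:R * (pi / 2) / a * b.
  have l1 : 2 * a / (b * pi) * (2 / kk) <= n%:R.
    apply: ltW; apply: lt_le_trans nN.
    apply: (lt_trans (archi_boundP (ltW (_ : 0 < 2 * a / (b * pi) * (2 / kk))))).
      by rewrite mulr_gt0 // divr_gt0 // mulr_gt0.
    by rewrite ltr_nat /N ltnS leq_addr.
  have bp : 0 < b * pi / (2 * a) by rewrite divr_gt0 // mulr_gt0.
  rewrite -(ler_pM2l bp) in l1; move: l1.
  have -> : b * pi / (2 * a) * (2 * a / (b * pi) * (2 / kk)) = 2 / kk.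
    by generalize (@pi R) pi0 => P P0; field; rewrite ?gt_eqF //.
  suff -> : b * pi / (2 * a) * n%:R = n%:R * (pi / 2) / a * b by [].
  by generalize (@pi R) pi0 => P P0; field; rewrite ?gt_eqF //.
have A2 : 2 / (b ^+ 2 * eta) <= n%:R * (pi / 2) / a.
  have be2 : 0 < b ^+ 2 * eta by rewrite mulr_gt0 // exprn_gt0.
  have l1 : 2 * a / pi * (2 / (b ^+ 2 * eta)) <= n%:R.
    apply: ltW; apply: lt_le_trans nN.
    apply: (lt_trans (archi_boundP (ltW (_ : 0 < 2 * a / pi * (2 / (b ^+ 2 * eta)))))).
      by rewrite mulr_gt0 // divr_gt0 // mulr_gt0.
    by rewrite ltr_nat /N ltnS leq_addl.
  have bp : 0 < pi / (2 * a) by rewrite divr_gt0 // mulr_gt0.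
  rewrite -(ler_pM2l bp) in l1; move: l1.
  have -> : pi / (2 * a) * (2 * a / pi * (2 / (b ^+ 2 * eta))) = 2 / (b ^+ 2 * eta).
    by generalize (@pi R) pi0 => P P0; field; rewrite ?gt_eqF //.
  suff -> : pi / (2 * a) * n%:R = n%:R * (pi / 2) / a by [].
  by generalize (@pi R) pi0 => P P0; field; rewrite ?gt_eqF //.
pose c : R := n.+1%:R * (pi / 2).
pose f x := -1 * (sin (x * a + - c) * ch (x * b + 0)) + -1 * (cos (x * a + - c) * sh (x * b + 0)).
have cf : continuous f.
  have k1 := @continuous_scaled R (@sin R) a (- c) (@continuous_sin R).
  have k2 := @continuous_scaled R (@cos R) a (- c) (@continuous_cos R).
  have k3 := @continuous_scaled R (@ch R) b 0 (@continuous_ch R).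
  have k4 := @continuous_scaled R (@sh R) b 0 (@continuous_sh R).
  by rewrite /f; continuity.
pose x1 := (c - pi / 4) / a; pose x2 := (c - be) / a.
have x1a : x1 * a = c - pi / 4 by rewrite /x1 divfK // gt_eqF.
have x2a : x2 * a = c - be by rewrite /x2 divfK // gt_eqF.
have x12 : x1 < x2 by rewrite -(ltr_pM2r a0) x1a x2a /be; lra.
have cE : c = n%:R * (pi / 2) + pi / 2 by rewrite /c -natr1; ring.
have nx1 : n%:R * (pi / 2) / a <= x1 by rewrite /x1 ler_pM2r ?invr_gt0 //; lra.
have f1 : 0 < f x1.
  rewrite /f x1a (_ : c - pi / 4 - c = - (pi / 4)); last by ring.
  rewrite sinN cosN cos_sin_quarter addr0.
  have -> : -1 * (- sin (pi / 4) * ch (x1 * b)) + -1 * (sin (pi / 4) * sh (x1 * b)) =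
    sin (pi / 4) * (ch (x1 * b) - sh (x1 * b)) by ring.
  rewrite mulr_gt0 ?subr_gt0 ?sh_lt_ch // sin_gt0_pi //; apply/andP; split; lra.
have f2 : f x2 < 0.
  rewrite /f x2a (_ : c - be - c = - be); last by ring.
  rewrite sinN cosN addr0; set z := x2 * b.
  have z1 : 2 / kk <= z by apply: (le_trans A1); rewrite /z ler_pM2r //; lra.
  have e1 : cos be + sin be <= 2 by have := cos_le1 be; have := sin_le1 be => ? ?; lra.
  have e2 : 2 * expR (- z) < kk * expR z.
    have E : expR (- z) * expR z = 1 by rewrite mulrC expRxMexpNx_1.
    rewrite -(ltr_pM2r (expR_gt0 z)) -mulrA E mulr1 -mulrA -expRD.
    rewrite ler_pdivrMr // in z1; rewrite mulrC in z1.
    have z0 : 0 < z.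
      by apply: lt_le_trans (_ : 2 / kk <= _); [rewrite divr_gt0|rewrite ler_pdivrMr // mulrC].
    have e3 : z + 1 <= expR (z + z) by apply: le_trans (expR_ge1Dx (z + z)); lra.
    have e4 : kk * (z + 1) <= kk * expR (z + z) by rewrite ler_pM2l.
    lra.
  have e3 : (cos be + sin be) * expR (- z) <= 2 * expR (- z) by rewrite ler_pM2r ?expR_gt0.
  have e4 : kk * expR z = cos be * expR z - sin be * expR z by rewrite kkE; ring.
  have e5 : (cos be + sin be) * expR (- z) = cos be * expR (- z) + sin be * expR (- z) by ring.
  rewrite e4 in e2; rewrite e5 in e3; rewrite /ch /sh; lra.
have [al /andP[al1 al2] fal] := ivt_zero x12 cf f1 f2.
have al0 : 0 < al.
  apply: lt_trans al1; apply: lt_le_trans nx1; rewrite divr_gt0 // mulr_gt0 ?divr_gt0 //.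
  by rewrite ltr0n; exact: leq_trans Nn.
pose s := al * sh (al * b) / ch (al * b).
have chn : ch (al * b) != 0 by rewrite gt_eqF // ch_gt0.
have hyp : hyperbolic_root b s al by split => //; left; rewrite /s divfK.
have s0 : 0 < s by rewrite divr_gt0 ?ch_gt0 // mulr_gt0 // sh_gt0 // mulr_gt0.
exists s; split => //.
  exists al, n.+1; split => //; split => //; rewrite /phase -/c.
  move: fal; rewrite /f addr0 => fal.
  have e : sin (al * a - c) * ch (al * b) = - (cos (al * a - c) * sh (al * b)) by lra.
  apply: (mulIf chn).
  transitivity (- (al * (sin (al * a - c) * ch (al * b)))); first by ring.
  by rewrite e /s; field.
have [_ d] := hyperbolic_root_close b0 s0 hyp.
have d1 : `|al - s| <= eta / 2.
  apply: (le_trans d); rewrite -[leRHS]invf_div lef_pV2 ?posrE; last 2 first.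
  - by rewrite mulr_gt0 // exprn_gt0.
  - by rewrite divr_gt0.
  have b2 : 0 < b ^+ 2 by rewrite exprn_gt0.
  rewrite -ler_pdivrMr //; apply: (@le_trans _ _ (n%:R * (pi / 2) / a)).
    apply: le_trans A2; rewrite le_eqVlt; apply/orP; left; apply/eqP.
    by field; rewrite ?gt_eqF //.
  by apply: (le_trans nx1); exact: ltW.
have d2 : `|al - (n%:R + 1 / 2) * (pi / (2 * a))| <= eta / 2.
  have xE : (n%:R + 1 / 2) * (pi / (2 * a)) = x1.
    by rewrite /x1 cE; generalize (@pi R) pi0 => P P0; field; rewrite ?gt_eqF //.
  have al3 : (al - x1) * a <= eta / 2 * a.
    have : al * a < x2 * a by rewrite ltr_pM2r.
    by rewrite mulrBl x1a x2a /be => ?; lra.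
  rewrite xE ger0_norm; last by lra.
  by rewrite -(ler_pM2r a0).
rewrite (_ : s - _ = (al - (n%:R + 1 / 2) * (pi / (2 * a))) - (al - s)); last by ring.
by apply: (le_trans (ler_normB _ _)); lra.
Qed.

(** Pigeonhole on the fractional parts of the multiples of (K + 1) r: two indices share a box of
    length 1 / M, and any difference of distinct indices yields q >= K + 1. *)
Lemma dirichlet_large r eps K : 0 <= r -> 0 < eps ->
  exists q p, (K <= q)%N /\ `|q%:R * r - p%:R| <= eps.
Proof.
move=> r0 e0; pose M := (Num.bound eps^-1).+1.
have eM : eps^-1 < M%:R.
  have ie0 : 0 <= eps^-1 by rewrite invr_ge0 ltW.
  by apply: (lt_trans (archi_boundP ie0)); rewrite ltr_nat.
have M0 : 0 < M%:R :> R by rewrite ltr0n.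
have Me : M%:R^-1 < eps by rewrite -[ltRHS]invrK ltf_pV2 ?posrE ?invr_gt0.
pose x i : R := (i * K.+1)%:R * r.
have x0 i : 0 <= x i by rewrite mulr_ge0.
pose fr i : R := x i - (Num.truncn (x i))%:R.
have fr01 i : 0 <= fr i < 1.
  have /andP[h1 h2] := Num.Theory.truncn_itv (x0 i).
  by rewrite /fr; rewrite -natr1 in h2; apply/andP; split; lra.
have bx i : (Num.truncn (M%:R * fr i) < M)%N.
  have /andP[f0 f1] := fr01 i.
  have m0 : 0 <= M%:R * fr i by rewrite mulr_ge0.
  have /andP[h1 _] := Num.Theory.truncn_itv m0.
  rewrite -(ltr_nat R); apply: (le_lt_trans h1).
  by rewrite -[ltRHS]mulr1 ltr_pM2l.
pose F (i : 'I_M.+1) : 'I_M := Ordinal (bx i).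
have [i [j [ij Fij]]] : exists i j : 'I_M.+1, (i < j)%N /\ F i = F j.
  have [/injectiveP inj|] := boolP (injectiveb F).
    by have := leq_card F inj; rewrite !card_ord ltnn.
  move=> /injectivePn[i [j ij Fij]].
  have [h|h|h] := ltngtP i j; [by exists i, j|by exists j, i|].
  by case/eqP: ij; exact: val_inj.
have close : `|fr j - fr i| <= M%:R^-1.
  have /andP[f0 _] := fr01 i; have /andP[g0 _] := fr01 j.
  have m0 : 0 <= M%:R * fr i by rewrite mulr_ge0.
  have m1 : 0 <= M%:R * fr j by rewrite mulr_ge0.
  have /andP[h1 h2] := Num.Theory.truncn_itv m0.
  have /andP[h3 h4] := Num.Theory.truncn_itv m1.
  have E : Num.truncn (M%:R * fr j) = Num.truncn (M%:R * fr i) by move: Fij => /(congr1 val).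
  rewrite E -natr1 in h3 h4; rewrite -natr1 in h2.
  rewrite -(ler_pM2l M0) divff ?gt_eqF // -[M%:R]ger0_norm ?(ltW M0) // -normrM.
  by rewrite mulrBr ler_norml; apply/andP; split; lra.
exists ((j - i) * K.+1)%N, (Num.truncn (x j) - Num.truncn (x i))%N; split.
  by apply: leq_trans (leqnSn K) _; rewrite leq_pmull // subn_gt0.
have tij : (Num.truncn (x i) <= Num.truncn (x j))%N.
  apply: Num.Theory.le_truncn; rewrite /x ler_wpM2r // ler_nat leq_mul2r ltnW ?orbT //.
rewrite natrB // mulnBl natrB ?leq_mul2r ?(ltnW ij) ?orbT //.
have -> : ((j * K.+1)%:R - (i * K.+1)%:R) * r -
    ((Num.truncn (x j))%:R - (Num.truncn (x i))%:R) = fr j - fr i by rewrite /fr /x; ring.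
exact: le_trans close (ltW Me).
Qed.

End Window.

(** * Frequencies that separate two rectangles *)

Section Separation.
Context {R : realType}.
Implicit Types (a b m M s x y z al : R) (n k : nat).

(** Here [eps] is the frequency beyond which the cosine bound holds; around a multiple of pi the
    cosine is at least [cos b], twice what that bound allows. *)
Lemma resonance_gap a a' b s k eps : 0 < a ->
  (forall s, resonance s a a' -> 0 < s -> eps <= s -> `|cos (2 * (s * a))| <= cos b / 2) ->
  b < pi / 2 -> 0 < s -> eps <= s -> `|2 * (s * a) - k%:R * pi| <= b ->
  ~ resonance s a a'.
Proof.
move=> a0 hcos b2 s0 es sk res; have pi0 := @pi_gt0 R.
have b0 : 0 <= b by apply: le_trans sk.
have cb : 0 < cos b by apply: cos_gt0_pihalf; apply/andP; split; lra.
have h1 := hcos s res s0 es.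
have h2 : cos b <= `|cos (2 * (s * a))|.
  by apply: (cos_neq_small sk); [lra|exists k].
lra.
Qed.

Lemma longest_side_separates a1 a2 b b' : 0 < a1 -> 0 < a2 -> 0 < b' ->
  a1 < b -> a2 < b -> exists s, [/\ 0 < s, resonance s b b',
    ~ resonance s a1 a2, ~ resonance s a2 a1 & s * a1 != 1 /\ s * a2 != 1].
Proof.
move=> a10 a20 b'0 a1b a2b; have pi0 := @pi_gt0 R.
have b0 : 0 < b by exact: lt_trans a1b.
(* The asymptotic spacing of the resonances governed by x; multiples of [c x] are centres of gaps,
   since cos (2 s x) is 1 or - 1 there. *)
pose c x : R := pi / (2 * x).
have c0 x : 0 < x -> 0 < c x by move=> x0; rewrite divr_gt0 // mulr_gt0.
have clt x : 0 < x -> x < b -> c b < c x.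
  by move=> x0 xb; rewrite /c ltr_pM2l // ltf_pV2 ?posrE ?mulr_gt0 // ltr_pM2l.
have cpi x : 0 < x -> 2 * x * c x = pi.
  by move=> x0; rewrite /c mulrC divfK // gt_eqF // mulr_gt0.
have c1 := clt _ a10 a1b; have c2 := clt _ a20 a2b.
have cb0 := c0 _ b0; have c10 := c0 _ a10; have c20 := c0 _ a20.
(* One [eta] is spent on locating a resonance of the pair (b, b'), another on the approximate common
   multiple; w = c b / 2 + 2 eta still stays below c a1 / 2 and c a2 / 2. *)
pose eta := Num.min ((c a1 - c b) / 8) ((c a2 - c b) / 8).
have eta0 : 0 < eta by rewrite lt_min; apply/andP; split; lra.
have [eta1 eta2] : eta <= (c a1 - c b) / 8 /\ eta <= (c a2 - c b) / 8.
  by rewrite /eta !ge_min !lexx orbT.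
pose w := c b / 2 + 2 * eta.
have psi x : 0 < x -> w < c x / 2 -> 2 * x * w < pi / 2.
  move=> x0 wx; have -> : pi / 2 = 2 * x * (c x / 2) by rewrite mulrA cpi.
  by rewrite ltr_pM2l // mulr_gt0.
have psi1 : 2 * a1 * w < pi / 2 by apply: psi => //; rewrite /w; lra.
have psi2 : 2 * a2 * w < pi / 2 by apply: psi => //; rewrite /w; lra.
have w0 : 0 < w by rewrite /w; lra.
have cosp x : 0 < x -> 2 * x * w < pi / 2 -> 0 < cos (2 * x * w) / 2.
  move=> x0 h; rewrite divr_gt0 //; apply: cos_gt0_pihalf.
  have : 0 < 2 * x * w by rewrite !mulr_gt0.
  by move=> ?; apply/andP; split; lra.
have [S1 h1] := high_resonance_cos a10 a20 (cosp _ a10 psi1).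
have [S2 h2] := high_resonance_cos a20 a10 (cosp _ a20 psi2).
have [N hN] := resonance_near b0 b'0 eta0.
(* The last two terms force s a1 and s a2 to be at least 2, away from 1. *)
pose S := `|S1| + `|S2| + 2 / a1 + 2 / a2.
have ia1 : 0 < 2 / a1 by rewrite divr_gt0.
have ia2 : 0 < 2 / a2 by rewrite divr_gt0.
have [S1S S2S] : S1 <= S /\ S2 <= S.
  have := ler_norm S1; have := ler_norm S2.
  have := normr_ge0 S1; have := normr_ge0 S2; rewrite /S.
  by clear -ia1 ia2; set u := `|S1|; set v := `|S2| => ? ? ? ?; split; lra.
have [Sa1 Sa2] : 2 / a1 <= S /\ 2 / a2 <= S.
  have := normr_ge0 S1; have := normr_ge0 S2; rewrite /S.
  by clear -ia1 ia2; set u := `|S1|; set v := `|S2| => ? ?; split; lra.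
have S0 : 0 <= S by apply: le_trans Sa1; exact: ltW.
(* A large q pushes t = q c a1, within [eta] of p c a2, past both thresholds: [t1] gives N <= n and
   [t2] gives S <= s. *)
pose K := (Num.bound ((N.+1%:R * c b) / c a1) + Num.bound ((S + c b + eta) / c a1))%N.
have r0 : 0 <= c a1 / c a2 by rewrite divr_ge0 // ltW.
have ep0 : 0 < eta / c a2 by rewrite divr_gt0.
have [q [p [Kq qp]]] := dirichlet_large K r0 ep0.
pose t := q%:R * c a1.
have tp : `|t - p%:R * c a2| <= eta.
  have -> : t - p%:R * c a2 = (q%:R * (c a1 / c a2) - p%:R) * c a2.
    by rewrite mulrBl -mulrA divfK // gt_eqF.
  by rewrite normrM [`|c a2|]ger0_norm ?(ltW c20) // -ler_pdivlMr.
have bd x : 0 <= x -> (Num.bound (x / c a1) <= q)%N -> x < t.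
  move=> x0 h; rewrite /t -ltr_pdivrMr //.
  apply: lt_le_trans (archi_boundP _) _; first by rewrite divr_ge0 // ltW.
  by rewrite ler_nat.
have t1 : N.+1%:R * c b < t.
  apply: bd; first by rewrite mulr_ge0 // ltW.
  exact: leq_trans (leq_addr _ _) Kq.
have t2 : S + c b + eta < t.
  apply: bd; first by clear -S0 cb0 eta0; lra.
  exact: leq_trans (leq_addl _ _) Kq.
have t0 : 0 <= t / c b by rewrite divr_ge0 ?(ltW cb0) //; clear -S0 cb0 eta0 t2; lra.
(* t lies between n c b and (n + 1) c b, hence within c b / 2 of the midpoint, near which there is a
   resonance of (b, b'). *)
have /andP[n1 n2] := Num.Theory.truncn_itv t0.
set n := Num.truncn _ in n1 n2.
rewrite ler_pdivlMr // in n1; rewrite ltr_pdivrMr // in n2.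
have Nn : (N <= n)%N.
  rewrite -ltnS -(ltr_nat R) -(ltr_pM2r cb0).
  by apply: lt_trans (lt_trans t1 n2); rewrite ltr_pM2r // ltr_nat.
have [s [res s0 sn]] := hN n Nn.
rewrite -/(c b) in sn.
have {}n2 : t < (n%:R + 1) * c b by rewrite natr1.
have snt : `|s - t| <= c b / 2 + eta.
  move: sn; clear -n1 n2; rewrite !ler_norml => /andP[u1 u2].
  by apply/andP; split; lra.
have sS : S <= s.
  by move: snt; clear -t2 cb0; rewrite ler_norml => /andP[u1 _]; lra.
have w1 : `|s - q%:R * c a1| <= w by rewrite -/t /w; clear -snt eta0; lra.
have w2 : `|s - p%:R * c a2| <= w.
  rewrite (_ : s - _ = (s - t) + (t - p%:R * c a2)); last by ring.
  by apply: (le_trans (ler_normD _ _)); rewrite /w; clear -snt tp; lra.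
have near x k : 0 < x -> `|s - k%:R * c x| <= w -> `|2 * (s * x) - k%:R * pi| <= 2 * x * w.
  move=> x0 h; rewrite -(cpi x x0).
  rewrite (_ : _ - _ = 2 * x * (s - k%:R * c x)); last by ring.
  by rewrite normrM [`|2 * x|]ger0_norm ?mulr_ge0 ?(ltW x0) // ler_pM2l // mulr_gt0.
exists s; split => //.
- apply: (@resonance_gap a1 a2 (2 * a1 * w) s q S1) => //.
  + by move=> s' r' p' q'; exact: h1.
  + exact: le_trans S1S sS.
  + exact: near.
- apply: (@resonance_gap a2 a1 (2 * a2 * w) s p S2) => //.
  + by move=> s' r' p' q'; exact: h2.
  + exact: le_trans S2S sS.
  + exact: near.
have big x : 0 < x -> 2 / x <= S -> s * x != 1.
  move=> x0 h; rewrite gt_eqF //.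
  have : 2 <= s * x by rewrite -ler_pdivrMr //; exact: le_trans sS.
  by clear; move=> ?; lra.
by split; exact: big.
Qed.

Lemma phase_cases n z : exists2 e : R, e != 0 &
  (cos (phase n z) = e * cos z /\ sin (phase n z) = e * sin z) \/
  (cos (phase n z) = e * sin z /\ sin (phase n z) = - (e * cos z)).
Proof.
elim: n => [|n [e e0 IHn]].
  exists 1; rewrite ?oner_eq0 //; left.
  by rewrite /phase mul0r subr0 !mul1r.
have -> : phase n.+1 z = phase n z - pi / 2 by rewrite /phase -natr1; ring.
rewrite cosBpihalf sinBpihalf; case: IHn => -[-> ->]; first by exists e => //; right.
by exists (- e); rewrite ?oppr_eq0 //; left; rewrite !mulNr.
Qed.

(** Below pi / 2 the two sides of the cosine equation have opposite signs, so only the sine mode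
    remains. *)
Lemma trig_root_small M s al n : 0 < M -> 0 < s -> trig_root M s al n ->
  al * M < pi / 2 -> al * cos (al * M) = s * sin (al * M).
Proof.
move=> M0 s0 [al0 root] alM; have alM0 : 0 < al * M by rewrite mulr_gt0.
have cp : 0 < cos (al * M) by apply: cos_gt0_pihalf; apply/andP; split; lra.
have sp : 0 < sin (al * M) by apply: sin_gt0_pihalf; apply/andP; split; lra.
have [e e0 [[c1 s1]|[c1 s1]]] := phase_cases n (al * M); rewrite c1 s1 in root.
  have h : - (al * sin (al * M)) = s * cos (al * M).
    by apply: (mulfI e0); rewrite mulrCA -root; ring.
  have h1 : 0 < al * sin (al * M) by rewrite mulr_gt0.
  have h2 : 0 < s * cos (al * M) by rewrite mulr_gt0.
  by lra.
by apply: (mulfI e0); rewrite [RHS]mulrCA -root; ring.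
Qed.

Lemma lt_of_derive_gt0 (f df : R -> R) x y : x < y ->
  (forall t : R, is_derive t 1 f (df t)) -> (forall t, x < t < y -> 0 < df t) ->
  f x < f y.
Proof.
move=> xy fE df0; have cf := is_derive_continuous fE.
have [z zxy] := MVT xy (fun t _ => fE t) (continuous_subspaceT cf).
rewrite -subr_gt0 => ->; apply: mulr_gt0; last by lra.
by apply: df0; rewrite in_itv in zxy.
Qed.

Lemma mul_cos_lt_sin z : 0 < z < pi / 2 -> z * cos z < sin z.
Proof.
move=> /andP[z0 z1].
have : sin 0 - 0 * cos 0 < sin z - z * cos z.
  apply: (@lt_of_derive_gt0 (fun t => sin t - t * cos t) (fun t => t * sin t)) => // t.
    have := is_derive_sin t; have := is_derive_cos t => ? ?.
    by apply: is_derive_eq; rewrite /GRing.scale /=; ring.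
  move=> /andP[t0 t1]; rewrite mulr_gt0 //; apply: sin_gt0_pihalf.
  by apply/andP; split => //; lra.
by rewrite sin0 mul0r subr0 => ?; lra.
Qed.

(* z cot z is decreasing; the derivative in z of the difference of the sides
   is at most sin v cos v - v. *)
Lemma mul_cot_decreasing v z : 0 < v -> v < z -> z < pi / 2 ->
  z * cos z * sin v < v * cos v * sin z.
Proof.
move=> v0 vz z1; have pi0 := @pi_gt0 R.
suff : v * cos v * sin v - v * cos v * sin v < v * cos v * sin z - z * cos z * sin v.
  by move=> ?; lra.
apply: (@lt_of_derive_gt0 (fun t => v * cos v * sin t - t * cos t * sin v)
  (fun t => v * cos v * cos t - (cos t - t * sin t) * sin v)) => // t.
  have := is_derive_sin t; have := is_derive_cos t => ? ?.
  by apply: is_derive_eq; rewrite /GRing.scale /=; ring.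
move=> /andP[vt tz].
have sv : 0 < sin v by apply: sin_gt0_pihalf; apply/andP; split => //; lra.
have st : sin v < sin t.
  by rewrite ltr_sin // in_itv /=; apply/andP; split; lra.
have ct : cos t < cos v.
  by rewrite ltr_cos // in_itv /=; apply/andP; split; lra.
have vin : 0 < v < pi / 2 by apply/andP; split => //; lra.
have sv2 : sin v <= v by apply: sin_le; exact: ltW.
have vc := mul_cos_lt_sin vin.
have h1 : cos t * (sin v - v * cos v) <= cos v * (sin v - v * cos v).
  by rewrite ler_wpM2r ?(ltW ct) // subr_ge0 ltW.
have h2 : v * sin v * sin v < t * sin t * sin v.
  rewrite ltr_pM2r //; apply: ltr_pM => //; exact: ltW.
have h3 : v * sin v * sin v = v - v * cos v * cos v.
  have := cos2Dsin2 v => e; transitivity (v * (cos v ^+ 2 + sin v ^+ 2) - v * cos v * cos v).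
    by ring.
  by rewrite e mulr1.
have h4 : cos v * sin v <= v.
  apply: le_trans sv2; rewrite ler_piMl ?(ltW sv) //; exact: cos_le1.
have -> : v * cos v * cos t - (cos t - t * sin t) * sin v =
  t * sin t * sin v - cos t * (sin v - v * cos v) by ring.
by rewrite mulrBr in h1; lra.
Qed.

(** The frequency s = al tanh (al m) = al cot (al M) comes from the root with al M < pi / 2.
    Replacing m by a longer hyperbolic side, with trigonometric side at most M, leaves no admissible
    frequency al'. *)
Lemma shortest_side_separates m m' M : 0 < m -> m < m' -> m' <= M ->
  exists s, [/\ 0 < s, resonance s M m,
    ~ resonance s m' M, ~ resonance s M m' & s * m' != 1 /\ s * M != 1].
Proof.
move=> m0 mm' m'M; have pi0 := @pi_gt0 R.
have m'0 : 0 < m' by exact: lt_trans mm'.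
have M0 : 0 < M by exact: lt_le_trans m'M.
pose f x := cos (x * M + 0) * ch (x * m + 0) + -1 * (sin (x * M + 0) * sh (x * m + 0)).
have cf : continuous f.
  have k1 := @continuous_scaled R (@sin R) M 0 (@continuous_sin R).
  have k2 := @continuous_scaled R (@cos R) M 0 (@continuous_cos R).
  have k3 := @continuous_scaled R (@ch R) m 0 (@continuous_ch R).
  have k4 := @continuous_scaled R (@sh R) m 0 (@continuous_sh R).
  by rewrite /f; continuity.
pose q := pi / 2 / M; have qM : q * M = pi / 2 by rewrite /q divfK // gt_eqF.
have q0 : 0 < q by rewrite divr_gt0 // divr_gt0.
have f0 : 0 < f 0.
  by rewrite /f !mul0r addr0 cos0 sin0 mul0r mulr0 addr0 mul1r ch_gt0.
have fq : f q < 0.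
  rewrite /f !addr0 qM cos_pihalf sin_pihalf mul0r add0r mul1r mulN1r oppr_lt0.
  by rewrite sh_gt0 // mulr_gt0.
have [al /andP[al0 alq] fal] := ivt_zero q0 cf f0 fq.
pose s := al * sh (al * m) / ch (al * m).
have chn : ch (al * m) != 0 by rewrite gt_eqF // ch_gt0.
have chp := ch_gt0 (al * m).
have s0 : 0 < s by rewrite divr_gt0 // mulr_gt0 // sh_gt0 // mulr_gt0.
have hyp : al * sh (al * m) = s * ch (al * m) by rewrite /s divfK.
have alM : al * M < pi / 2 by rewrite -qM ltr_pM2r.
have alM0 : 0 < al * M by rewrite mulr_gt0.
have cp : 0 < cos (al * M) by apply: cos_gt0_pihalf; apply/andP; split; lra.
have trig : al * cos (al * M) = s * sin (al * M).
  move: fal; rewrite /f !addr0 => fal.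
  have e : cos (al * M) * ch (al * m) = sin (al * M) * sh (al * m) by lra.
  apply: (mulIf chn); rewrite -mulrA e.
  transitivity (al * sh (al * m) * sin (al * M)); first by ring.
  by rewrite hyp; ring.
(* As z cot z < 1. This excludes the odd hyperbolic mode on any side of half-length at most M, and
   also the values s = 1 / M and s = 1 / m'. *)
have sM : s * M < 1.
  have zin : 0 < al * M < pi / 2 by rewrite alM0.
  have h := mul_cos_lt_sin zin; rewrite -(ltr_pM2l s0) -trig in h.
  rewrite -(ltr_pM2r cp) -(ltr_pM2l al0) mul1r.
  by have -> : al * (s * M * cos (al * M)) = s * (al * M * cos (al * M)) by ring.
have sm' : s * m' < 1 by apply: le_lt_trans sM; rewrite ler_pM2l.
have nores x y : 0 < x -> x <= M -> m < y -> y <= M -> ~ resonance s x y.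
  move=> x0 xM my yM [al' [n [[al'0 hyp'] trig']]].
  have y0 : 0 < y by exact: lt_trans my.
  have chy := ch_gt0 (al' * y).
  case: hyp' => hyp'; last first.
    have h1 : sh (al' * y) <= al' * y * ch (al' * y).
      by apply: sh_le_mul_ch; rewrite mulr_ge0 // ltW.
    rewrite -(ler_pM2l s0) -hyp' in h1.
    have h2 : 1 * (al' * ch (al' * y)) <= s * y * (al' * ch (al' * y)).
      by rewrite mul1r (le_trans h1) // le_eqVlt; apply/orP; left; apply/eqP; ring.
    rewrite (ler_pM2r (mulr_gt0 al'0 chy)) in h2.
    have h3 : s * y <= s * M by rewrite ler_pM2l.
    by lra.
  (* If al' >= al, then al' tanh (al' y) > al tanh (al m) = s. If al' < al, then al' x < al M and
     the monotonicity of z cot z gives s x > s M, against x <= M. *)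
  have [aa|aa] := leP al al'.
    have h0 : al * m < al' * y.
      by apply: (@le_lt_trans _ _ (al' * m)); [rewrite ler_pM2r|rewrite ltr_pM2l].
    have h1 := tanh_increasing h0; rewrite -(ltr_pM2l al0) mulrA hyp in h1.
    have h2 : al * (ch (al * m) * sh (al' * y)) <= al' * (ch (al * m) * sh (al' * y)).
      by rewrite ler_wpM2r // mulr_ge0 ?(ltW chp) // ltW // sh_gt0 // mulr_gt0.
    have h3 : al' * (ch (al * m) * sh (al' * y)) = s * ch (al * m) * ch (al' * y).
      by rewrite mulrCA hyp'; ring.
    by lra.
  have vz : al' * x < al * M.
    by apply: (@le_lt_trans _ _ (al' * M)); [rewrite ler_pM2l|rewrite ltr_pM2r].
  have v0 : 0 < al' * x by rewrite mulr_gt0.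
  have t' := trig_root_small x0 s0 trig' (lt_trans vz alM).
  have := mul_cot_decreasing v0 vz alM.
  have sx : 0 < sin (al' * x) by apply: sin_gt0_pihalf; apply/andP; split => //; lra.
  have sz : 0 < sin (al * M) by apply: sin_gt0_pihalf; apply/andP; split => //; lra.
  have -> : al * M * cos (al * M) * sin (al' * x) =
      M * (al * cos (al * M)) * sin (al' * x) by ring.
  have -> : al' * x * cos (al' * x) * sin (al * M) =
      x * (al' * cos (al' * x)) * sin (al * M) by ring.
  rewrite trig t'.
  have -> : M * (s * sin (al * M)) * sin (al' * x) =
      M * (s * sin (al * M) * sin (al' * x)) by ring.
  have -> : x * (s * sin (al' * x)) * sin (al * M) =
      x * (s * sin (al * M) * sin (al' * x)) by ring.
  by rewrite (ltr_pM2r (mulr_gt0 (mulr_gt0 s0 sz) sx)) ltNge xM.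
exists s; split => //.
- exists al, 1%N; split; first by split => //; left.
  split => //; rewrite /phase mul1r sinBpihalf cosBpihalf -trig; ring.
- by apply: nores => //; apply: lt_le_trans mm' _.
- by apply: nores.
- by rewrite !lt_eqF.
Qed.

(** * Comparison of the two rectangles *)

Lemma same_spectrum_longest a1 a2 b1 b2 : 0 < a1 -> 0 < a2 -> 0 < b1 -> 0 < b2 ->
  same_steklov_spectrum a1 a2 b1 b2 -> Num.max b1 b2 <= Num.max a1 a2.
Proof.
move=> a10 a20 b10 b20 hs; rewrite leNgt; apply/negP; rewrite lt_max !gt_max.
have excl b b' s : 0 < s -> resonance s b1 b2 \/ resonance s b2 b1 ->
    ~ resonance s a1 a2 -> ~ resonance s a2 a1 -> s * a1 != 1 -> s * a2 != 1 -> False.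
  move=> s0 res r1 r2 n1 n2.
  have := resonance_eigenvalue b10 b20 res => /hs eig.
  by case: (steklov_eigenvalue_resonance a10 a20 s0 n1 n2 eig).
case/orP => /andP[h1 h2].
  have [s [s0 res r1 r2 [n1 n2]]] := longest_side_separates a10 a20 b20 h1 h2.
  by apply: (excl b1 b2 s s0 _ r1 r2 n1 n2); left.
have [s [s0 res r1 r2 [n1 n2]]] := longest_side_separates a10 a20 b10 h1 h2.
by apply: (excl b1 b2 s s0 _ r1 r2 n1 n2); right.
Qed.

Lemma same_spectrum_shortest a1 a2 b1 b2 : 0 < a1 -> 0 < a2 -> 0 < b1 -> 0 < b2 ->
  same_steklov_spectrum a1 a2 b1 b2 -> Num.max a1 a2 = Num.max b1 b2 ->
  Num.min b1 b2 <= Num.min a1 a2.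
Proof.
move=> a10 a20 b10 b20 hs emax; rewrite leNgt; apply/negP => lmin.
pose m := Num.min a1 a2; pose m' := Num.min b1 b2; pose M := Num.max b1 b2.
have m0 : 0 < m by rewrite lt_min a10.
have m'M : m' <= M by rewrite ge_min !le_max !lexx.
have [s [s0 res r1 r2 [n1 n2]]] := shortest_side_separates m0 lmin m'M.
have resa : resonance s a1 a2 \/ resonance s a2 a1.
  move: res; rewrite /M -emax /m; case: (leP a1 a2) => _; first by right.
  by left.
have eig := resonance_eigenvalue a10 a20 resa; move/hs: eig => eig.
have [n3 n4] : s * b1 != 1 /\ s * b2 != 1.
  by move: n1 n2; rewrite /M /m'; case: (leP b1 b2).
have : resonance s m' M \/ resonance s M m'.
  have := steklov_eigenvalue_resonance b10 b20 s0 n3 n4 eig.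
  by rewrite /M /m'; case: (leP b1 b2) => _ [] h; [left|right|right|left].
by case.
Qed.

End Separation.

Theorem corollary1p8 (R : realType) (a1 a2 a1' a2' : R)
  (ha1 : 0 < a1) (ha2 : 0 < a2) (ha1' : 0 < a1') (ha2' : 0 < a2')
  (hspec : same_steklov_spectrum a1 a2 a1' a2') :
  perm_eq [:: a1; a2] [:: a1'; a2'].
Proof.
have hspec' : same_steklov_spectrum a1' a2' a1 a2.
  by move=> sigma n; split=> /hspec.
have emax : Num.max a1 a2 = Num.max a1' a2'.
  apply/eqP; rewrite eq_le; apply/andP; split.
    exact: (same_spectrum_longest ha1' ha2' ha1 ha2 hspec').
  exact: (same_spectrum_longest ha1 ha2 ha1' ha2' hspec).
have emin : Num.min a1 a2 = Num.min a1' a2'.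
  apply/eqP; rewrite eq_le; apply/andP; split.
    exact: (same_spectrum_shortest ha1' ha2' ha1 ha2 hspec' (esym emax)).
  exact: (same_spectrum_shortest ha1 ha2 ha1' ha2' hspec emax).
have perm_min_max (x y : R) : perm_eq [:: x; y] [:: Num.min x y; Num.max x y].
  by case: (leP x y) => _ //; apply/permP => p /=; rewrite !addn0 addnC.
apply: perm_trans (perm_min_max a1 a2) _; rewrite perm_sym emin emax.
exact: perm_min_max.
Qed.
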